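(* Fix numbers of inputs $m,n\ge 1$ and finite output alphabets $\mathcal A,\mathcal B$. Let $R$ be the device-independent key rate, defined for every quantum distribution tuple $\boldsymbol P=(P_{x,y}(a,b))_{x,y,a,b}$ by $$R(\boldsymbol P)=\inf_{\rho,(M_{x,a})_a,(N_{y,b})_b}\ \sup_{\mathrm{rkp}}\ R'(\rho_{\mathrm{rk}}),$$ where the supremum is over all raw key protocols, the infimum is over all quantum realizations $(\rho,(M_{x,a})_a,(N_{y,b})_b)$ of $\boldsymbol P$, $\rho_{\mathrm{rk}}$ is the tripartite state at the end of the raw key protocol, and $R'$ is the asymptotic secret key rate (all defined in the context). Then: (i) $R$ preserves the nonlocality order: if $\boldsymbol P$ and $\boldsymbol P'$ are quantum distribution tuples and $\boldsymbol P$ is not less nonlocal than $\boldsymbol P'$, then $R(\boldsymbol P')\le R(\boldsymbol P)$. (ii) $R(\boldsymbol P)=0$ for every Bell local distribution tuple $\boldsymbol P$.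
   Context: **Distribution tuples.** Inputs are $x\in\{1,\dots,m\}$ (Alice) and $y\in\{1,\dots,n\}$ (Bob), outputs are $a\in\mathcal A$, $b\in\mathcal B$. A distribution tuple is $\boldsymbol P=(P_{x,y}(a,b))_{x,y,a,b}$ where each $P_{x,y}$ is a probability mass function on $\mathcal A\times\mathcal B$. **Quantum.** $\boldsymbol P$ is quantum if there are Hilbert spaces $\mathcal H_A,\mathcal H_B,\mathcal H_E$ ($\mathcal H_A$, $\mathcal H_B$ may be taken infinite-dimensional), a density operator $\rho$ on $\mathcal H_A\otimes\mathcal H_B\otimes\mathcal H_E$, and positive operators $M_{x,a}$ on $\mathcal H_A$, $N_{y,b}$ on $\mathcal H_B$ with $\sum_a M_{x,a}=I_A$ for all $x$ and $\sum_b N_{y,b}=I_B$ for all $y$, such that $P_{x,y}(a,b)=\operatorname{tr}(\rho\, M_{x,a}\otimes N_{y,b}\otimes I_E)$ for all $x,y,a,b$. Such $(\rho,(M_{x,a})_a,(N_{y,b})_b)$ is called a quantum realization of $\boldsymbol P$. **Bell local.** $\boldsymbol P$ is Bell local if it is a convex combination of deterministic tuples $\boldsymbol D_{\boldsymbol a,\boldsymbol b}$, $\boldsymbol a=(a_x)_x\in\mathcal A^m$, $\boldsymbol b=(b_y)_y\in\mathcal B^n$, whose component for $(x,y,a,b)$ is $\delta_{a,a_x}\delta_{b,b_y}$. Bell local tuples are quantum. **Nonlocality order.** For no-signaling tuples with the same alphabets and numbers of inputs, $\boldsymbol P$ is not less nonlocal than $\boldsymbol P'$ iff $\boldsymbol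 P'=p_0\boldsymbol L+\sum_{k\ge1}p_k\mathcal T_k(\boldsymbol P)$ with probabilities $p_k\ge0$, $\sum_{k\ge0}p_k=1$, $\boldsymbol L$ Bell local, and each $\mathcal T_k$ a composition of transformations of the following types (each also in the version for Bob's inputs/outputs): - input substitution: for given $x,x'$, every $P_{x',y}(a,b)$ is replaced by $P_{x,y}(a,b)$, the other components being unchanged; - input relabeling: a permutation of the inputs $x$; - output relabeling: for a given $x$ and a permutation $\pi$ of $\mathcal A$, every $P_{x,y}(a,b)$ is replaced by $P_{x,y}(\pi(a),b)$; - output coarse graining: for a given $x$, $\mathcal A'\subset\mathcal A$ and $a'\in\mathcal A'$, $P_{x,y}(a,b)$ becomes $\sum_{a''\in\mathcal A'}P_{x,y}(a'',b)$ if $a=a'$, $0$ if $a\in\mathcal A'\setminus\{a'\}$, and is unchanged if $a\notin\mathcal A'$. **Raw key protocols.** A raw key protocol $\mathrm{rkp}$ is given by: tuples of discrete random variables $\boldsymbol X$ (Alice's private ones), $\boldsymbol Y$ (Bob's private ones), $\boldsymbol E$ (public ones, known to Alice, Bob and Eve), independent of the quantum system, with $P_{\boldsymbol X,\boldsymbol Y,\boldsymbol E}=P_{\boldsymbol X|\boldsymbol E}P_{\boldsymbol Y|\boldsymbol E}P_{\boldsymbol E}$; a choice variable $X$ with values in $\{1,\dots,m\}$ that is a component of $\boldsymbol X$ or of $\boldsymbol E$, and a choice variable $Y$ with values in $\{1,\dots,n\}$ that is a component of $\boldsymbol Y$ or of $\boldsymbol E$; and conditional probability mass functions $P_{A|U,\boldsymbol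 X,\boldsymbol E}$ and $P_{B|V,\boldsymbol Y,\boldsymbol E}$. (When $X=x$ Alice performs measurement $x$ and gets the outcome $U$, when $Y=y$ Bob performs measurement $y$ and gets the outcome $V$; Alice then generates the raw key character $A$ from $U,\boldsymbol X,\boldsymbol E$ and Bob generates $B$ from $V,\boldsymbol Y,\boldsymbol E$.) Let $$\tilde\rho=\sum_{\boldsymbol x,\boldsymbol y,\boldsymbol e}P_{\boldsymbol X,\boldsymbol Y,\boldsymbol E}(\boldsymbol x,\boldsymbol y,\boldsymbol e)\,\Pi^{Alice}_{\boldsymbol x,\boldsymbol e}\otimes\Pi^{Bob}_{\boldsymbol y,\boldsymbol e}\otimes\Pi^{Eve}_{\boldsymbol e},$$ where $(\Pi^{Alice}_{\boldsymbol x,\boldsymbol e})$, $(\Pi^{Bob}_{\boldsymbol y,\boldsymbol e})$, $(\Pi^{Eve}_{\boldsymbol e})$ are families of mutually orthogonal rank-one projectors summing to the identity on Hilbert spaces $\mathcal H'_A,\mathcal H'_B,\mathcal H'_E$. Let $$M_a=\sum_{\boldsymbol x,\boldsymbol e,u}P_{A|U,\boldsymbol X,\boldsymbol E}(a|u,\boldsymbol x,\boldsymbol e)\,\Pi^{Alice}_{\boldsymbol x,\boldsymbol e}\otimes M_{x,u},\qquad N_b=\sum_{\boldsymbol y,\boldsymbol e,v}P_{B|V,\boldsymbol Y,\boldsymbol E}(b|v,\boldsymbol y,\boldsymbol e)\,\Pi^{Bob}_{\boldsymbol y,\boldsymbol e}\otimes N_{y,v},$$ where $x$ (resp. $y$)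 is the value of the choice variable $X$ (resp. $Y$). The state at the end of the protocol is $$\rho_{\mathrm{rk}}=\sum_{a,b}\Pi_a\otimes\Pi_b\otimes\operatorname{tr}_{\mathcal H_{AB}}\big((\tilde\rho\otimes\rho)\,(M_a\otimes N_b\otimes I'_E)\big),$$ where $\mathcal H_{AB}=\mathcal H'_A\otimes\mathcal H_A\otimes\mathcal H'_B\otimes\mathcal H_B$, $I'_E$ is the identity on $\mathcal H'_E\otimes\mathcal H_E$, and $(\Pi_a)$, $(\Pi_b)$ are families of mutually orthogonal rank-one projectors (held by Alice and Bob respectively). **Secret key rate.** For a classical-classical-quantum state $\omega$ of the form of $\rho_{\mathrm{rk}}$, $R'(\omega)$ is the large $L$ limit of $l(\omega^{\otimes L})/L$, where $l(\omega^{\otimes L})$ is the length in bits of the longest secret key Alice and Bob can achieve when they share $\omega^{\otimes L}$ with Eve, using local randomness, local classical processing and two-way public classical communication (every message becomes known to Eve). In the standard (Devetak–Winter) sense: $R'(\omega)$ is the supremum of the $r\ge0$ for which there is a sequence of such protocols, acting on $\omega^{\otimes L}$ and outputting $l_L$-bit strings to Alice and Bob, with $\liminf_L l_L/L\ge r$ and with final state (Eve holding her quantum systems and all public messages) at trace distance tending to $0$ from a state of the form $2^{-l_L}\sum_{k\in\{0,1\}^{l_L}}|k\rangle\langle k|\otimes|k\rangle\langle k|\otimes\sigma_L$. *)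

(* Defs.v *)
(* Conventions.

   - A Hilbert space with orthonormal basis indexed by I is represented as
     l^2(I), where the choiceType I is arbitrary (finite, countable or not);
     every Hilbert space is of this form up to a unitary.  The tensor product of
     l^2(I) and l^2(J) is l^2(I * J).
   - A bounded operator T is represented by its matrix coefficients
     T i j = <i|T|j>; the predicate [bounded] singles out the arrays that are
     the matrix of a bounded operator.
   - All sums over possibly infinite index sets are unconditional: they are
     limits of finite partial sums along the directed set of finite subsets.
   - A classical register with values in T is l^2(T), its mutually orthogonal
     rank-one projectors summing to the identity being the [proj t]. *)
From HB Require Import structures.
From mathcomp Require Import all_boot all_order all_algebra perm finmap.
From mathcomp Require Import complex.
From mathcomp Require Import all_classical all_reals topology normedtype.
From mathcomp Require Import ereal sequences summability.

Set Implicit Arguments.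
Unset Strict Implicit.
Unset Printing Implicit Defensive.
Import Order.TTheory GRing.Theory Num.Theory.
Import numFieldNormedType.Exports.
Local Open Scope classical_set_scope.
Local Open Scope ring_scope.
Local Open Scope complex_scope.

Section Operators.
Variable R : realType.
Implicit Types I J : choiceType.

Definition csum I (f : I -> R[i]) : R[i] := sum (R := (R[i])^o) f.

Definition csum_to I (f : I -> R[i]) (l : R[i]) : Prop :=
  partial_sum f @ totally --> (l : (R[i])^o).

Definition l2 I (v : I -> R[i]) : Prop :=
  exists l, csum_to (fun i => `|v i| ^+ 2) l.

(* antilinear in the first argument *)
Definition inner I (v w : I -> R[i]) : R[i] := csum (fun i => (v i)^* * w i).

Definition op I := I -> I -> R[i].

Definition app I (T : op I) (v : I -> R[i]) : I -> R[i] :=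
  fun i => csum (fun j => T i j * v j).

Definition bounded I (T : op I) : Prop :=
  exists c : R, forall v, l2 v ->
    [/\ forall i, exists l, csum_to (fun j => T i j * v j) l,
        l2 (app T v) &
        inner (app T v) (app T v) <= c%:C * inner v v].

Definition positive I (T : op I) : Prop :=
  bounded T /\ forall v, l2 v -> 0 <= inner v (app T v).

Definition idop I : op I := fun i j => (i == j)%:R.
Definition mulop I (S T : op I) : op I :=
  fun i j => csum (fun k => S i k * T k j).
Definition adjop I (T : op I) : op I := fun i j => (T j i)^*.
Definition subop I (S T : op I) : op I := fun i j => S i j - T i j.
Definition scaleop I (c : R) (T : op I) : op I := fun i j => c%:C * T i j.

(* sum of a family of operators; convergence is coefficientwise *)
Definition sumop I (W : choiceType) (F : W -> op I) : op I :=
  fun i j => csum (fun w => F w i j).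

Definition tensor I J (S : op I) (T : op J) : op (I * J)%type :=
  fun p q => S p.1 q.1 * T p.2 q.2.

(* the rank-one projector onto the basis vector t *)
Definition proj I (t : I) : op I := fun i j => ((i == t) && (j == t))%:R.

Definition tr I (T : op I) : R[i] := csum (fun i => T i i).

(* partial trace over the first tensor factor *)
Definition ptr1 I J (T : op (I * J)%type) : op J :=
  fun j j' => csum (fun i => T (i, j) (i, j')).

Definition density I (rho : op I) : Prop :=
  positive rho /\ csum_to (fun i => rho i i) 1.

Definition tpow I (L : nat) (T : op I) : op (L.-tuple I) :=
  fun p q => \prod_(i < L) T (tnth p i) (tnth q i).

(* d = tr |T| where |T| = sqrt (T^* T) is the positive operator S such that
   S^2 = T^* T *)
Definition trace_norm_is I (T : op I) (d : R) : Prop :=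
  exists S : op I, [/\ positive S,
    forall i j, mulop S S i j = mulop (adjop T) T i j &
    csum_to (fun i => S i i) d%:C].

Definition trace_distance_is I (rho sigma : op I) (d : R) : Prop :=
  trace_norm_is (subop rho sigma) (2 * d).

Definition is_pmf I (f : I -> R) : Prop :=
  (forall t, 0 <= f t) /\ partial_sum f @ totally --> (1 : R).

End Operators.

Section Tuples.
Variables (R : realType) (m n : nat) (A B : finType).

(* P x y a b = P_{x,y}(a,b); Alice's inputs are 'I_m, Bob's are 'I_n *)
Definition dtuple := 'I_m -> 'I_n -> A -> B -> R.
Implicit Types P : dtuple.

Definition is_distribution P : Prop := forall x y,
  (forall a b, 0 <= P x y a b) /\ \sum_a \sum_b P x y a b = 1.

Definition is_povm (I : choiceType) (O : finType) (M : O -> op R I) : Prop :=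
  (forall o, positive (M o)) /\
  forall i j, \sum_o M o i j = idop R i j.

Definition quantum_realization P (I J K : choiceType)
    (rho : op R ((I * J) * K)%type)
    (M : 'I_m -> A -> op R I) (N : 'I_n -> B -> op R J) : Prop :=
  [/\ density rho,
      forall x, is_povm (M x),
      forall y, is_povm (N y) &
      forall x y a b,
        (P x y a b)%:C =
        tr (mulop rho (tensor (tensor (M x a) (N y b)) (@idop R K)))].

Definition quantum P : Prop := is_distribution P /\
  exists (I J K : choiceType) (rho : op R ((I * J) * K)%type) M N,
    quantum_realization P rho M N.

Definition deterministic (s : {ffun 'I_m -> A}) (t : {ffun 'I_n -> B}) :
  dtuple := fun x y a b => (a == s x)%:R * (b == t y)%:R.

Definition bell_local P : Prop :=
  exists q : {ffun 'I_m -> A} -> {ffun 'I_n -> B} -> R,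
    [/\ forall s t, 0 <= q s t, \sum_s \sum_t q s t = 1 &
        forall x y a b,
          P x y a b = \sum_s \sum_t q s t * deterministic s t x y a b].

Inductive elementary : Type :=
| SubstA (x x' : 'I_m)
| SubstB (y y' : 'I_n)
| PermA (s : {perm 'I_m})
| PermB (s : {perm 'I_n})
| RelabelA (x : 'I_m) (s : {perm A})
| RelabelB (y : 'I_n) (s : {perm B})
| CoarseA (x : 'I_m) (A' : {set A}) (a' : A) of a' \in A'
| CoarseB (y : 'I_n) (B' : {set B}) (b' : B) of b' \in B'.

Definition apply_elementary (e : elementary) P : dtuple :=
  match e with
  | SubstA x x' => fun x1 y a b => P (if x1 == x' then x else x1) y a b
  | SubstB y y' => fun x y1 a b => P x (if y1 == y' then y else y1) a b
  | PermA s => fun x y a b => P (s x) y a b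
  | PermB s => fun x y a b => P x (s y) a b
  | RelabelA x s => fun x1 y a b =>
      P x1 y (if x1 == x then s a else a) b
  | RelabelB y s => fun x y1 a b =>
      P x y1 a (if y1 == y then s b else b)
  | CoarseA x A' a' _ => fun x1 y a b =>
      if (x1 == x) && (a \in A')
      then if a == a' then \sum_(a'' in A') P x1 y a'' b else 0
      else P x1 y a b
  | CoarseB y B' b' _ => fun x y1 a b =>
      if (y1 == y) && (b \in B')
      then if b == b' then \sum_(b'' in B') P x y1 a b'' else 0
      else P x y1 a b
  end.

Definition apply_composition (c : seq elementary) P : dtuple :=
  foldr apply_elementary P c.

Definition not_less_nonlocal P P' : Prop :=
  exists (k : nat) (p0 : R) (p : 'I_k -> R) (Loc : dtuple)
         (T : 'I_k -> seq elementary),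
    [/\ 0 <= p0, forall i, 0 <= p i, p0 + \sum_i p i = 1, bell_local Loc &
        forall x y a b,
          P' x y a b = p0 * Loc x y a b +
                       \sum_i p i * apply_composition (T i) P x y a b].

(* A tuple of discrete random variables is a variable with values in a countable
   type; its components are functions of that value.  The tuples X, Y, E have
   values in TX, TY, TE and the raw key characters in KA, KB. *)
Record raw_key_protocol := RawKeyProtocol {
  KA : countType; KB : countType;
  TX : countType; TY : countType; TE : countType;
  pE : TE -> R;                   (* P_E *)
  pX : TE -> TX -> R;             (* P_{X|E} *)
  pY : TE -> TY -> R;             (* P_{Y|E} *)
  (* choice variables: components of X (resp. Y) or of E *)
  choiceX : (TX -> 'I_m) + (TE -> 'I_m);
  choiceY : (TY -> 'I_n) + (TE -> 'I_n);
  genA : A -> TX -> TE -> KA -> R;  (* P_{A|U,X,E} *)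
  genB : B -> TY -> TE -> KB -> R;  (* P_{B|V,Y,E} *)
  pE_pmf : is_pmf pE;
  pX_pmf : forall e, is_pmf (pX e);
  pY_pmf : forall e, is_pmf (pY e);
  genA_pmf : forall u x e, is_pmf (genA u x e);
  genB_pmf : forall v y e, is_pmf (genB v y e)
}.

Section RawKeyState.
Variables (rkp : raw_key_protocol) (I J K : choiceType).
Variable rho : op R ((I * J) * K)%type.
Variables (M : 'I_m -> A -> op R I) (N : 'I_n -> B -> op R J).

Local Notation HA' := (TX rkp * TE rkp)%type.
Local Notation HB' := (TY rkp * TE rkp)%type.
Local Notation HE' := (TE rkp).

Definition inputA (x : TX rkp) (e : TE rkp) : 'I_m :=
  match choiceX rkp with inl f => f x | inr f => f e end.

Definition inputB (y : TY rkp) (e : TE rkp) : 'I_n :=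
  match choiceY rkp with inl f => f y | inr f => f e end.

Definition rho_tilde : op R ((HA' * HB') * HE')%type :=
  sumop (fun w : (TX rkp * TY rkp) * TE rkp =>
    let: (x, y, e) := w in
    scaleop (pX e x * pY e y * pE e)
      (tensor (tensor (proj R (x, e)) (proj R (y, e))) (proj R e))).

Definition opA (a : KA rkp) : op R (HA' * I)%type :=
  sumop (fun w : (TX rkp * TE rkp) * A =>
    let: (x, e, u) := w in
    scaleop (genA u x e a) (tensor (proj R (x, e)) (M (inputA x e) u))).

Definition opB (b : KB rkp) : op R (HB' * J)%type :=
  sumop (fun w : (TY rkp * TE rkp) * B =>
    let: (y, e, v) := w in
    scaleop (genB v y e b) (tensor (proj R (y, e)) (N (inputB y e) v))).

(* rho_tilde (x) rho, with the tensor factors reordered from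
   (A' B' E') (A B E) to ((A' A) (B' B)) (E' E) *)
Definition joint_state : op R (((HA' * I) * (HB' * J)) * (HE' * K))%type :=
  fun p q =>
    let: (((a1, a), (b1, b)), (e1, e)) := p in
    let: (((a1', a'), (b1', b')), (e1', e')) := q in
    tensor rho_tilde rho
      (((a1, b1), e1), ((a, b), e)) (((a1', b1'), e1'), ((a', b'), e')).

Definition rho_rk : op R ((KA rkp * KB rkp) * (HE' * K))%type :=
  sumop (fun w : KA rkp * KB rkp =>
    tensor (tensor (proj R w.1) (proj R w.2))
      (ptr1 (mulop joint_state
               (tensor (tensor (opA w.1) (opB w.2)) (@idop R (HE' * K)%type))))).

End RawKeyState.
End Tuples.
Arguments rho_rk {R m n A B} rkp {I J K} rho M N.

Section SecretKeyRate.
Variables (R : realType) (KA KB : countType).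

(* Key distillation from L copies, with l-bit keys.  Alice and Bob draw private
   local randomness ra, rb, then alternately send public messages (Alice
   first), each message depending on the sender's raw key string, local
   randomness and all the previous messages; a silent round is a constant
   message. *)
Record distillation (L l : nat) := Distillation {
  RA : countType; RB : countType; Msg : countType;
  pRA : RA -> R; pRB : RB -> R;
  rounds : nat;
  sendA : L.-tuple KA -> RA -> seq Msg -> Msg;
  sendB : L.-tuple KB -> RB -> seq Msg -> Msg;
  keyA : L.-tuple KA -> RA -> seq Msg -> l.-tuple bool;
  keyB : L.-tuple KB -> RB -> seq Msg -> l.-tuple bool;
  pRA_pmf : is_pmf pRA;
  pRB_pmf : is_pmf pRB
}.

Section FinalState.
Variables (E : choiceType) (omega : op R ((KA * KB) * E)%type).
Variables (L l : nat) (D : distillation L l).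

Fixpoint transcript (a : L.-tuple KA) (b : L.-tuple KB) (ra : RA D) (rb : RB D)
    (k : nat) : seq (Msg D) :=
  if k is k'.+1 then
    let t := transcript a b ra rb k' in
    rcons t (if odd k' then sendB b rb t else sendA a ra t)
  else [::].

(* the block <a,b| omega^{(x) L} |a,b>, an operator on Eve's L systems *)
Definition eve_block (a : L.-tuple KA) (b : L.-tuple KB) : op R (L.-tuple E) :=
  fun e e' =>
    tpow omega [tuple ((tnth a i, tnth b i), tnth e i) | i < L]
               [tuple ((tnth a i, tnth b i), tnth e' i) | i < L].

(* factors: Alice's key, Bob's key, and Eve's (messages, quantum systems) *)
Definition final_state :
    op R ((l.-tuple bool * l.-tuple bool) * (seq (Msg D) * L.-tuple E))%type :=
  sumop (fun w : (L.-tuple KA * L.-tuple KB) * (RA D * RB D) =>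
    let: ((a, b), (ra, rb)) := w in
    let t := transcript a b ra rb (rounds D) in
    scaleop (pRA ra * pRB rb)
      (tensor (tensor (proj R (keyA a ra t)) (proj R (keyB b rb t)))
              (tensor (proj R t) (eve_block a b)))).

End FinalState.
Arguments final_state {E} omega {L l} D.

Definition ideal_state (l : nat) (F : choiceType) (sigma : op R F) :
    op R ((l.-tuple bool * l.-tuple bool) * F)%type :=
  scaleop (2 ^- l) (fun p q =>
    \sum_(k : l.-tuple bool)
       tensor (tensor (proj R k) (proj R k)) sigma p q).
Arguments ideal_state l {F} sigma.

Definition achievable_rate (E : choiceType) (omega : op R ((KA * KB) * E)%type)
    (r : R) : Prop :=
  0 <= r /\
  exists (l : nat -> nat) (D : forall L, distillation L (l L))
         (sigma : forall L, op R (seq (Msg (D L)) * L.-tuple E)%type)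
         (d : nat -> R),
    [/\ (r%:E <= limn_einf (fun L => ((l L)%:R / L%:R)%:E))%E,
        forall L, density (sigma L),
        forall L, trace_distance_is (final_state omega (D L))
                    (ideal_state (l L) (sigma L)) (d L) &
        d @ \oo --> (0 : R)].

Definition secret_key_rate (E : choiceType) (omega : op R ((KA * KB) * E)%type) :
  \bar R := ereal_sup [set r%:E | r in [set r | achievable_rate omega r]].

End SecretKeyRate.

Definition di_key_rate (R : realType) (m n : nat) (A B : finType)
    (P : dtuple R m n A B) : \bar R :=
  ereal_inf [set v | exists (I J K : choiceType)
      (rho : op R ((I * J) * K)%type) (M : 'I_m -> A -> op R I)
      (N : 'I_n -> B -> op R J),
    quantum_realization P rho M N /\
    v = ereal_sup [set s | exists rkp : raw_key_protocol R m n A B,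
                     s = secret_key_rate (rho_rk rkp rho M N)]].

(* Main.v *)
(* (i) A tuple P' below P is a mixture, over a finite flag, of local deterministic
   pre- and postprocessings of P: a Bell local tuple is the case where the outputs
   of P are ignored.  A realization of P together with one copy of the flag for
   each of Alice, Bob and Eve realizes P'.  A raw key protocol run on it can be
   simulated on the realization of P, with the flag among the public variables;
   the two final states differ by a relabelling of Eve's basis, hence have the
   same key rate.

   (ii) A protocol with constant outcomes achieves the rate 0.  For the upper
   bound, (i) reduces to a deterministic tuple, realized on one-dimensional
   spaces.  Given the public variables, the raw keys are then independent, and
   they remain so given the transcript of the distillation, because the inputs
   compatible with a transcript form a rectangle.  So the first bits of the two
   keys have a product distribution given what Eve knows, which is at a distance
   bounded below from two equal uniform bits.  The trace norm controls this
   distance since |T_ii| <= |T|_ii for hermitian T.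

   Unbounded index sets are handled by testing positivity on finitely supported
   vectors, where positive forms have finite Gram decompositions. *)

Require Import Defs.
From HB Require Import structures.
From mathcomp Require Import all_boot all_order all_algebra perm finmap.
From mathcomp Require Import complex.
From mathcomp Require Import all_classical all_reals topology normedtype.
From mathcomp Require Import ereal sequences summability.
From mathcomp Require Import ring lra.

Set Implicit Arguments.
Unset Strict Implicit.
Unset Printing Implicit Defensive.
Import Order.TTheory GRing.Theory Num.Theory.
Import numFieldNormedType.Exports.
Local Open Scope classical_set_scope.
Local Open Scope complex_scope.
Local Open Scope ring_scope.

(** * Unconditional sums *)

#[local] Existing Instance totally_filter.

(** The key rate is an infimum over realizations, so each upper bound needs only one convenient
    realization of the tuple being bounded. Eve's copy of the flag is what allows the simulation to
    treat the flag as public. [positive] and [density] quantify over all of l^2, whereas sums,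
    products and tensor products of operators are computed coefficientwise. Both notions are
    therefore translated once into statements on finite sections: [psd], the one-sided bound
    [qbound], and a convergent diagonal. The states and measurements built later are checked in that
    form. [trace_norm_is] only provides some positive [S] with the right square. Without spectral
    calculus, [S] is compared with [T] and [-T] by a continuity argument in a shift [l]. The final
    estimate is quantitative: a product state has trace distance at least 1/8 from every ideal state
    with a key of positive length. Distances tending to 0 thus force keys of length 0 from some
    point on. *)

Lemma partial_sumE (I : choiceType) (V : zmodType) (f : I -> V) (A : {fset I}) :
  partial_sum f A = \sum_(i <- A) f i.
Proof. by rewrite /partial_sum big_seq_fsetE. Qed.

(** An equality of filters, not just of limits: [csum] is a chosen limit, so it can then be
    reindexed even where convergence is unknown. Finite sets correspond by image and preimage, and
    points outside the range of [g] contribute 0. *)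
Lemma totally_reindex (I J : choiceType) (V : zmodType) (g : I -> J)
    (f : J -> V) : injective g -> (forall j, f j != 0 -> exists i, j = g i) ->
  partial_sum f @ totally = partial_sum (f \o g) @ totally :> set_system V.
Proof.
move=> gI fg.
have img (A : {fset I}) : partial_sum (f \o g) A = partial_sum f [fset g i | i in A]%fset.
  rewrite !partial_sumE big_imfset //=.
  by move=> x y _ _ /gI.
have pre (B : {fset J}) : exists A : {fset I}, (forall i, (i \in A) = (g i \in B)) /\
    partial_sum f B = partial_sum (f \o g) A.
  have [A AP] : exists A : {fset I}, forall i, (i \in A) = (g i \in B).
    (* Since [g] is injective, each point of [B] has at most one preimage; listing them shows that
       the preimage of [B] is finite. *)
    pose h j := if pselect (exists i, j = g i) is left P
                then [:: sval (cid P)] else [::].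
    exists [fset i | i in flatten (map h B)]%fset => i.
    rewrite in_fset /=; apply/idP/idP.
      move=> /flattenP[s /mapP[j jB ->]]; rewrite /h.
      case: pselect => // P; rewrite inE => /eqP ->.
      by case: cid => /= x <-.
    move=> iB; apply/flattenP; exists (h (g i)); first exact: map_f.
    rewrite /h; case: pselect => [P|[]]; last by exists i.
    by case: cid => /= x /gI ->; rewrite inE.
  exists A; split=> //; rewrite img !partial_sumE.
  apply/esym/big_fset_incl.
    by apply/fsubsetP => j /imfsetP[i /= iA ->]; rewrite -AP.
  move=> j jB jA; apply/eqP; case: eqVneq => // /fg[i ji].
  by case/negP: jA; rewrite ji; apply/imfsetP; exists i => //=; rewrite AP -ji.
apply/funext => U; apply/propext; split => -[A _ AU] /=.
- have [A' [A'P _]] := pre A.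
  exists A' => // B A'B; rewrite /= img.
  have -> : partial_sum f [fset g i | i in B]%fset =
            partial_sum f (A `|` [fset g i | i in B])%fset.
    rewrite !partial_sumE; apply: big_fset_incl; first exact: fsubsetUr.
    move=> j; rewrite in_fsetU => /orP[jA|->//] jB.
    apply/eqP; case: eqVneq => // /fg[i ji]; case/negP: jB.
    rewrite ji; apply/imfsetP; exists i => //=.
    by apply: (fsubsetP A'B); rewrite A'P -ji.
  by apply: AU; rewrite /= fsubsetUl.
- exists [fset g i | i in A]%fset => // B AB /=.
  have [B' [B'P ->]] := pre B.
  apply: AU => /=; apply/fsubsetP => i iA; rewrite B'P.
  by apply: (fsubsetP AB); apply/imfsetP; exists i.
Qed.

Section SumsTo.
Variable (K : numFieldType).

Definition sumsto (I : choiceType) (f : I -> K) (l : K) : Prop :=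
  partial_sum f @ totally --> (l : K^o).

Lemma sumstoP (I : choiceType) (f : I -> K) (l : K) :
  sumsto f l <-> forall e, 0 < e -> exists A : {fset I},
    forall B : {fset I}, (A `<=` B)%fset -> `|l - \sum_(i <- B) f i| < e.
Proof.
split.
- move=> /cvgrPdist_lt fl e e0; have [A _ AP] := fl e e0.
  by exists A => B /AP; rewrite /= partial_sumE.
- move=> fl; apply/cvgrPdist_lt => e e0; have [A AP] := fl e e0.
  by exists A => // B /AP; rewrite /= partial_sumE.
Qed.

Lemma lim_eq0 (z : K) : (forall e, 0 < e -> `|z| < e) -> z = 0.
Proof.
move=> zP; apply/eqP; apply: contraT => z0.
have := zP `|z|; rewrite normr_gt0 ltxx => /(_ z0); by [].
Qed.

(** In the partially ordered field [K] (the complex numbers later), [0 <= z] amounts to [|z| = z], a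
    condition that survives limits. *)
Lemma lim_ge0 (z : K) : (forall e, 0 < e -> exists2 x, 0 <= x & `|z - x| < e) ->
  0 <= z.
Proof.
move=> zP; suff : `|z| - z = 0 by move/eqP; rewrite subr_eq0 => /eqP <-.
apply: lim_eq0 => e e0; have [|x x0 zx] := zP (e / 2); first by rewrite divr_gt0.
rewrite [e]splitr; have -> : `|z| - z = (`|z| - x) + (x - z) by ring.
apply: le_lt_trans (ler_normD _ _) _; apply: ltrD; last by rewrite distrC.
rewrite -{1}(ger0_norm x0); apply: le_lt_trans zx; exact: ler_dist_dist.
Qed.

Section Basic.
Variable I : choiceType.
Implicit Types (f g : I -> K).

Lemma sumsto_reindex (J : choiceType) (g : I -> J) (f : J -> K) l :
  injective g -> (forall j, f j != 0 -> exists i, j = g i) ->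
  sumsto f l <-> sumsto (f \o g) l.
Proof. by move=> gI fg; rewrite /sumsto (totally_reindex gI fg). Qed.

Lemma sumsto_ext f g l : f =1 g -> sumsto f l -> sumsto g l.
Proof. by move=> /funext ->. Qed.

Lemma sumsto_uniq f l l' : sumsto f l -> sumsto f l' -> l = l'.
Proof.
move=> /sumstoP fl /sumstoP fl'; apply/eqP; rewrite -subr_eq0; apply/eqP.
apply: lim_eq0 => e e0; have e2 : 0 < e / 2 by rewrite divr_gt0.
have [A AP] := fl _ e2; have [B BP] := fl' _ e2.
set s := \sum_(i <- (A `|` B)%fset) f i.
rewrite [e]splitr; have -> : l - l' = (l - s) - (l' - s) by ring.
apply: le_lt_trans (ler_normB _ _) _.
by apply: ltrD; [apply: AP|apply: BP]; rewrite ?fsubsetUl ?fsubsetUr.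
Qed.

Lemma sumstoD f g a b : sumsto f a -> sumsto g b ->
  sumsto (fun i => f i + g i) (a + b).
Proof.
move=> /sumstoP fl /sumstoP fl'; apply/sumstoP => e e0.
have e2 : 0 < e / 2 by rewrite divr_gt0.
have [A AP] := fl _ e2; have [B BP] := fl' _ e2.
exists (A `|` B)%fset => D; rewrite fsubUset => /andP[AD BD].
rewrite big_split /= [e]splitr opprD addrACA.
by apply: le_lt_trans (ler_normD _ _) _; apply: ltrD; [exact: AP|exact: BP].
Qed.

Lemma sumstoZ c f a : sumsto f a -> sumsto (fun i => c * f i) (c * a).
Proof.
move=> /sumstoP fl; apply/sumstoP => e e0.
have c1 : 0 < `|c| + 1 by rewrite ltr_wpDl.
have [|A AP] := fl (e / (`|c| + 1)); first by rewrite divr_gt0.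
exists A => B /AP h; rewrite -mulr_sumr -mulrBr normrM.
have [->|c0] := eqVneq c 0; first by rewrite normr0 mul0r.
rewrite mulrC -ltr_pdivlMr ?normr_gt0//; apply: lt_le_trans h _.
apply: ler_wpM2l; first exact: ltW.
by rewrite lef_pV2 ?posrE ?normr_gt0// lerDl.
Qed.

Arguments sumstoZ c [f a] _.

Lemma sumstoZr c f a : sumsto f a -> sumsto (fun i => f i * c) (a * c).
Proof.
by move=> /(sumstoZ c) H; move: H; rewrite [c * a]mulrC; apply: sumsto_ext => i;
  rewrite mulrC.
Qed.

Lemma sumsto0 : sumsto (fun _ : I => 0) 0.
Proof.
by apply/sumstoP => e e0; exists fset0 => B _; rewrite big1 // subr0 normr0.
Qed.

Lemma sumsto_sum (T : Type) (s : seq T) (F : T -> I -> K) (l : T -> K) :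
  (forall t, sumsto (F t) (l t)) ->
  sumsto (fun i => \sum_(t <- s) F t i) (\sum_(t <- s) l t).
Proof.
move=> Fl; elim: s => [|t s IH].
  by rewrite big_nil; apply: sumsto_ext sumsto0 => i; rewrite big_nil.
rewrite big_cons; apply: sumsto_ext (sumstoD (Fl t) IH) => i.
by rewrite big_cons.
Qed.

Lemma sumstoB f g a b : sumsto f a -> sumsto g b ->
  sumsto (fun i => f i - g i) (a - b).
Proof.
move=> fa gb; have := sumstoD fa (sumstoZ (-1) gb); rewrite mulN1r.
by apply: sumsto_ext => i; rewrite mulN1r.
Qed.

Lemma sumsto_fin f (s : seq I) : uniq s -> (forall i, f i != 0 -> i \in s) ->
  sumsto f (\sum_(i <- s) f i).
Proof.
move=> us fs; apply/sumstoP => e e0; exists [fset i in s]%fset => B sB.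
suff -> : \sum_(i <- s) f i = \sum_(i <- B) f i by rewrite subrr normr0.
rewrite (perm_big [fset i in s]%fset) /=.
  apply: big_fset_incl => // i _; rewrite in_fset /= => /negP is_.
  by apply/eqP; apply: contraT => /fs.
by apply: uniq_perm => // i; rewrite in_fset.
Qed.

Lemma sumsto1 f (i0 : I) : (forall i, i != i0 -> f i = 0) -> sumsto f (f i0).
Proof.
move=> f0; have := @sumsto_fin f [:: i0] isT; rewrite big_seq1; apply=> i.
by apply: contraNT; rewrite inE => /f0 ->.
Qed.

Lemma sumsto_ge f l (c : K) (A0 : {fset I}) : sumsto f l ->
  (forall A : {fset I}, (A0 `<=` A)%fset -> c <= \sum_(i <- A) f i) -> c <= l.
Proof.
move=> /sumstoP fl fc; rewrite -subr_ge0; apply: lim_ge0 => e e0.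
have [A AP] := fl e e0.
exists (\sum_(i <- (A `|` A0)%fset) f i - c).
  by rewrite subr_ge0 fc// fsubsetUr.
rewrite opprB subrKA; apply: AP; exact: fsubsetUl.
Qed.

Lemma sumsto_le f l (c : K) (A0 : {fset I}) : sumsto f l ->
  (forall A : {fset I}, (A0 `<=` A)%fset -> \sum_(i <- A) f i <= c) -> l <= c.
Proof.
move=> fl fc; rewrite -lerN2.
apply: (@sumsto_ge (fun i => - f i) _ _ A0).
  by rewrite -[- l]mulN1r; apply: sumsto_ext (sumstoZ (-1) fl) => i; rewrite mulN1r.
by move=> A /fc; rewrite sumrN lerN2.
Qed.

Lemma sumsto_ge0 f l : (forall i, 0 <= f i) -> sumsto f l -> 0 <= l.
Proof. by move=> f0 /(@sumsto_ge _ _ _ fset0); apply=> A _; apply: sumr_ge0. Qed.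

Lemma sumsto_partial_le f l (A : {fset I}) : (forall i, 0 <= f i) ->
  sumsto f l -> \sum_(i <- A) f i <= l.
Proof.
move=> f0 /(@sumsto_ge _ _ _ A); apply=> B AB.
rewrite [leRHS](big_fsetID _ (mem A)) /=.
have -> : [fset i in B | i \in A]%fset = A.
  apply/fsetP => i; rewrite !inE /=; apply/andP/idP => [[]//|iA]; split=> //.
  exact: (fsubsetP AB).
by rewrite lerDl sumr_ge0.
Qed.

Lemma sumsto_seq_le f l (s : seq I) : (forall i, 0 <= f i) -> uniq s ->
  sumsto f l -> \sum_(i <- s) f i <= l.
Proof.
move=> f0 us fl; rewrite (perm_big [fset i in s]%fset) /=.
  exact: sumsto_partial_le.
by apply: uniq_perm => // i; rewrite in_fset.
Qed.

Lemma sumsto_le_sumsto f g a b : (forall i, f i <= g i) ->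
  sumsto f a -> sumsto g b -> a <= b.
Proof.
move=> fg fa gb; rewrite -subr_ge0; apply: sumsto_ge0 (sumstoB gb fa) => i.
by rewrite subr_ge0.
Qed.

End Basic.
End SumsTo.
(* [sumsto] unfolds to a product, which misleads the detection of implicit arguments. *)
Arguments sumstoZ {K I} c {f a} _.
Arguments sumstoZr {K I} c {f a} _.

Lemma ler_sum_subset (K : numDomainType) (I : eqType) (s1 s2 : seq I)
    (f : I -> K) : uniq s1 -> {subset s1 <= s2} -> (forall i, 0 <= f i) ->
  \sum_(i <- s1) f i <= \sum_(i <- s2) f i.
Proof.
move=> u12 s12 f0; elim: s1 s2 u12 s12 => [|x s1 IH] s2 /=.
  by rewrite big_nil => *; apply: sumr_ge0.
move=> /andP[xs1 us1] s12; have xs2 : x \in s2 by apply: s12; rewrite mem_head.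
rewrite (perm_big _ (perm_to_rem xs2)) !big_cons lerD2l; apply: IH => // y ys1.
have : y \in s2 by apply: s12; rewrite inE ys1 orbT.
rewrite (perm_mem (perm_to_rem xs2)) inE => /orP[/eqP yx|//].
by rewrite -yx ys1 in xs1.
Qed.

Lemma sum_ler_rect (K : numDomainType) (I J : eqType) (s1 : seq I) (s2 : seq J)
    (s : seq (I * J)) (F : I -> J -> K) :
  uniq s -> (forall p, p \in s -> p.1 \in s1 /\ p.2 \in s2) ->
  (forall i j, 0 <= F i j) ->
  \sum_(p <- s) F p.1 p.2 <= \sum_(i <- s1) \sum_(j <- s2) F i j.
Proof.
move=> us sP F0; rewrite -(@big_allpairs _ _ _ _ _ s1 s2 (fun p => F p.1 p.2)).
apply: ler_sum_subset => // -[i j] /sP[/= ? ?].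
by apply/allpairsP; exists (i, j).
Qed.

(** * Sums over products of index sets *)

Section Products.
Variable K : numFieldType.

Lemma sumsto_prod (I J : choiceType) (f : I -> K) (g : J -> K) a b :
  (forall i, 0 <= f i) -> (forall j, 0 <= g j) -> sumsto f a -> sumsto g b ->
  sumsto (fun p : I * J => f p.1 * g p.2) (a * b).
Proof.
move=> f0 g0 fa gb; apply/sumstoP => e e0.
have a0 := sumsto_ge0 f0 fa; have b0 := sumsto_ge0 g0 gb.
have pos1 x : 0 <= x -> 0 < x + 1 :> K by move=> ?; rewrite ltr_wpDl.
(* The error splits as [(a - SA) * b + SA * (b - SB)], at most [a + b] times this tolerance; the
   added 1 keeps the denominator positive and the final inequality strict. *)
have c0 : 0 < e / (a + b + 1) by rewrite divr_gt0// pos1// addr_ge0.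
have [A /(_ A (fsubset_refl _)) AP] := (sumstoP f a).1 fa _ c0.
have [B /(_ B (fsubset_refl _)) BP] := (sumstoP g b).1 gb _ c0.
exists (A `*` B)%fset => D ABD.
set S := \sum_(i <- D) _; set SA := \sum_(i <- A) f i in AP *.
set SB := \sum_(i <- B) g i in BP *.
have SAa : SA <= a by exact: sumsto_partial_le.
have SBb : SB <= b by exact: sumsto_partial_le.
have SA0 : 0 <= SA by apply: sumr_ge0.
have SB0 : 0 <= SB by apply: sumr_ge0.
have SABS : SA * SB <= S.
  rewrite /SA /SB mulr_suml; under eq_bigr do rewrite mulr_sumr.
  rewrite -(@big_allpairs _ _ _ _ _ A B (fun p => f p.1 * g p.2)).
  apply: ler_sum_subset => [||p]; last by rewrite mulr_ge0.
    by apply: allpairs_uniq => // -[? ?] [? ?].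
  move=> [i j] /allpairsP[[i' j'] /= [iA jB [-> ->]]].
  by apply: (fsubsetP ABD); rewrite in_fsetM iA.
have Sab : S <= a * b.
  apply: (@le_trans _ _ ((\sum_(i <- [fset p.1 | p in D]%fset) f i) *
                         (\sum_(j <- [fset p.2 | p in D]%fset) g j))).
    rewrite mulr_suml; under eq_bigr do rewrite mulr_sumr.
    apply: (sum_ler_rect (F := fun i j => f i * g j)) => [|p pD|i j];
      first exact: fset_uniq.
      by split; apply/imfsetP; exists p.
    by rewrite mulr_ge0.
  by apply: ler_pM; rewrite ?sumr_ge0//; apply: sumsto_partial_le.
rewrite ger0_norm ?subr_ge0//.
apply: (@le_lt_trans _ _ (a * b - SA * SB)); first by rewrite lerD2l lerN2.
have -> : a * b - SA * SB = (a - SA) * b + SA * (b - SB) by ring.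
rewrite ger0_norm ?subr_ge0// in AP; rewrite ger0_norm ?subr_ge0// in BP.
apply: (@le_lt_trans _ _ (e / (a + b + 1) * b + a * (e / (a + b + 1)))).
  apply: lerD; first by apply: ler_wpM2r => //; exact: ltW.
  by apply: ler_pM => //; [rewrite subr_ge0|exact: ltW].
have -> : e / (a + b + 1) * b + a * (e / (a + b + 1)) =
  (a + b) * (e / (a + b + 1)) by ring.
rewrite -[X in _ < X](@divfK _ (a + b + 1)) ?gt_eqF ?pos1 ?addr_ge0//.
by rewrite mulrC ltr_pM2l// ltrDl.
Qed.

Lemma sumsto_tuple (I : choiceType) L (f : 'I_L -> I -> K) (l : 'I_L -> K) :
  (forall i k, 0 <= f i k) -> (forall i, sumsto (f i) (l i)) ->
  sumsto (fun p : L.-tuple I => \prod_(i < L) f i (tnth p i)) (\prod_(i < L) l i).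
Proof.
elim: L f l => [|L IH] f l f0 fl.
  have := @sumsto1 K _ (fun p : 0.-tuple I => \prod_(i < 0) f i (tnth p i)) [tuple].
  by rewrite !big_ord0; apply=> i; rewrite tuple0 eqxx.
rewrite big_ord_recl.
pose g (q : I * L.-tuple I) : L.+1.-tuple I := [tuple of q.1 :: q.2].
rewrite (@sumsto_reindex K _ _ g).
- have g0 (t : L.-tuple I) : 0 <= \prod_(i < L) f (lift ord0 i) (tnth t i).
    exact: prodr_ge0.
  apply: sumsto_ext (sumsto_prod (f0 ord0) g0 (fl ord0)
    (IH _ _ (fun i => f0 _) (fun i => fl (lift ord0 i)))) => -[x t].
  rewrite /= big_ord_recl tnth0; congr (_ * _); apply: eq_bigr => i _.
  by rewrite tnthS.
- move=> [x t] [y u] /= /(congr1 val) /= [-> tu]; congr (_, _); exact: val_inj.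
- move=> t _; exists (thead t, behead_tuple t); apply: val_inj => /=.
  by case/tupleP: t => x t /=; rewrite theadE.
Qed.

End Products.

(** * Convergence criteria for real and complex families *)

Section RealComplex.
Variable R : realType.
Local Notation C := R[i].

Lemma ler_re (x y : C) : x <= y -> complex.Re x <= complex.Re y.
Proof. by rewrite lecE => /andP[]. Qed.

Lemma normc_real (x : R) : `|x%:C| = `|x|%:C :> C.
Proof. by rewrite normc_def /= expr0n addr0 sqrtr_sqr. Qed.

Lemma ge0_Re (x : C) : 0 <= x -> (complex.Re x)%:C = x.
Proof. by move=> /ger0_real/RRe_real. Qed.

Lemma sumsto_realC (I : choiceType) (f : I -> R) (l : R) :
  sumsto f l <-> sumsto (fun i => (f i)%:C : C) l%:C.
Proof.
split=> /sumstoP fl; apply/sumstoP => e e0.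
- have er := RRe_real (gtr0_real e0).
  have [|A AP] := fl (complex.Re e); first by rewrite -ltcR er.
  exists A => B /AP; rewrite -rmorph_sum -rmorphB normc_real.
  by rewrite -[X in _ -> _ < X]er ltcR.
- have [|A AP] := fl e%:C; first by rewrite ltcR.
  by exists A => B /AP; rewrite -rmorph_sum -rmorphB normc_real ltcR.
Qed.

Lemma sumsto_bounded_real (I : choiceType) (f : I -> R) (b : R) :
  (forall i, 0 <= f i) -> (forall A : {fset I}, \sum_(i <- A) f i <= b) ->
  exists l, sumsto f l.
Proof.
move=> f0 fb; pose S := [set x | exists A : {fset I}, x = \sum_(i <- A) f i].
have supS : has_sup S.
  split; first by exists (\sum_(i <- fset0) f i), fset0.
  by exists b => _ [A ->].
exists (sup S); apply/sumstoP => e e0.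
have [_ [A ->] AP] := sup_adherent e0 supS.
exists A => B AB.
have le1 : \sum_(i <- B) f i <= sup S by apply: ub_le_sup; [exact: supS.2|exists B].
rewrite ger0_norm ?subr_ge0// ltrBlDr -ltrBlDl; apply: lt_le_trans AP _.
by apply: ler_sum_subset => //; exact/fsubsetP.
Qed.

Lemma sumsto_bounded (I : choiceType) (f : I -> C) (b : C) :
  (forall i, 0 <= f i) -> (forall A : {fset I}, \sum_(i <- A) f i <= b) ->
  exists l, sumsto f l.
Proof.
move=> f0 fb.
have fE i : f i = (complex.Re (f i))%:C by rewrite ge0_Re.
have [|A|l fl] := @sumsto_bounded_real I (fun i => complex.Re (f i)) (complex.Re b).
- by move=> i; rewrite -ler0c -fE.
- rewrite -(raddf_sum (@complex.Re R)); apply: ler_re; exact: fb.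
- exists l%:C; apply: sumsto_ext ((sumsto_realC _ _).1 fl) => i; exact: esym.
Qed.

(** Real and imaginary parts are dominated by the modulus, and a real family [g] is the difference
    of the nonnegative families [|g| + g] and [|g|], whose partial sums are bounded. *)
Lemma sumsto_abs (I : choiceType) (f : I -> C) (b : C) :
  (forall A : {fset I}, \sum_(i <- A) `|f i| <= b) -> exists l, sumsto f l.
Proof.
move=> fb.
have real_part (g : I -> R) : (forall i, `|g i|%:C <= `|f i|) ->
    exists l, sumsto (fun i => (g i)%:C : C) l.
  move=> gf.
  have ab (A : {fset I}) : \sum_(i <- A) `|g i|%:C <= b.
    by apply: le_trans (fb A); apply: ler_sum.
  have [||l1 gl1] := @sumsto_bounded I (fun i => `|g i|%:C) b; first 2 last.
  - have [||l2 gl2] := @sumsto_bounded I (fun i => (`|g i| + g i)%:C) (b + b).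
    + by move=> i; rewrite ler0c addrC -lerBlDl sub0r -normrN ler_norm.
    + move=> A; apply: (@le_trans _ _ (\sum_(i <- A) (`|g i|%:C + `|g i|%:C))).
        by apply: ler_sum => i _; rewrite -rmorphD lecR lerD2l ler_norm.
      by rewrite big_split /= lerD.
    exists (l2 - l1); apply: sumsto_ext (sumstoB gl2 gl1) => i.
    by rewrite rmorphD /= addrC addKr.
  - by move=> i; rewrite ler0c.
  - exact: ab.
have [l1 fl1] := real_part (fun i => complex.Re (f i)) (fun i => normc_ge_Re _).
have [|l2 fl2] := real_part (fun i => complex.Im (f i)).
  move=> i; rewrite -[complex.Im _]opprK -ReiNIm normrN.
  have i1 : `|'i%C : C| = 1 by rewrite normc_def /= expr0n expr1n add0r sqrtr1.
  by apply: le_trans (normc_ge_Re _) _; rewrite normrM i1 mulr1.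
exists (l1 + 'i%C * l2).
have H := sumstoD fl1 (sumstoZ ('i%C : C) fl2).
by apply: sumsto_ext H => i; rewrite -complexE.
Qed.

Lemma csum_eq (I : choiceType) (f : I -> C) (l : C) : sumsto f l -> csum f = l.
Proof. by move=> fl; apply: (sumsto_uniq _ fl); exact: (cvgP _ fl). Qed.

Lemma csumP (I : choiceType) (f : I -> C) : (exists l, sumsto f l) -> sumsto f (csum f).
Proof. by move=> [l fl]; rewrite (csum_eq fl). Qed.

Lemma csum_reindex (I J : choiceType) (g : I -> J) (f : J -> C) :
  injective g -> (forall j, f j != 0 -> exists i, j = g i) ->
  csum f = csum (f \o g).
Proof. by move=> gI fg; rewrite /csum /sum (totally_reindex gI fg). Qed.

Lemma csum_single (I : choiceType) (f : I -> C) (i0 : I) :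
  (forall i, i != i0 -> f i = 0) -> csum f = f i0.
Proof. by move=> f0; apply/csum_eq/sumsto1. Qed.

Lemma csum_fintype (I : finType) (f : I -> C) : sumsto f (\sum_i f i).
Proof. by apply: sumsto_fin; [exact: index_enum_uniq|move=> *;
  exact: mem_index_enum]. Qed.

(** Tonelli for nonnegative families. A finite set of pairs lies in the rectangle of its
    projections, and finite sums over a rectangle can be exchanged. *)
Lemma sumsto_iter (I J : choiceType) (f : I * J -> C) (l : C) :
  (forall p, 0 <= f p) -> sumsto f l ->
  (forall j, exists a, sumsto (fun i => f (i, j)) a) /\
  sumsto (fun j => csum (fun i => f (i, j))) l.
Proof.
move=> f0 fl.
have fle (s : seq (I * J)) : uniq s -> \sum_(p <- s) f p <= l.
  by move=> us; apply: sumsto_seq_le us fl.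
have row j : exists a, sumsto (fun i => f (i, j)) a.
  apply: (@sumsto_bounded _ _ l) => // A.
  have := fle [seq (i, j) | i <- A]; rewrite big_map; apply.
  by rewrite map_inj_uniq// => ? ? [].
split=> //.
have fs (B : {fset J}) : sumsto (fun i => \sum_(j <- B) f (i, j))
    (\sum_(j <- B) csum (fun i => f (i, j))).
  by apply: sumsto_sum => j; apply: csumP.
have f0' (B : {fset J}) i : 0 <= \sum_(j <- B) f (i, j) by apply: sumr_ge0.
have Ble (B : {fset J}) : \sum_(j <- B) csum (fun i => f (i, j)) <= l.
  apply: (sumsto_le (A0 := fset0) (fs B)) => A _.
  rewrite -(@big_allpairs _ _ _ _ _ A B f); apply: fle.
  by apply: allpairs_uniq => // -[? ?] [? ?].
apply/sumstoP => e e0; have [D /(_ D (fsubset_refl _)) DP] := (sumstoP f l).1 fl e e0.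
have Dl : \sum_(p <- D) f p <= l by apply: fle; exact: fset_uniq.
exists [fset p.2 | p in D]%fset => B DB.
rewrite ger0_norm ?subr_ge0//; rewrite ger0_norm ?subr_ge0// in DP.
apply: le_lt_trans DP; rewrite lerD2l lerN2.
apply: le_trans (sumsto_partial_le [fset p.1 | p in D]%fset (f0' B) (fs B)).
have -> : \sum_(p <- D) f p = \sum_(p <- D) f (p.1, p.2).
  by apply: eq_bigr => -[].
apply: (sum_ler_rect (F := fun i j => f (i, j))) => [|p pD|i j];
  [exact: fset_uniq| |exact: f0].
split.
  by apply/imfsetP; exists p.
by apply: (fsubsetP DB); apply/imfsetP; exists p.
Qed.

End RealComplex.

(** * Positive semidefinite forms *)

Lemma eq_big_subset (V : nmodType) (I : eqType) (s1 s2 : seq I) (f : I -> V) :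
  uniq s1 -> uniq s2 -> {subset s1 <= s2} ->
  (forall i, i \notin s1 -> f i = 0) ->
  \sum_(i <- s1) f i = \sum_(i <- s2) f i.
Proof.
move=> u1 u2 s12 f0; rewrite [RHS](bigID (mem s1)) /= [X in _ + X]big1 ?addr0//.
rewrite -[RHS]big_filter; apply: perm_big; apply: uniq_perm => //.
  exact: filter_uniq.
by move=> i; rewrite mem_filter; case: (boolP (i \in s1)) => //= /s12 ->.
Qed.

Section QForms.
Variable C : numClosedFieldType.
Implicit Types I J : eqType.

Definition qform I (T : I -> I -> C) (s : seq I) (u v : I -> C) : C :=
  \sum_(i <- s) \sum_(j <- s) (u i)^* * T i j * v j.

Definition psd_on I (s : seq I) (T : I -> I -> C) : Prop :=
  forall v, 0 <= qform T s v v.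

(* Positivity is tested on finitely supported vectors only. *)
Definition psd I (T : I -> I -> C) : Prop := forall s, uniq s -> psd_on s T.

Definition sqnorm I (s : seq I) (v : I -> C) : C := \sum_(i <- s) `|v i| ^+ 2.

(** The operator inequality [T <= c]. It is one-sided; for [psd] forms it bounds the operator norm
    by [c]. *)
Definition qbound I (c : C) (T : I -> I -> C) : Prop :=
  forall s v, uniq s -> qform T s v v <= c * sqnorm s v.

Lemma qform_linl I (T : I -> I -> C) s x y u w v :
  qform T s (fun i => x * u i + y * w i) v =
  x^* * qform T s u v + y^* * qform T s w v.
Proof.
rewrite /qform !mulr_sumr -big_split /=; apply: eq_bigr => i _.
rewrite !mulr_sumr -big_split /=; apply: eq_bigr => j _.
by rewrite rmorphD !rmorphM /= !mulrDl !mulrA.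
Qed.

Lemma qform_linr I (T : I -> I -> C) s x y u w v :
  qform T s v (fun i => x * u i + y * w i) = x * qform T s v u + y * qform T s v w.
Proof.
rewrite /qform !mulr_sumr -big_split /=; apply: eq_bigr => i _.
rewrite !mulr_sumr -big_split /=; apply: eq_bigr => j _.
by rewrite mulrDr !mulrA ![_ * x]mulrC ![_ * y]mulrC !mulrA.
Qed.

Lemma qform_subset I (T : I -> I -> C) s1 s2 u v : uniq s1 -> uniq s2 ->
  {subset s1 <= s2} -> (forall i, i \notin s1 -> u i = 0) ->
  (forall i, i \notin s1 -> v i = 0) -> qform T s1 u v = qform T s2 u v.
Proof.
move=> u1 u2 s12 u0 v0; rewrite /qform.
have -> : \sum_(i <- s1) \sum_(j <- s1) (u i)^* * T i j * v j =
          \sum_(i <- s1) \sum_(j <- s2) (u i)^* * T i j * v j.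
  by apply: eq_bigr => i _; apply: eq_big_subset => // j /v0 ->; rewrite mulr0.
apply: eq_big_subset => // i /u0 ui; rewrite big1 // => j _.
by rewrite ui rmorph0 !mul0r.
Qed.

Lemma eq_qform I (T T' : I -> I -> C) s u v u' v' :
  {in s &, forall i j, T i j = T' i j} -> {in s, u =1 u'} -> {in s, v =1 v'} ->
  qform T s u v = qform T' s u' v'.
Proof.
move=> TT uu vv; rewrite /qform !big_seq; apply: eq_bigr => i si.
rewrite !big_seq; apply: eq_bigr => j sj.
by rewrite TT // uu // vv.
Qed.

Lemma psd_on_subset I (T : I -> I -> C) s1 s2 : uniq s1 -> uniq s2 ->
  {subset s1 <= s2} -> psd_on s2 T -> psd_on s1 T.
Proof.
move=> u1 u2 s12 T2 v; pose w i := if i \in s1 then v i else 0.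
have wv : {in s1, v =1 w} by move=> i; rewrite /w => ->.
rewrite (eq_qform (T' := T) (u' := w) (v' := w)) // (qform_subset T u1 u2 s12) //.
all: by move=> i; rewrite /w => /negbTE ->.
Qed.

Lemma qform_single I (T : I -> I -> C) i u v : qform T [:: i] u v = (u i)^* * T i i * v i.
Proof. by rewrite /qform !big_seq1. Qed.

Lemma psd_diag_ge0 I (T : I -> I -> C) s i : uniq s -> psd_on s T -> i \in s ->
  0 <= T i i.
Proof.
move=> us Ts si; have := @psd_on_subset _ T [:: i] s isT us _ Ts (fun=> 1).
rewrite qform_single rmorph1 mul1r mulr1; apply=> j.
by rewrite inE => /eqP ->.
Qed.

Lemma qform_pair I (T : I -> I -> C) i j u v : qform T [:: i; j] u v =
  (u i)^* * T i i * v i + (u i)^* * T i j * v j +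
  ((u j)^* * T j i * v i + (u j)^* * T j j * v j).
Proof. by rewrite /qform !big_cons !big_nil !addr0. Qed.

Lemma psd_on_pair I (T : I -> I -> C) s i j x y : uniq s -> psd_on s T ->
  i \in s -> j \in s -> i != j ->
  0 <= x^* * T i i * x + x^* * T i j * y + (y^* * T j i * x + y^* * T j j * y).
Proof.
move=> us Ts si sj ij.
have := @psd_on_subset _ T [:: i; j] s _ us _ Ts (fun k => if k == i then x else y).
rewrite qform_pair eqxx eq_sym (negbTE ij); apply.
  by rewrite /= inE ij.
by move=> k; rewrite !inE => /orP[] /eqP ->.
Qed.

(** Over the complex numbers, hermitian symmetry is part of positivity: the form is real on every
    vector, and polarization recovers the coefficients. *)
Lemma psd_on_herm I (T : I -> I -> C) s i j : uniq s -> psd_on s T ->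
  i \in s -> j \in s -> T j i = (T i j)^*.
Proof.
move=> us Ts si sj; have [<-|ij] := eqVneq i j.
  by apply/esym/CrealP/ger0_real; exact: (psd_diag_ge0 us Ts).
have real_sum x y : x^* * T i j * y + y^* * T j i * x \is Num.real.
  have h := ger0_real (psd_on_pair x y us Ts si sj ij).
  have ri : x^* * T i i * x \is Num.real.
    rewrite mulrAC mulrC; apply: realM; last by rewrite mulrC -normCK realX// normr_real.
    exact/ger0_real/(psd_diag_ge0 us Ts).
  have rj : y^* * T j j * y \is Num.real.
    rewrite mulrAC mulrC; apply: realM; last by rewrite mulrC -normCK realX// normr_real.
    exact/ger0_real/(psd_diag_ge0 us Ts).
  have := realB (realB h ri) rj.
  by congr (_ \is _); ring.
(* These two vectors make [T i j + T j i] and ['i * (T i j - T j i)] real, which determines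
   [T j i]. *)
have /CrealP h1 := real_sum 1 1; have /CrealP h2 := real_sum 1 'i.
rewrite !rmorphD !rmorphM /= !conjCK !rmorph1 !mul1r !mulr1 in h1.
rewrite !rmorphD !rmorphM /= !conjCK !rmorph1 conjCi !mul1r !mulr1 in h2.
set a := T i j in h1 h2 *; set b := T j i in h1 h2 *.
have h3 : a^* - b^* = b - a.
  apply: (@mulIf _ (- 'i)); first by rewrite oppr_eq0 neq0Ci.
  transitivity (a^* * - 'i + 'i * b^*); first by ring.
  by rewrite h2; ring.
apply: (@mulIf _ 2); first by rewrite pnatr_eq0.
transitivity ((a + b) + (b - a)); first by ring.
by rewrite -h1 -h3; ring.
Qed.

Lemma qform_conj I (T : I -> I -> C) s u v : uniq s -> psd_on s T ->
  qform T s v u = (qform T s u v)^*.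
Proof.
move=> us Ts; rewrite /qform exchange_big /= rmorph_sum big_seq [RHS]big_seq.
apply: eq_bigr => i si; rewrite rmorph_sum big_seq [RHS]big_seq.
apply: eq_bigr => j sj; rewrite !rmorphM /= conjCK (psd_on_herm us Ts si sj).
by ring.
Qed.

Lemma qform_CS I (T : I -> I -> C) s u v : uniq s -> psd_on s T ->
  `|qform T s u v| ^+ 2 <= qform T s u u * qform T s v v.
Proof.
move=> us Ts.
set a := qform T s u u; set d := qform T s v v; set b := qform T s u v.
have a0 : 0 <= a by exact: Ts. have d0 : 0 <= d by exact: Ts.
have expand x y : 0 <= x^* * (x * a + y * b) + y^* * (x * b^* + y * d).
  have := Ts (fun i => x * u i + y * v i).
  by rewrite qform_linl !qform_linr (qform_conj u v us Ts).
(* For [d] nonzero this is, up to a scalar, the vector that minimizes the form along [u + C v]. *)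
have := expand d (- b^*); rewrite rmorphN /= conjCK (CrealP (ger0_real d0)).
have -> : d * (d * a + - b^* * b) + - b * (d * b^* + - b^* * d) =
  d * (a * d - b * b^*) by ring.
rewrite -normCK; have [d_eq0 _|dn0] := eqVneq d 0; last first.
  by rewrite pmulr_rge0 ?subr_ge0// lt_def dn0.
have [->|b0] := eqVneq b 0; first by rewrite normr0 expr0n mulr_ge0.
have bb0 : b * b^* != 0 by rewrite mulf_neq0// conjC_eq0.
(* When [d = 0] the form is affine along real multiples of this direction, so a nonzero [b] would
   make it negative; this [c] gives the value [a - 2 * (a + 1)]. *)
pose c := (a + 1) / (b * b^*).
have cJ : c^* = c.
  rewrite /c rmorphM rmorphV ?unitfE// rmorphD rmorphM rmorph1 /= conjCK.
  by rewrite (CrealP (ger0_real a0)) [b^* * b]mulrC.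
have := expand 1 (- c * b^*).
rewrite d_eq0 !mulr0 !addr0 rmorph1 !mul1r rmorphM rmorphN /= conjCK cJ.
have -> : a + - c * b^* * b + - c * b * b^* = a - 2 * (c * (b * b^*)) by ring.
rewrite divfK// => h.
have : a - 2 * (a + 1) < 0.
  have -> : a - 2 * (a + 1) = - (a + 2) by ring.
  by rewrite oppr_lt0 ltr_wpDl.
by move/(le_lt_trans h); rewrite ltxx.
Qed.

Lemma psd_herm I (T : I -> I -> C) i j : psd T -> T j i = (T i j)^*.
Proof.
move=> psdT; have us := undup_uniq [:: i; j].
by apply: (psd_on_herm us (psdT _ us)); rewrite mem_undup !inE eqxx ?orbT.
Qed.

Lemma psd_ge0 I (T : I -> I -> C) i : psd T -> 0 <= T i i.
Proof. by move=> psdT; apply: (psd_diag_ge0 _ (psdT [:: i] isT)); rewrite ?inE. Qed.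

Lemma psd_on_entry I (T : I -> I -> C) s i j : uniq s -> psd_on s T ->
  i \in s -> j \in s -> `|T i j| ^+ 2 <= T i i * T j j.
Proof.
move=> us Ts si sj; have [<-|ij] := eqVneq i j.
  rewrite ger0_norm ?expr2//; exact: (psd_diag_ge0 us Ts).
have upair : uniq [:: i; j] by rewrite /= inE ij.
have Tp : psd_on [:: i; j] T.
  apply: psd_on_subset us _ Ts => // k.
  by rewrite !inE => /orP[] /eqP ->.
have := qform_CS (fun k => (k == i)%:R) (fun k => (k == j)%:R) upair Tp.
rewrite !qform_pair !eqxx (negbTE ij) [j == i]eq_sym (negbTE ij).
by rewrite !rmorph1 !rmorph0 !(mul0r, mulr0, mul1r, mulr1, addr0, add0r).
Qed.

Lemma psd_entry I (T : I -> I -> C) i j : psd T -> `|T i j| ^+ 2 <= T i i * T j j.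
Proof.
move=> psdT; have us := undup_uniq [:: i; j].
by apply: (psd_on_entry us (psdT _ us)); rewrite mem_undup !inE eqxx ?orbT.
Qed.

Lemma sqnorm_ge0 I s (v : I -> C) : 0 <= sqnorm s v.
Proof. by apply: sumr_ge0 => i _; rewrite exprn_ge0. Qed.

(* Cauchy-Schwarz for the form [T], applied to [v] and the restriction of [T v] to [s]. *)
Lemma qform_image I (T : I -> I -> C) c s v : 0 <= c -> uniq s -> psd T ->
  qbound c T -> sqnorm s (fun i => \sum_(j <- s) T i j * v j) <= c * qform T s v v.
Proof.
move=> c0 us psdT Tc; set u := fun i => _; set N := sqnorm s u.
have N0 : 0 <= N by exact: sqnorm_ge0.
have uvN : qform T s u v = N.
  rewrite /qform /N /sqnorm; apply: eq_bigr => i _.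
  by rewrite normCK mulrC /u mulr_sumr; apply: eq_bigr => j _; rewrite mulrA.
have := qform_CS u v us (psdT s us); rewrite uvN ger0_norm// => h.
have f0 := psdT s us v.
have h2 : N * N <= N * (c * qform T s v v).
  rewrite -expr2; apply: le_trans h _; rewrite mulrA [N * c]mulrC.
  by apply: ler_wpM2r => //; exact: Tc.
have [N_eq0|Nn0] := eqVneq N 0; last first.
  by move: h2; rewrite ler_pM2l// lt_def Nn0.
by rewrite N_eq0 mulr_ge0.
Qed.

Lemma qform_image_norm I (T : I -> I -> C) c s v : 0 <= c -> uniq s -> psd T ->
  qbound c T -> sqnorm s (fun i => \sum_(j <- s) T i j * v j) <= c ^+ 2 * sqnorm s v.
Proof.
move=> c0 us psdT Tc; apply: le_trans (qform_image v c0 us psdT Tc) _.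
by rewrite expr2 -mulrA; apply: ler_wpM2l => //; exact: Tc.
Qed.

(** Cholesky decomposition: split off the column of [x] as a rank-one term and continue with the
    Schur complement on [s]. If [T x x = 0], the row and column of [x] vanish by the entry bound. *)
Lemma gram I (T : I -> I -> C) s : uniq s -> psd_on s T ->
  exists ws : seq (I -> C),
    {in s &, forall i j, T i j = \sum_(w <- ws) w i * (w j)^*}.
Proof.
elim: s T => [|x s IH] T; first by exists [::].
move=> us Ts; have /andP[xs us'] := us.
have sx : {subset s <= x :: s} by move=> i si; rewrite inE si orbT.
have xx : x \in x :: s by rewrite mem_head.
have nx i : i \in s -> i != x by move=> si; apply: contraNneq xs => <-.
(* The vectors from the induction are cut to vanish at [x], so that they leave the row and column of
   [x] to the first vector. *)
pose zero (w : I -> C) i := if i == x then 0 else w i.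
have extend (T' : I -> I -> C) : psd_on s T' -> exists ws : seq (I -> C),
    {in s &, forall i j, T' i j = \sum_(w <- ws) w i * (w j)^*} /\
    {in ws, forall w : I -> C, w x = 0}.
  move=> /(IH _ us')[ws wsP]; exists [seq zero w | w <- ws]; split.
    move=> i j si sj; rewrite wsP// big_map; apply: eq_bigr => w _.
    by rewrite /zero !ifN ?nx.
  by move=> _ /mapP[w _ ->]; rewrite /zero eqxx.
have Txx := psd_diag_ge0 us Ts xx.
have [Txx0|Txxn0] := eqVneq (T x x) 0.
  have row i : i \in s -> T x i = 0.
    move=> /sx si; have := psd_on_entry us Ts xx si; rewrite Txx0 mul0r => h.
    apply/eqP; rewrite -normr_eq0 -sqrf_eq0; apply/eqP/le_anti.
    by rewrite h exprn_ge0.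
  have [ws [wsP ws0]] := extend T (psd_on_subset us' us sx Ts).
  exists ws => i j; rewrite !inE => /predU1P[->|si] /predU1P[->|sj].
  - by rewrite Txx0 big_seq big1// => w /ws0 ->; rewrite mul0r.
  - by rewrite row// big_seq big1// => w /ws0 ->; rewrite mul0r.
  - rewrite (psd_on_herm us Ts xx (sx _ si)) row// rmorph0.
    by rewrite big_seq big1// => w /ws0 ->; rewrite rmorph0 mulr0.
  - exact: wsP.
pose d := T x x; have d_gt0 : 0 < d by rewrite lt_def Txxn0.
have dJ : d^* = d by exact/CrealP/ger0_real.
pose T' i j := T i j - T i x * T x j / d.
have T's : psd_on s T'.
  move=> v; pose b := \sum_(j <- s) T x j * v j.
  have bJ : \sum_(i <- s) (v i)^* * T i x = b^*.
    rewrite rmorph_sum big_seq [RHS]big_seq; apply: eq_bigr => i si.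
    by rewrite rmorphM mulrC (psd_on_herm us Ts xx (sx _ si)).
  have T'E : qform T' s v v = qform T s v v - b^* * b / d.
    transitivity (\sum_(i <- s) (\sum_(j <- s) (v i)^* * T i j * v j -
                                 (v i)^* * T i x * (b / d))).
      apply: eq_bigr => i _; rewrite /b mulr_suml mulr_sumr -sumrB.
      by apply: eq_bigr => j _; rewrite /T'; ring.
    by rewrite sumrB -mulr_suml bJ mulrA.
  rewrite T'E.
  (* The value at [x] minimizes the form of [T] among the extensions of [v], and the minimum is the
     Schur complement at [v]. *)
  pose v' i := if i == x then - b / d else v i.
  have v'x : v' x = - b / d by rewrite /v' eqxx.
  have v's i : i \in s -> v' i = v i by move=> /nx/negbTE; rewrite /v' => ->.
  have := Ts v'; rewrite /qform !big_cons v'x.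
  have -> : \sum_(j <- s) (- b / d)^* * T x j * v' j = (- b / d)^* * b.
    rewrite /b mulr_sumr big_seq [RHS]big_seq; apply: eq_bigr => j sj.
    by rewrite v's// mulrA.
  have -> : \sum_(i <- s) \sum_(j <- x :: s) (v' i)^* * T i j * v' j =
            b^* * (- b / d) + qform T s v v.
    rewrite -bJ mulr_suml -big_split /= big_seq [RHS]big_seq.
    apply: eq_bigr => i si; rewrite big_cons v'x v's//; congr (_ + _).
    by rewrite big_seq [RHS]big_seq; apply: eq_bigr => j sj; rewrite v's.
  rewrite rmorphM rmorphN rmorphV ?unitfE//= dJ -/d.
  have -> // : - b^* / d * d * (- b / d) + - b^* / d * b +
    (b^* * (- b / d) + qform T s v v) = qform T s v v - b^* * b / d.
  by field; rewrite Txxn0.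
have [ws [wsP ws0]] := extend T' T's.
pose q := sqrtC d.
have q0 : 0 <= q by rewrite sqrtC_ge0 ltW.
have qJ : q^* = q by exact/CrealP/ger0_real.
have qn0 : q != 0 by rewrite sqrtC_eq0.
have qq : q * q = d by rewrite -expr2 sqrtCK.
exists ((fun i => T i x / q) :: ws) => i j; rewrite big_cons => xsi xsj.
rewrite rmorphM rmorphV ?unitfE//= qJ -(psd_on_herm us Ts xsj xx).
have -> : T i x / q * (T x j / q) = T i x * T x j / d.
  by rewrite -qq; field.
move: xsi xsj; rewrite !inE => /predU1P[->|si] /predU1P[->|sj].
- rewrite big_seq big1 ?addr0// => [|w /ws0 ->]; last by rewrite mul0r.
  by rewrite -/d mulfK.
- rewrite big_seq big1 ?addr0// => [|w /ws0 ->]; last by rewrite mul0r.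
  by rewrite -/d mulrAC mulfV// mul1r.
- rewrite big_seq big1 ?addr0// => [|w /ws0 ->]; last by rewrite rmorph0 mulr0.
  by rewrite -/d mulfK.
- by rewrite -wsP// /T' addrC subrK.
Qed.

Lemma qform_gram I (T : I -> I -> C) s v (ws : seq (I -> C)) :
  {in s &, forall i j, T i j = \sum_(w <- ws) w i * (w j)^*} ->
  qform T s v v = \sum_(w <- ws) `|\sum_(i <- s) (v i)^* * w i| ^+ 2.
Proof.
move=> wsP.
transitivity (\sum_(i <- s) \sum_(j <- s) \sum_(w <- ws) (v i)^* * w i * ((w j)^* * v j)).
  rewrite /qform big_seq [RHS]big_seq; apply: eq_bigr => i si.
  rewrite big_seq [RHS]big_seq; apply: eq_bigr => j sj.
  by rewrite wsP// mulr_sumr mulr_suml; apply: eq_bigr => w _; ring.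
under eq_bigr do rewrite exchange_big; rewrite exchange_big.
apply: eq_bigr => w _; rewrite normCK rmorph_sum mulr_suml; apply: eq_bigr => i _.
rewrite mulr_sumr; apply: eq_bigr => j _.
by rewrite rmorphM /= conjCK; ring.
Qed.

Lemma gram_psd I (T : I -> I -> C) :
  (forall s, uniq s -> exists ws : seq (I -> C),
    {in s &, forall i j, T i j = \sum_(w <- ws) w i * (w j)^*}) -> psd T.
Proof.
move=> TP s us v; have [ws wsP] := TP s us.
by rewrite (qform_gram v wsP); apply: sumr_ge0 => w _; rewrite exprn_ge0.
Qed.

(** Schur's product theorem: the products of Gram vectors are Gram vectors of the entrywise product.
    With [psd_pull] it yields positivity of tensor products. *)
Lemma psd_hadamard I (S T : I -> I -> C) : psd S -> psd T ->
  psd (fun i j => S i j * T i j).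
Proof.
move=> psdS psdT; apply: gram_psd => s us.
have [ws wsP] := gram us (psdS s us); have [ws' ws'P] := gram us (psdT s us).
exists [seq (fun i => w i * w' i) | w <- ws, w' <- ws'] => i j si sj.
rewrite wsP// ws'P// big_allpairs_dep /= mulr_suml; apply: eq_bigr => w _.
by rewrite mulr_sumr; apply: eq_bigr => w' _; rewrite rmorphM /=; ring.
Qed.

(** [g] may identify indices: besides submatrices this covers forms that depend on one tensor factor
    only. *)
Lemma psd_pull I J (g : I -> J) (T : J -> J -> C) : psd T ->
  psd (fun i j => T (g i) (g j)).
Proof.
move=> psdT; apply: gram_psd => s us.
have [ws wsP] := gram (undup_uniq (map g s)) (psdT _ (undup_uniq _)).
exists [seq w \o g | w : J -> C <- ws] => i j si sj.
by rewrite big_map wsP ?mem_undup ?map_f.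
Qed.

Lemma psd_rank1 I (w : I -> C) : psd (fun i j => w i * (w j)^*).
Proof. by apply: gram_psd => s us; exists [:: w] => i j _ _; rewrite big_seq1. Qed.

Lemma psd_ext I (S T : I -> I -> C) : (forall i j, S i j = T i j) -> psd S -> psd T.
Proof. by move=> ST; have -> : T = S by apply/funext => i; apply/funext. Qed.

Lemma sum_delta I (s : seq I) (f : I -> C) i : uniq s -> i \in s ->
  \sum_(j <- s) f j * (j == i)%:R = f i.
Proof.
move=> us si; rewrite (bigD1_seq i)//= eqxx mulr1 big1 ?addr0// => j /negbTE ->.
by rewrite mulr0.
Qed.

Lemma sqnorm_delta I (s : seq I) i : uniq s -> i \in s ->
  sqnorm s (fun j => (j == i)%:R) = 1.
Proof.
move=> us si; rewrite /sqnorm (bigD1_seq i)//= eqxx normr1 expr1n big1 ?addr0//.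
by move=> j /negbTE ->; rewrite normr0 expr0n.
Qed.

Lemma qform_idop I s (v : I -> C) : uniq s ->
  qform (fun i j => (i == j)%:R) s v v = sqnorm s v.
Proof.
move=> us; rewrite /qform /sqnorm big_seq [RHS]big_seq; apply: eq_bigr => i si.
rewrite (bigD1_seq i)//= big1 ?addr0 ?eqxx ?mulr1 1?mulrC -?normCK// => j ji.
by rewrite eq_sym (negbTE ji) mulr0 mul0r.
Qed.

Lemma psd_id I : psd (fun i j : I => (i == j)%:R).
Proof. by move=> s us v; rewrite qform_idop// sqnorm_ge0. Qed.

Lemma psd0 I : psd (fun i j : I => 0).
Proof. by move=> s us v; rewrite /qform big1// => i _; rewrite big1// => j _; ring. Qed.

Lemma qformD I (S T : I -> I -> C) s u v :
  qform (fun i j => S i j + T i j) s u v = qform S s u v + qform T s u v.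
Proof.
rewrite /qform -big_split; apply: eq_bigr => i _; rewrite -big_split.
by apply: eq_bigr => j _; rewrite mulrDr mulrDl.
Qed.

Lemma qformZ I c (T : I -> I -> C) s u v :
  qform (fun i j => c * T i j) s u v = c * qform T s u v.
Proof.
rewrite /qform mulr_sumr; apply: eq_bigr => i _; rewrite mulr_sumr.
by apply: eq_bigr => j _; ring.
Qed.

Lemma qformB I (S T : I -> I -> C) s u v :
  qform (fun i j => S i j - T i j) s u v = qform S s u v - qform T s u v.
Proof.
rewrite -[qform T _ _ _]mul1r -mulNr -qformZ -qformD.
by apply: eq_qform => // i j _ _; rewrite mulN1r.
Qed.

Lemma psdD I (S T : I -> I -> C) : psd S -> psd T -> psd (fun i j => S i j + T i j).
Proof. by move=> psdS psdT s us v; rewrite qformD addr_ge0//;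
  [exact: psdS|exact: psdT]. Qed.

Lemma psdZ I c (T : I -> I -> C) : 0 <= c -> psd T -> psd (fun i j => c * T i j).
Proof. by move=> c0 psdT s us v; rewrite qformZ mulr_ge0//; exact: psdT. Qed.

Lemma psd_sum I (K : Type) (r : seq K) (P : pred K) (F : K -> I -> I -> C) :
  (forall k, P k -> psd (F k)) -> psd (fun i j => \sum_(k <- r | P k) F k i j).
Proof.
move=> psdF; elim: r => [|k r IH].
  by apply: psd_ext (@psd0 I) => i j; rewrite big_nil.
case Pk : (P k).
  apply: psd_ext (psdD (psdF k Pk) IH) => i j; by rewrite big_cons Pk.
by apply: psd_ext IH => i j; rewrite big_cons Pk.
Qed.

Lemma psd_prod I (K : Type) (r : seq K) (F : K -> I -> I -> C) :
  (forall k, psd (F k)) -> psd (fun i j => \prod_(k <- r) F k i j).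
Proof.
move=> psdF; elim: r => [|k r IH].
  apply: psd_ext (@psd_rank1 I (fun=> 1)) => i j.
  by rewrite big_nil rmorph1 mulr1.
by apply: psd_ext (psd_hadamard (psdF k) IH) => i j; rewrite big_cons.
Qed.

Lemma psd_tensor I J (S : I -> I -> C) (T : J -> J -> C) : psd S -> psd T ->
  psd (fun p q : I * J => S p.1 q.1 * T p.2 q.2).
Proof. by move=> psdS psdT; apply: psd_hadamard; exact: psd_pull. Qed.

Lemma qbound_effect I (c : C) (T : I -> I -> C) :
  psd (fun i j => c * (i == j)%:R - T i j) <-> qbound c T.
Proof.
split=> h s; first by move=> v us; have := h s us v;
  rewrite qformB qformZ qform_idop// subr_ge0.
by move=> us v; rewrite qformB qformZ qform_idop// subr_ge0 h.
Qed.

(** The trace dominates the norm: it is the total squared norm of the Gram vectors, and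
    Cauchy-Schwarz applies to each of them. *)
Lemma qform_trace_bound I (T : I -> I -> C) s v : psd T -> uniq s ->
  qform T s v v <= (\sum_(i <- s) T i i) * sqnorm s v.
Proof.
move=> psdT us; have [ws wsP] := gram us (psdT s us).
rewrite (qform_gram v wsP).
have -> : \sum_(i <- s) T i i = \sum_(w <- ws) sqnorm s w.
  rewrite /sqnorm exchange_big [LHS]big_seq [RHS]big_seq; apply: eq_bigr => i si.
  by rewrite wsP//; apply: eq_bigr => w _; rewrite normCK.
rewrite mulr_suml; apply: ler_sum => w _.
have := qform_CS v w us (@psd_id I s us); rewrite !qform_idop// mulrC.
congr (_ <= _); congr (`|_| ^+ 2); rewrite /qform big_seq [RHS]big_seq.
apply: eq_bigr => i si; rewrite (bigD1_seq i)//= big1 ?addr0 ?eqxx ?mulr1// => j ji.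
by rewrite eq_sym (negbTE ji) mulr0 mul0r.
Qed.

Lemma sqnorm_conj (I : eqType) (A : seq I) (f : I ->
  C) : sqnorm A (fun i => (f i)^*) = sqnorm A f.
Proof. by apply: eq_bigr => i _; rewrite norm_conjC. Qed.

Lemma sqnorm_sub (I : eqType) (s1 s2 : seq I) (v : I -> C) : uniq s1 ->
  {subset s1 <= s2} -> sqnorm s1 v <= sqnorm s2 v.
Proof. by move=> u1 s12; apply: ler_sum_subset => // i; rewrite exprn_ge0. Qed.

Lemma sqnorm_restrict (I : eqType) (s1 s2 : seq I) (v : I -> C) : uniq s1 -> uniq s2 ->
  {subset s1 <= s2} -> sqnorm s2 (fun i => if i \in s1 then v i else 0) = sqnorm s1 v.
Proof.
move=> u1 u2 s12; rewrite /sqnorm.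
rewrite -(@eq_big_subset _ _ s1 s2)//.
  by rewrite big_seq [RHS]big_seq; apply: eq_bigr => i ->.
by move=> i /negbTE ->; rewrite normr0 expr0n.
Qed.

(* Against phases the diagonal of [rho X] becomes, by a Gram decomposition of
   [rho], a sum of matrix elements of the contraction [X]. *)
Lemma psd_trace_phase I (rho X : I -> I -> C) (s A B : seq I) (th : I -> C) :
  psd rho -> psd X -> qbound 1 X -> uniq s -> {subset A <= s} -> {subset B <= s} ->
  uniq A -> uniq B -> (forall i, `|th i| <= 1) ->
  `|\sum_(k <- B) \sum_(i <- A) th i * (rho i k * X k i)| <= \sum_(i <- s) rho i i.
Proof.
move=> psd_rho psdX X1 us As Bs uA uB th1.
have [ws wsP] := gram us (psd_rho s us).
pose u (w : I -> C) k := if k \in B then w k else 0.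
pose v (w : I -> C) i := if i \in A then th i * w i else 0.
have -> : \sum_(k <- B) \sum_(i <- A) th i * (rho i k * X k i) =
    \sum_(w <- ws) qform X s (u w) (v w).
  rewrite /qform exchange_big; under [RHS]eq_bigr do rewrite exchange_big.
  rewrite /= [RHS]exchange_big /= -(@eq_big_subset _ _ A s)//; last first.
    move=> i iA; rewrite big1// => w _; rewrite big1// => k _.
    by rewrite /v (negbTE iA) mulr0.
  rewrite [LHS]big_seq [RHS]big_seq; apply: eq_bigr => i iA.
  rewrite [RHS]exchange_big /= -(@eq_big_subset _ _ B s)//; last first.
    move=> k kB; rewrite big1// => w _.
    by rewrite /u (negbTE kB) rmorph0 !mul0r.
  rewrite [LHS]big_seq [RHS]big_seq; apply: eq_bigr => k kB.
  rewrite wsP; [|exact: As|exact: Bs]; rewrite mulr_suml mulr_sumr; apply: eq_bigr => w _.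
  by rewrite /u /v iA kB; ring.
apply: le_trans (ler_norm_sum _ _ _) _.
suff <- : \sum_(w <- ws) sqnorm s w = \sum_(i <- s) rho i i.
  apply: ler_sum => w _.
  rewrite -ler_sqr ?nnegrE ?normr_ge0 ?sqnorm_ge0//.
  apply: le_trans (qform_CS (u w) (v w) us (psdX s us)) _.
  rewrite expr2; apply: ler_pM; rewrite ?psdX//.
    apply: le_trans (X1 _ _ us) _; rewrite mul1r; apply: ler_sum => i _.
    by rewrite /u; case: ifP => // _; rewrite normr0 expr0n exprn_ge0.
  apply: le_trans (X1 _ _ us) _; rewrite mul1r; apply: ler_sum => i _.
  rewrite /v; case: ifP => _; last by rewrite normr0 expr0n exprn_ge0.
  rewrite normrM exprMn -[leRHS]mul1r; apply: ler_wpM2r; first by rewrite exprn_ge0.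
  by rewrite exprn_ile1.
rewrite /sqnorm exchange_big [LHS]big_seq [RHS]big_seq; apply: eq_bigr => i si.
by rewrite wsP//; apply: eq_bigr => w _; rewrite normCK.
Qed.

End QForms.

(** * Positive operators and densities *)

Section Operators.
Variable R : realType.
Local Notation C := R[i].
Implicit Type I : choiceType.

Lemma sumsto_norm_le (K : numFieldType) I (f : I -> K) l b : sumsto f l ->
  (forall A : {fset I}, `|\sum_(i <- A) f i| <= b) -> `|l| <= b.
Proof.
move=> /sumstoP fl fb; rewrite -subr_ge0; apply: lim_ge0 => e e0.
have [A /(_ A (fsubset_refl _)) AP] := fl e e0.
exists (b - `|\sum_(i <- A) f i|); first by rewrite subr_ge0.
have -> : b - `|l| - (b - `|\sum_(i <- A) f i|) =
  `|\sum_(i <- A) f i| - `|l| by ring.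
by rewrite distrC; apply: le_lt_trans AP; exact: ler_dist_dist.
Qed.

Lemma ler_normM_sqr (x y : C) : `|x * y| <= `|x| ^+ 2 + `|y| ^+ 2.
Proof.
rewrite normrM -subr_ge0.
have xy0 : 0 <= `|x| * `|y| by rewrite mulr_ge0.
have -> : `|x| ^+ 2 + `|y| ^+ 2 - `|x| * `|y| =
  (`|x| - `|y|) ^+ 2 + `|x| * `|y| by ring.
by rewrite addr_ge0// real_exprn_even_ge0// realB// normr_real.
Qed.

Lemma ler_sqrtC_norm (x y : C) : 0 <= y -> `|x| ^+ 2 <= y -> `|x| <= sqrtC y.
Proof.
by move=> y0; rewrite -{1}[y]sqrtCK ler_sqr ?nnegrE ?sqrtC_ge0.
Qed.

Lemma sumsto_l2_mul I (f g : I -> C) (a b : C) :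
  (forall A : {fset I}, sqnorm A f <= a) -> (forall A : {fset I}, sqnorm A g <= b) ->
  exists l, sumsto (fun i => f i * g i) l.
Proof.
move=> fa gb; apply: (@sumsto_abs _ _ _ (a + b)) => A.
apply: (@le_trans _ _ (sqnorm A f + sqnorm A g)); last exact: lerD.
rewrite /sqnorm -big_split; apply: ler_sum => i _; exact: ler_normM_sqr.
Qed.

(** * Positive operators and their finite sections *)

Section PsdPositive.
Variables (I : choiceType) (T : op R I).

Lemma app_fin (v : I -> C) (s : seq I) i : uniq s ->
  (forall j, j \notin s -> v j = 0) -> app T v i = \sum_(j <- s) T i j * v j.
Proof.
move=> us v0; apply: csum_eq; apply: sumsto_fin => // j.
by apply: contraNT => /v0 ->; rewrite mulr0.
Qed.

Lemma l2_fin (v : I -> C) (s : seq I) : uniq s ->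
  (forall j, j \notin s -> v j = 0) -> sumsto (fun i => `|v i| ^+ 2) (sqnorm s v).
Proof.
move=> us v0; apply: sumsto_fin => // j.
by apply: contraNT => /v0 ->; rewrite normr0 expr0n.
Qed.

Lemma inner_fin (v w : I -> C) (s : seq I) : uniq s ->
  (forall j, j \notin s -> v j = 0) -> inner v w = \sum_(i <- s) (v i)^* * w i.
Proof.
move=> us v0; apply: csum_eq; apply: sumsto_fin => // j.
by apply: contraNT => /v0 ->; rewrite rmorph0 mul0r.
Qed.

Lemma positive_psd : positive T -> psd T.
Proof.
move=> [_ Tpos] s us v; pose w i := if i \in s then v i else 0.
have w0 j : j \notin s -> w j = 0 by rewrite /w => /negbTE ->.
have := Tpos w; rewrite (inner_fin _ us w0).
have -> : \sum_(i <- s) (w i)^* * app T w i = qform T s v v.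
  rewrite /qform big_seq [RHS]big_seq; apply: eq_bigr => i si.
  rewrite (app_fin _ us w0) mulr_sumr big_seq [RHS]big_seq.
  by apply: eq_bigr => j sj; rewrite /w si sj mulrA.
by apply; exists (sqnorm s w); exact: l2_fin.
Qed.

Lemma positive_qbound : positive T -> exists2 c : R, 0 <= c & qbound c%:C T.
Proof.
move=> Tpos; have psdT := positive_psd Tpos; have [[c Tc] _] := Tpos.
(* The constant of [bounded] controls the square of the norm, and [|x * y| <= |x|^2 + |y|^2]
   termwise bounds the form at [w] by the squared norms of [w] and [T w]. *)
exists (1 + `|c|) => [|s v us]; first by rewrite addr_ge0.
pose w i := if i \in s then v i else 0.
have w0 j : j \notin s -> w j = 0 by rewrite /w => /negbTE ->.
have wl2 := l2_fin us w0.
have [|_ [l Tl] le] := Tc w; first by exists (sqnorm s w).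
have sw : sqnorm s w = sqnorm s v.
  rewrite /sqnorm big_seq [RHS]big_seq; apply: eq_bigr => i si.
  by rewrite /w si.
have fw : qform T s v v = \sum_(i <- s) (w i)^* * app T w i.
  rewrite /qform big_seq [RHS]big_seq; apply: eq_bigr => i si.
  rewrite (app_fin _ us w0) mulr_sumr big_seq [RHS]big_seq.
  by apply: eq_bigr => j sj; rewrite /w si sj mulrA.
have Tle : sqnorm s (app T w) <= `|c|%:C * sqnorm s v.
  apply: (@le_trans _ _ (inner (app T w) (app T w))).
    have -> : inner (app T w) (app T w) = l.
      by apply: csum_eq; apply: sumsto_ext Tl => i; rewrite normCKC.
    by apply: sumsto_seq_le Tl => // i; rewrite exprn_ge0.
  apply: le_trans le _; rewrite (inner_fin _ us w0).
  have -> : \sum_(i <- s) (w i)^* * w i = sqnorm s v.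
    by rewrite -sw; apply: eq_bigr => i _; rewrite normCKC.
  by apply: ler_wpM2r; [exact: sqnorm_ge0|rewrite lecR ler_norm].
rewrite -[leLHS]ger0_norm ?psdT// fw.
apply: le_trans (ler_norm_sum _ _ _) _.
apply: (@le_trans _ _ (sqnorm s w + sqnorm s (app T w))).
  rewrite /sqnorm -big_split; apply: ler_sum => i _.
  by rewrite -(norm_conjC (w i)); exact: ler_normM_sqr.
by rewrite sw rmorphD rmorph1 mulrDl mul1r lerD2l.
Qed.

Section Bounded.
Variable c : C.
Hypotheses (c0 : 0 <= c) (psdT : psd T) (Tc : qbound c T).

Lemma psd_column_bound i (A : seq I) : uniq A -> sqnorm A (fun j => T j i) <= c ^+ 2.
Proof.
move=> uA; pose s := undup (i :: A); have us : uniq s by exact: undup_uniq.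
have is_ : i \in s by rewrite mem_undup mem_head.
have := qform_image_norm (fun k => (k == i)%:R) c0 us psdT Tc.
rewrite sqnorm_delta//.
rewrite mulr1; apply: le_trans.
have -> : sqnorm s (fun i0 => \sum_(j <- s) T i0 j * (j == i)%:R) = sqnorm s (fun j =>
  T j i).
  apply: eq_bigr => j _; congr (`|_| ^+ 2).
  exact: sum_delta.
by apply: sqnorm_sub => // k kA; rewrite mem_undup inE kA orbT.
Qed.

Lemma psd_row_bound i (A : seq I) : uniq A -> sqnorm A (T i) <= c ^+ 2.
Proof.
move=> uA; rewrite -[leLHS]sqnorm_conj; apply: le_trans (psd_column_bound i uA).
by rewrite le_eqVlt; apply/orP; left; apply/eqP/eq_bigr => j _; rewrite -psd_herm.
Qed.

(** The bound [|<u, T w>| <= c |u| |w|] for [u] cut to [A] and [w] square summable: Cauchy-Schwarz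
    for the form on finite sections, then a limit in [w] only. *)
Lemma pair_bound (A : {fset I}) (u w : I -> C) W l :
  (forall B : {fset I}, sqnorm B w <= W) ->
  sumsto (fun j => (\sum_(i <- A) (u i)^* * T i j) * w j) l ->
  `|l| <= sqrtC (c ^+ 2 * sqnorm A u * W).
Proof.
move=> wW /sumsto_norm_le; apply=> B.
have W0 : 0 <= W by apply: le_trans (wW fset0); exact: sqnorm_ge0.
apply: ler_sqrtC_norm; first by rewrite !mulr_ge0 ?exprn_ge0 ?sqnorm_ge0.
pose s := (A `|` B)%fset; have us : uniq s by exact: fset_uniq.
have As : {subset A <= s} by apply/fsubsetP; exact: fsubsetUl.
have Bs : {subset B <= s} by apply/fsubsetP; exact: fsubsetUr.
pose u' i := if i \in (A : seq I) then u i else 0.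
pose w' i := if i \in (B : seq I) then w i else 0.
have -> : \sum_(j <- B) (\sum_(i <- A) (u i)^* * T i j) * w j = qform T s u' w'.
  under eq_bigr do rewrite mulr_suml.
  rewrite exchange_big /qform -(@eq_big_subset _ _ A s)//; last first.
    move=> i iA; rewrite big1// => j _.
    by rewrite /u' (negbTE iA) rmorph0 !mul0r.
  rewrite [LHS]big_seq [RHS]big_seq; apply: eq_bigr => i iA.
  rewrite -(@eq_big_subset _ _ B s)//; last first.
    by move=> j jB; rewrite /w' (negbTE jB) mulr0.
  rewrite [LHS]big_seq [RHS]big_seq; apply: eq_bigr => j jB.
  by rewrite /u' /w' iA jB.
apply: le_trans (qform_CS u' w' us (psdT us)) _.
have -> : c ^+ 2 * sqnorm A u * W = (c * sqnorm A u) * (c * W) by ring.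
apply: ler_pM; rewrite ?psdT//.
  by apply: le_trans (Tc u' us) _; rewrite sqnorm_restrict ?fset_uniq.
apply: le_trans (Tc w' us) _; rewrite sqnorm_restrict ?fset_uniq//.
by apply: ler_wpM2l.
Qed.

Section Vector.
Variables (v : I -> C) (V : C).
Hypothesis vV : sumsto (fun i => `|v i| ^+ 2) V.

Let vle (A : {fset I}) : sqnorm A v <= V.
Proof. by apply: sumsto_partial_le vV => i; rewrite exprn_ge0. Qed.

Let V0 : 0 <= V.
Proof. by apply: sumsto_ge0 vV => i; rewrite exprn_ge0. Qed.

Lemma app_sumsto i : sumsto (fun j => T i j * v j) (app T v i).
Proof.
by apply/csumP; apply: sumsto_l2_mul vle => A; exact: psd_row_bound.
Qed.

Let pair_sumsto (A : {fset I}) (u : I -> C) :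
  sumsto (fun j => (\sum_(i <- A) (u i)^* * T i j) * v j)
         (\sum_(i <- A) (u i)^* * app T v i).
Proof.
have := @sumsto_sum _ _ _ A (fun i j => (u i)^* * (T i j * v j))
  (fun i => (u i)^* * app T v i) (fun i => sumstoZ _ (@app_sumsto i)).
apply: sumsto_ext => j; rewrite mulr_suml; apply: eq_bigr => i _.
by rewrite mulrA.
Qed.

(** Pairing [T v] with its own restriction to [A] gives [N <= sqrt (c^2 N V)], and one factor [N]
    cancels. *)
Lemma app_norm_le (A : {fset I}) : sqnorm A (app T v) <= c ^+ 2 * V.
Proof.
have := pair_bound vle (@pair_sumsto A (app T v)).
have -> : \sum_(i <- A) (app T v i)^* * app T v i = sqnorm A (app T v).
  by apply: eq_bigr => i _; rewrite normCKC.
set N := sqnorm A _; have N0 : 0 <= N by exact: sqnorm_ge0.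
have cV : 0 <= c ^+ 2 * V by rewrite mulr_ge0 ?exprn_ge0.
rewrite ger0_norm// -[leLHS](@sqrCK _ N)// => h.
have : N ^+ 2 <= N * (c ^+ 2 * V).
  rewrite -[leRHS]sqrtCK ler_sqr ?nnegrE ?sqrtC_ge0 ?mulr_ge0//.
  by rewrite [N * _]mulrC mulrAC -{1}(sqrCK N0).
have [->|Nn0] := eqVneq N 0; first by [].
by rewrite expr2 ler_pM2l// lt_def Nn0.
Qed.

(** The inner product is a limit of [qform T A v v]. The error has two parts: the tail of the outer
    sum, and the pairing of [v] on [A] with the tail [w] of [v]. *)
Lemma inner_app_ge0 : 0 <= inner v (app T v).
Proof.
have [z vTv] : exists z, sumsto (fun i => (v i)^* * app T v i) z.
  apply: (@sumsto_l2_mul _ _ _ V (c ^+ 2 * V)) => A; last exact: app_norm_le.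
  by rewrite sqnorm_conj.
rewrite /inner (csum_eq vTv); apply: lim_ge0 => e e0.
have e2 : 0 < e / 2 by rewrite divr_gt0.
have [A1 A1P] := (sumstoP _ _).1 vTv _ e2.
(* [pair_bound] gives a squared error of at most [c^2 * V] times the squared norm of the tail; a
   tail below [d] brings it under [(e / 2)^2], and the 1 makes [k] invertible. *)
pose k := c ^+ 2 * V + 1; have k0 : 0 < k by rewrite ltr_wpDl ?mulr_ge0 ?exprn_ge0.
pose d := (e / 2) ^+ 2 / k; have d0 : 0 < d by rewrite divr_gt0// exprn_gt0.
have [A2 A2P] := (sumstoP _ _).1 vV _ d0.
pose A := (A1 `|` A2)%fset; exists (qform T A v v); first exact: psdT.
have h1 := A1P A (fsubsetUl _ _).
have hV : V - sqnorm A v < d.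
  by have := A2P A (fsubsetUr _ _); rewrite -/(sqnorm A v) ger0_norm ?subr_ge0.
pose w j := if j \in A then 0 else v j.
have us (B : {fset I}) : uniq (B `|` A)%fset by exact: fset_uniq.
have Wle (B : {fset I}) : sqnorm B w <= V - sqnorm A v.
  have AB : {subset A <= (B `|` A)%fset} by apply/fsubsetP; exact: fsubsetUr.
  rewrite lerBrDr; apply: le_trans (vle (B `|` A)%fset).
  apply: (@le_trans _ _ (sqnorm (B `|` A)%fset w + sqnorm A v)).
    by rewrite lerD2r; apply: sqnorm_sub; rewrite ?fset_uniq//; apply/fsubsetP/fsubsetUl.
  rewrite -(sqnorm_restrict v (fset_uniq A) (us B) AB) /sqnorm -big_split /=.
  apply: ler_sum => i _; rewrite /w; case: ifP => _.
    by rewrite normr0 expr0n add0r.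
  by rewrite normr0 expr0n addr0.
have diff : sumsto (fun j => (\sum_(i <- A) (v i)^* * T i j) * w j)
   (\sum_(i <- A) (v i)^* * app T v i - qform T A v v).
  pose g j := (\sum_(i <- A) (v i)^* * T i j) * v j.
  have gA : sumsto (fun j => if j \in A then g j else 0) (qform T A v v).
    have -> : qform T A v v = \sum_(j <- A) if j \in A then g j else 0.
      rewrite /qform exchange_big [LHS]big_seq [RHS]big_seq; apply: eq_bigr => j ->.
      by rewrite /g mulr_suml.
    apply: sumsto_fin; first exact: fset_uniq.
    by move=> j; case: ifP => //; rewrite eqxx.
  apply: sumsto_ext (sumstoB (@pair_sumsto A v) gA) => j.
  by rewrite /w /g; case: ifP => _; rewrite ?subrr ?subr0 ?mulr0.
have h := pair_bound Wle diff.
set x := \sum_(i <- A) _ in h1 h diff.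
rewrite [e]splitr; have -> : z - qform T A v v = (z - x) + (x - qform T A v v) by ring.
apply: le_lt_trans (ler_normD _ _) _; apply: ltrD => //.
apply: le_lt_trans h _; set Y := _ * (V - _).
have Y0 : 0 <= Y by rewrite !mulr_ge0 ?exprn_ge0 ?sqnorm_ge0// subr_ge0.
rewrite -ltr_sqr ?nnegrE ?sqrtC_ge0 ?(ltW e2)// sqrtCK /Y.
apply: (@le_lt_trans _ _ ((k - 1) * (V - sqnorm A v))).
  rewrite /k addrK; apply: ler_wpM2r; first by rewrite subr_ge0.
  by apply: ler_wpM2l; rewrite ?exprn_ge0.
apply: (@le_lt_trans _ _ (k * (V - sqnorm A v))).
  by apply: ler_wpM2r; rewrite ?subr_ge0// gerBl.
by rewrite mulrC -ltr_pdivlMr.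
Qed.

End Vector.
(** The converse of [positive_psd] and [positive_qbound]; through it positivity on l^2 is
    established from finite sections. *)
Lemma psd_positive : positive T.
Proof.
have cR : (complex.Re (c ^+ 2))%:C = c ^+ 2 by rewrite ge0_Re ?exprn_ge0.
split; last by move=> v [V vV]; exact: inner_app_ge0 vV.
exists (complex.Re (c ^+ 2)) => v [V vV].
have vle := app_norm_le vV.
have [l Tvl] : exists l, sumsto (fun i => `|app T v i| ^+ 2) l.
  by apply: sumsto_bounded vle => i; rewrite exprn_ge0.
split.
- by move=> i; exists (app T v i); exact: (@app_sumsto v V vV i).
- by exists l.
- have -> : inner (app T v) (app T v) = l.
    by apply: csum_eq; apply: sumsto_ext Tvl => i; rewrite normCKC.
  have -> : inner v v = V.
    by apply: csum_eq; apply: sumsto_ext vV => i; rewrite normCKC.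
  by rewrite cR; apply: (sumsto_le (A0 := fset0) Tvl) => A _; exact: vle.
Qed.

End Bounded.

Lemma psd_trace_qbound : psd T -> sumsto (fun i => T i i) 1 -> qbound 1 T.
Proof.
move=> psdT T1 s v us; apply: le_trans (qform_trace_bound v psdT us) _.
apply: ler_wpM2r; first exact: sqnorm_ge0.
by apply: sumsto_seq_le T1 => // i; exact: psd_ge0.
Qed.

(** Boundedness comes for free: a positive form of trace 1 is below the identity. *)
Lemma densityP : density T <-> psd T /\ sumsto (fun i => T i i) 1.
Proof.
split=> [[Tpos T1]|[psdT T1]]; first by split=> //; exact: positive_psd.
by split=> //; apply: (psd_positive ler01 psdT); exact: psd_trace_qbound.
Qed.

End PsdPositive.

(** * Convergence of traces of a density times an effect *)

Section TraceClass.
Variables (I : choiceType) (rho : op R I).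
Hypotheses (psd_rho : psd rho) (tr_rho : sumsto (fun i => rho i i) 1).

Let rho1 : qbound 1 rho := psd_trace_qbound psd_rho tr_rho.

Lemma mulop_sumsto (X : op R I) p q : psd X -> qbound 1 X ->
  sumsto (fun k => rho p k * X k q) (mulop rho X p q).
Proof.
move=> psdX X1; apply: csumP; apply: (@sumsto_l2_mul _ _ _ 1 1) => A.
  by rewrite -[leRHS](expr1n _ 2); apply: psd_row_bound => //; exact: fset_uniq.
by rewrite -[leRHS](expr1n _ 2); apply: psd_column_bound => //; exact: fset_uniq.
Qed.

(** Absolute convergence of the trace of [rho X], uniformly in [A]: once phases replace the absolute
    values, the double sums over finite sets are bounded by the trace of [rho]. *)
Lemma mulop_diag_bound (X : op R I) (A : {fset I}) : psd X -> qbound 1 X ->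
  \sum_(i <- A) `|mulop rho X i i| <= 1.
Proof.
move=> psdX X1; pose z i := mulop rho X i i.
(* Where [z i = 0] the phase is 0, as the inverse of 0 is 0. *)
pose th i := `|z i| / z i.
have thz i : th i * z i = `|z i|.
  rewrite /th; have [->|z0] := eqVneq (z i) 0; first by rewrite mulr0 normr0.
  by rewrite divfK.
have th1 i : `|th i| <= 1.
  rewrite /th; have [->|z0] := eqVneq (z i) 0; first by rewrite invr0 mulr0 normr0.
  by rewrite normrM normr_id normfV divff// normr_eq0.
have S : sumsto (fun k => \sum_(i <- A) th i * (rho i k * X k i))
    (\sum_(i <- A) `|z i|).
  rewrite (eq_bigr (fun i => th i * z i)); last by move=> i _; rewrite thz.
  by apply: sumsto_sum => i; apply: sumstoZ; exact: mulop_sumsto.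
rewrite -[leLHS]ger0_norm ?sumr_ge0//; apply: sumsto_norm_le S _ => B.
pose s := (A `|` B)%fset; have us : uniq s by exact: fset_uniq.
have As : {subset A <= s} by apply/fsubsetP; exact: fsubsetUl.
have Bs : {subset B <= s} by apply/fsubsetP; exact: fsubsetUr.
apply: le_trans (psd_trace_phase psd_rho psdX X1 us As Bs (fset_uniq _) (fset_uniq _)
  th1) _.
by apply: sumsto_partial_le tr_rho => i; exact: psd_ge0.
Qed.

Lemma tr_mulop_sumsto (X : op R I) : psd X -> qbound 1 X ->
  sumsto (fun i => mulop rho X i i) (tr (mulop rho X)).
Proof.
by move=> psdX X1; apply: csumP; apply: (@sumsto_abs _ _ _ 1) => A;
  exact: mulop_diag_bound.
Qed.

Lemma tr_mulop_sum (K : Type) (r : seq K) (a : K -> C) (X : K -> op R I) :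
  (forall k, psd (X k)) -> (forall k, qbound 1 (X k)) ->
  sumsto (fun i => mulop rho (fun p q => \sum_(k <- r) a k * X k p q) i i)
    (\sum_(k <- r) a k * tr (mulop rho (X k))).
Proof.
move=> psdX X1.
have H := @sumsto_sum _ _ _ r _ _ (fun k => sumstoZ (a k) (tr_mulop_sumsto (psdX k) (X1
  k))).
apply: sumsto_ext H => i; rewrite /mulop; apply/esym/csum_eq.
have H := @sumsto_sum _ _ _ r _ _ (fun k => sumstoZ (a k) (@mulop_sumsto _ i i (psdX k)
  (X1 k))).
apply: sumsto_ext H => j.
by rewrite mulr_sumr; apply: eq_bigr => k _; ring.
Qed.

End TraceClass.

End Operators.

(** * Absolute value of a hermitian operator *)

Section SquareRootStep.
Variable C : numClosedFieldType.
Implicit Types I : eqType.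

Lemma sqr_normD_le (x y eta : C) : 0 < eta ->
  `|x + y| ^+ 2 <= (1 + eta) * `|x| ^+ 2 + (1 + eta^-1) * `|y| ^+ 2.
Proof.
move=> eta0; apply: (@le_trans _ _ ((`|x| + `|y|) ^+ 2)).
  by rewrite ler_sqr ?nnegrE ?addr_ge0// ler_normD.
rewrite -subr_ge0.
have -> : (1 + eta) * `|x| ^+ 2 + (1 + eta^-1) * `|y| ^+ 2 - (`|x| + `|y|) ^+ 2 =
  eta^-1 * (eta * `|x| - `|y|) ^+ 2 by field; rewrite gt_eqF.
rewrite mulr_ge0 ?invr_ge0 ?(ltW eta0)// real_exprn_even_ge0//.
by rewrite realB ?realM ?normr_real// ger0_real ?ltW.
Qed.

(** Compare the norms of both sides of [(S + lam) v = T v + F v]. On the left the cross term is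
    nonnegative as [S] is positive; on the right the weighted triangle inequality applies and
    [|F v|^2] is at most [k <v, F v>]. The window [t] is larger than the support [s] because the
    images of [v] leave [s]. *)
Lemma sqrt_step I (S T F : I -> I -> C) lam k eta (s t : seq I) (v : I -> C) :
  (forall i j, F i j = S i j - T i j + lam * (i == j)%:R) ->
  uniq s -> uniq t -> {subset s <= t} -> psd S -> psd F -> 0 <= k -> qbound k F ->
  0 <= lam -> 0 < eta ->
  sqnorm t (fun i => \sum_(j <- s) S i j * v j) + lam ^+ 2 * sqnorm s v <=
  (1 + eta) * sqnorm t (fun i => \sum_(j <- s) T i j * v j) +
    (1 + eta^-1) * (k * qform F s v v).
Proof.
move=> FE us ut st psdS psdF k0 Fk lam0 eta0.
pose w i := if i \in s then v i else 0.
have w0 i : i \notin s -> w i = 0 by rewrite /w => /negbTE ->.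
have app (X : I -> I -> C) i : \sum_(j <- t) X i j * w j = \sum_(j <- s) X i j * v j.
  rewrite -(@eq_big_subset _ _ s t)//; last by move=> j /w0 ->; rewrite mulr0.
  by rewrite big_seq [RHS]big_seq; apply: eq_bigr => j sj; rewrite /w sj.
have qf (X : I -> I -> C) : qform X t w w = qform X s v v.
  rewrite -(@qform_subset _ _ X s t)//; apply: eq_qform => // i si;
  by rewrite /w si.
have lamJ : lam^* = lam by exact/CrealP/ger0_real.
pose Sv i := \sum_(j <- s) S i j * v j; pose Tv i := \sum_(j <- s) T i j * v j.
pose Fv i := \sum_(j <- t) F i j * w j.
have Fvk : sqnorm t Fv <= k * qform F s v v by rewrite -qf; exact: qform_image.
have FvE i : i \in t -> Sv i + lam * w i = Tv i + Fv i.
  move=> ti; rewrite /Sv /Tv /Fv -!app -big_split /=.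
  have -> : lam * w i = \sum_(j <- t) lam * (i == j)%:R * w j.
    rewrite -(@sum_delta _ _ t w i)// mulr_sumr; apply: eq_bigr => j _.
    by rewrite eq_sym; ring.
  by rewrite -big_split /=; apply: eq_bigr => j _; rewrite FE; ring.
have cross : \sum_(i <- t) (w i)^* * Sv i = qform S s v v.
  rewrite -qf /qform; apply: eq_bigr => i _; rewrite /Sv -app mulr_sumr.
  by apply: eq_bigr => j _; rewrite mulrA.
have lhs : sqnorm t (fun i => Sv i + lam * w i) =
    sqnorm t Sv + (lam * qform S s v v + lam * (qform S s v v)^*) + lam ^+ 2 * sqnorm s v.
  have -> : sqnorm s v = sqnorm t w by rewrite /w sqnorm_restrict.
  rewrite -cross rmorph_sum /sqnorm !mulr_sumr -!big_split /=; apply: eq_bigr => i _.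
  by rewrite !normCK !rmorphD !rmorphM /= conjCK lamJ; ring.
apply: (@le_trans _ _ (sqnorm t (fun i => Sv i + lam * w i))).
  rewrite lhs lerD2r lerDl (CrealP (ger0_real (psdS s us v))).
  by rewrite addr_ge0// mulr_ge0// psdS.
apply: (@le_trans _ _ ((1 + eta) * sqnorm t Tv + (1 + eta^-1) * sqnorm t Fv)).
  rewrite /sqnorm !mulr_sumr -big_split /= [leLHS]big_seq [leRHS]big_seq;
    apply: ler_sum => i ti.
  by rewrite FvE//; exact: sqr_normD_le.
by rewrite lerD2l; apply: ler_wpM2l => //; rewrite addr_ge0// invr_ge0 ltW.
Qed.

Lemma sqr_norm_sum_expand I (X : I -> I -> C) s (v : I -> C) i :
  `|\sum_(j <- s) X i j * v j| ^+ 2 =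
  \sum_(j <- s) \sum_(j' <- s) (v j)^* * v j' * ((X i j)^* * X i j').
Proof.
rewrite normCKC rmorph_sum mulr_suml; apply: eq_bigr => j _.
rewrite mulr_sumr; apply: eq_bigr => j' _.
by rewrite rmorphM /=; ring.
Qed.

Lemma qform_image_norm_subset I (T : I -> I -> C) c (s t : seq I) v : 0 <= c ->
  uniq s -> uniq t -> {subset s <= t} -> psd T -> qbound c T ->
  sqnorm t (fun i => \sum_(j <- s) T i j * v j) <= c ^+ 2 * sqnorm s v.
Proof.
move=> c0 us ut st psdT Tc; pose w i := if i \in s then v i else 0.
have -> : sqnorm s v = sqnorm t w by rewrite /w sqnorm_restrict.
have -> : sqnorm t (fun i => \sum_(j <- s) T i j * v j) =
          sqnorm t (fun i => \sum_(j <- t) T i j * w j).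
  apply: eq_bigr => i _; congr (`|_| ^+ 2).
  rewrite -(@eq_big_subset _ _ s t)//.
    by rewrite big_seq [RHS]big_seq; apply: eq_bigr => j sj; rewrite /w sj.
  by move=> j; rewrite /w => /negbTE ->; rewrite mulr0.
exact: qform_image_norm.
Qed.

End SquareRootStep.

(** * Comparison of a hermitian operator with its absolute value *)

Section AbsoluteValue.
Variables (R : realType) (I : choiceType).
Local Notation C := R[i].
Implicit Types S T X : op R I.

Definition l2_columns X := forall j, exists b : C,
  forall A : {fset I}, sqnorm A (fun i => X i j) <= b.

(** The squared norm of [X v] as a form in the coefficients of adjoint times [X]. In this way the
    hypothesis on the square of [S] becomes [|S v| = |T v|] for finitely supported [v]. *)
Lemma image_sqnorm_sumsto X s (v : I -> C) : l2_columns X ->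
  sumsto (fun i => `|\sum_(j <- s) X i j * v j| ^+ 2)
    (\sum_(j <- s) \sum_(j' <- s) (v j)^* * v j' * mulop (adjop X) X j j').
Proof.
move=> X2.
have H j j' : sumsto (fun i => (X i j)^* * X i j') (mulop (adjop X) X j j').
  have [b Xb] := X2 j; have [b' Xb'] := X2 j'.
  by apply: csumP; apply: (@sumsto_l2_mul _ _ _ _ b b') => // A; rewrite sqnorm_conj.
have K j := @sumsto_sum _ _ _ s _ _ (fun j' => sumstoZ ((v j)^* * v j') (@H j j')).
have L := @sumsto_sum _ _ _ s _ _ K.
by apply: sumsto_ext L => i; rewrite sqr_norm_sum_expand.
Qed.

Lemma psd_l2_columns (c : C) X : 0 <= c -> psd X -> qbound c X -> l2_columns X.
Proof.
move=> c0 psdX Xc j; exists (c ^+ 2) => A.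
by apply: psd_column_bound => //; exact: fset_uniq.
Qed.

Lemma psd_adjop X i j : psd X -> adjop X i j = X i j.
Proof. by move=> psdX; rewrite (psd_herm j i psdX). Qed.

(* If [l] is the least [l >= 0] with [T <= S + l] and [l > 0], vectors on which
   [S + l - T] is nearly degenerate satisfy [T v ~ S v + l v], whence
   [|T v| > |S v|], contradicting [T^2 = S^2]. *)
Lemma psd_sqrt_sub S T (c d : R) : 0 <= c -> 0 <= d -> psd S -> qbound c%:C S ->
  (forall i j, T j i = (T i j)^*) -> qbound d%:C T -> qbound d%:C (fun i j => - T i j) ->
  l2_columns T -> (forall i j, mulop S S i j = mulop (adjop T) T i j) ->
  psd (fun i j => S i j - T i j).
Proof.
move=> c0 d0 psdS Sc Therm Td TNd T2 ST.
pose F (l : R) : op R I := fun i j => S i j - T i j + l%:C * (i == j)%:R.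
have FE l s v : uniq s -> qform (F l) s v v =
    qform S s v v - qform T s v v + l%:C * sqnorm s v.
  by move=> us; rewrite /F qformD qformB qformZ qform_idop.
have Fmono l l' : l <= l' -> psd (F l) -> psd (F l').
  move=> ll' Fl s us v; apply: le_trans (Fl s us v) _; rewrite !FE// lerD2l.
  by apply: ler_wpM2r; [exact: sqnorm_ge0|rewrite lecR].
have Fk l : qbound (c + d + l)%:C (F l).
  move=> s v us; rewrite FE// !rmorphD /= !mulrDl lerD2r; apply: lerD; first exact: Sc.
  have -> : - qform T s v v = qform (fun i j => - T i j) s v v.
    by rewrite -mulN1r -qformZ; apply: eq_qform => // i j _ _; rewrite mulN1r.
  exact: TNd.
have step l : 0 < l -> psd (F l) -> exists2 e : R, 0 < e & psd (F (l - e)).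
  move=> l0 Fl.
  (* Chosen so that [eta * c^2 <= l^2 / 2]: the excess [eta |T v|^2] then uses up at most half of
     [l^2 |v|^2]. *)
  pose eta : R := l ^+ 2 / (2 * (c ^+ 2 + 1)).
  have eta0 : 0 < eta by rewrite divr_gt0 ?mulr_gt0 ?exprn_gt0// ltr_wpDl ?exprn_ge0.
  pose k := c + d + l; have k0 : 0 < k by rewrite ltr_wpDl ?addr_ge0.
  (* The other half of [l^2 |v|^2] is at most [(1 + eta^-1) k <v, F v>], so [F l >= e] and the shift
     can be lowered by [e]. *)
  pose e := l ^+ 2 / 2 / ((1 + eta^-1) * k).
  have M0 : 0 < (1 + eta^-1) * k by rewrite mulr_gt0// ltr_wpDr// invr_ge0 ltW.
  have e0 : 0 < e by rewrite divr_gt0// divr_gt0// exprn_gt0.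
  exists e => // s us v.
  have key : (l ^+ 2 / 2)%:C * sqnorm s v <= ((1 + eta^-1) * k)%:C * qform (F l) s v v.
    pose Sv i := \sum_(j <- s) S i j * v j; pose Tv i := \sum_(j <- s) T i j * v j.
    pose sg := \sum_(j <- s) \sum_(j' <- s) (v j)^* * v j' * mulop (adjop T) T j j'.
    have Tsg : sumsto (fun i => `|Tv i| ^+ 2) sg by exact: image_sqnorm_sumsto.
    have Ssg : sumsto (fun i => `|Sv i| ^+ 2) sg.
      have := @image_sqnorm_sumsto S s v (psd_l2_columns _ psdS Sc).
      rewrite ler0c => /(_ c0); congr sumsto; apply: eq_bigr => j _;
        apply: eq_bigr => j' _.
      congr (_ * _); rewrite -ST; apply: (congr1 (@csum R I)); apply/funext => i.
      by rewrite psd_adjop.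
    (* [sqrt_step] holds on each finite window [A] containing [s]; as [A] grows, both squared norms
       tend to the same [sg]. *)
    have ineq := sumsto_ge (A0 := [fset i in s]%fset) (c := (l ^+ 2)%:C * sqnorm s v -
      ((1 + eta^-1) * k)%:C * qform (F l) s v v) (sumstoB (sumstoZ (1 + eta%:C) Tsg) Ssg).
    have sgle : sg <= (c ^+ 2)%:C * sqnorm s v.
      apply: (sumsto_le (A0 := [fset i in s]%fset) Ssg) => A sA.
      rewrite rmorphXn; apply: qform_image_norm_subset => //; rewrite ?ler0c ?fset_uniq//.
      by move=> i si; apply: (fsubsetP sA); rewrite in_fset.
    have {}ineq : (l ^+ 2)%:C * sqnorm s v - ((1 + eta^-1) * k)%:C * qform (F l) s v v
        <= (1 + eta%:C) * sg - sg.
      apply: ineq => A sA; rewrite sumrB -mulr_sumr.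
      rewrite lerBrDr addrAC lerBlDr.
      have := @sqrt_step _ _ S T (F l) l%:C k%:C eta%:C s A v _ us (fset_uniq _) _ psdS
        Fl.
      have -> : ((1 + eta^-1) * k)%:C = (1 + eta%:C^-1) * k%:C.
        by rewrite rmorphM rmorphD rmorph1 fmorphV.
      rewrite mulrA rmorphXn /= addrC => H; apply: H => //.
      + by move=> i si; apply: (fsubsetP sA); rewrite in_fset.
      + by rewrite ler0c ltW.
      + exact: Fk.
      + by rewrite ler0c ltW.
      + by rewrite ltcR.
    move: ineq; have -> : (1 + eta%:C) * sg - sg = eta%:C * sg by ring.
    rewrite lerBlDr => ineq.
    have etac : eta * c ^+ 2 <= l ^+ 2 / 2.
      rewrite /eta -mulrA; rewrite ler_pM2l ?exprn_gt0//.
      rewrite invfM -mulrA ger_pMr ?invr_gt0// mulrC ler_pdivrMr ?mul1r ?lerDl//.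
      by rewrite ltr_wpDl ?exprn_ge0.
    have e1 : eta%:C * sg <= (l ^+ 2 / 2)%:C * sqnorm s v.
      apply: (@le_trans _ _ (eta%:C * ((c ^+ 2)%:C * sqnorm s v))).
        by apply: ler_wpM2l => //; rewrite ler0c ltW.
      by rewrite mulrA -rmorphM; apply: ler_wpM2r; [exact: sqnorm_ge0|rewrite lecR].
    have : (l ^+ 2)%:C * sqnorm s v <= (l ^+ 2 / 2)%:C * sqnorm s v +
      ((1 + eta^-1) * k)%:C * qform (F l) s v v.
      by apply: le_trans ineq _; rewrite lerD2r.
    rewrite {1}[l ^+ 2]splitr [X in X * _]rmorphD mulrDl lerD2l; exact.
  have -> : qform (F (l - e)) s v v = qform (F l) s v v - e%:C * sqnorm s v.
    by rewrite !FE// rmorphB mulrBl addrA.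
  rewrite subr_ge0 -(@ler_pM2l _ ((1 + eta^-1) * k)%:C) ?ltcR// mulrA -rmorphM.
  by have -> : (1 + eta^-1) * k * e = l ^+ 2 / 2 by rewrite /e mulrC divfK// gt_eqF.
pose E := [set l : R | 0 <= l /\ psd (F l)].
have Ed : E d.
  split=> // s us v; rewrite FE// addrAC subr_ge0; apply: le_trans (Td s v us) _.
  by rewrite lerDr psdS.
have infE : has_inf E by split; [exists d|exists 0 => l []].
pose l := inf E.
have l0 : 0 <= l by apply: lb_le_inf; [exists d|move=> x []].
(* Each form is continuous in the shift, so positivity persists at the infimum. *)
have Fl : psd (F l).
  move=> s us v; apply: lim_ge0 => e e0.
  have N0 := sqnorm_ge0 s v; have NE := ge0_Re N0; set n := complex.Re _ in NE.
  have n0 : 0 <= n by rewrite -ler0c NE.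
  have eE := RRe_real (gtr0_real e0).
  have d1 : 0 < complex.Re e / (n + 1).
    by rewrite divr_gt0 ?ltr_wpDl// -ltcR eE.
  have [l' [l'0 Fl'] l'l] := inf_adherent d1 infE.
  exists (qform (F l') s v v); first exact: Fl'.
  have ll' : l <= l' by apply: ge_inf => //; exact: infE.2.
  have -> : qform (F l) s v v - qform (F l') s v v = - ((l' - l) * n)%:C.
    by rewrite !FE// rmorphM rmorphB /= NE; ring.
  rewrite normrN normc_real -eE ltcR ger0_norm; last by rewrite mulr_ge0// subr_ge0.
  apply: (@le_lt_trans _ _ ((l' - l) * (n + 1))).
    by apply: ler_wpM2l; rewrite ?subr_ge0// lerDl.
  by rewrite -ltr_pdivlMr ?ltr_wpDl// ltrBlDl.
have [l_gt0|] := ltP 0 l; last first.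
  move=> l_le0; have l_eq0 : l = 0 by apply/le_anti; rewrite l_le0.
  apply: psd_ext Fl => i j; by rewrite /F l_eq0 mul0r addr0.
have [e e0 Fle] := step _ l_gt0 Fl.
(* The maximum keeps the lowered shift in [E], where shifts are nonnegative; as [l] and [e] are
   positive, this contradicts minimality. *)
have : l <= Num.max 0 (l - e).
  apply: ge_inf; first exact: infE.2.
  split; first by rewrite le_max lexx.
  by apply: Fmono Fle; rewrite le_max lexx orbT.
by rewrite le_max lt_geF//= lerBrDl gerDr lt_geF.
Qed.

(* [S] is [|T|], so the trace norm dominates the l1-norm of the diagonal. *)
Lemma diag_le_sqrt S T (c d : R) i : 0 <= c -> 0 <= d -> psd S -> qbound c%:C S ->
  (forall i j, T j i = (T i j)^*) -> qbound d%:C T -> qbound d%:C (fun i j => - T i j) ->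
  l2_columns T -> (forall i j, mulop S S i j = mulop (adjop T) T i j) ->
  `|T i i| <= S i i.
Proof.
move=> c0 d0 psdS Sc Therm Td TNd T2 ST.
have h1 := psd_ge0 i (psd_sqrt_sub c0 d0 psdS Sc Therm Td TNd T2 ST).
have h2 : 0 <= S i i - - T i i.
  apply: (psd_ge0 i (psd_sqrt_sub (T := fun i j => - T i j) c0 d0 psdS Sc _ TNd _ _ _)).
  - by move=> p q; rewrite rmorphN Therm.
  - by move=> s v us; rewrite (eq_qform (T' := T) (u' := v) (v' :=
      v))// ?Td// => p q _ _; rewrite opprK.
  - move=> j; have [b Tb] := T2 j; exists b => A.
    by apply: le_trans (Tb A); apply: ler_sum => k _; rewrite normrN.
  - move=> p q; rewrite ST; apply: (congr1 (@csum R I)); apply/funext => k.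
    by rewrite /adjop rmorphN mulrNN.
have rT : T i i \is Num.real by apply/CrealP; rewrite -Therm.
rewrite opprK in h2; rewrite real_ler_norml//; apply/andP; split.
  by rewrite -subr_ge0 opprK addrC.
by rewrite -subr_ge0.
Qed.

End AbsoluteValue.

(** * Relabelling Eve's system *)

Section Reindexing.
Variables (R : realType) (I J : choiceType) (f : I -> J) (g : J -> I).
Hypotheses (fK : cancel f g) (gK : cancel g f).
Local Notation C := R[i].

Let f_inj : injective f := can_inj fK.

Lemma sumsto_bij (K : numFieldType) (h : J -> K) l :
  sumsto (fun i => h (f i)) l <-> sumsto h l.
Proof.
by rewrite (@sumsto_reindex K _ _ f h l f_inj)// => j _; exists (g j); rewrite gK.
Qed.

Lemma csum_bij (h : J -> C) : csum (fun i => h (f i)) = csum h.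
Proof.
by rewrite (@csum_reindex R _ _ f h f_inj)// => j _; exists (g j); rewrite gK.
Qed.

Definition pullop (T : op R J) : op R I := fun i i' => T (f i) (f i').

Lemma mulop_pullop (S T : op R J) : mulop (pullop S) (pullop T) = pullop (mulop S T).
Proof. by apply/funext => i; apply/funext => j;
  apply: (csum_bij (fun k => S (f i) k * T k (f j))). Qed.

Lemma qbound_pullop (c : C) (T : op R J) : qbound c T -> qbound c (pullop T).
Proof.
move=> /qbound_effect Tc; apply/qbound_effect.
apply: psd_ext (psd_pull f Tc) => i j; by rewrite (inj_eq f_inj).
Qed.

Lemma positive_pullop (T : op R J) : positive T -> positive (pullop T).
Proof.
move=> Tpos; have psdT := positive_psd Tpos.
have [c c0 Tc] := positive_qbound Tpos.
apply: (@psd_positive _ _ _ c%:C); first by rewrite ler0c.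
  exact: (psd_pull f psdT).
exact: qbound_pullop.
Qed.

Lemma density_pullop (T : op R J) : density T -> density (pullop T).
Proof.
move=> /densityP[psdT T1]; apply/densityP; split; first exact: (psd_pull f psdT).
exact/(sumsto_bij (fun j => T j j)).
Qed.

Lemma trace_norm_pullop (T : op R J) d : trace_norm_is T d -> trace_norm_is (pullop T) d.
Proof.
move=> [S [Spos ST Sd]]; exists (pullop S); split.
- exact: positive_pullop.
- by move=> i j; rewrite mulop_pullop -[adjop _]/(pullop (adjop T)) mulop_pullop
    /pullop ST.
- exact/(sumsto_bij (fun j => S j j)).
Qed.

End Reindexing.

(** * Invariance of the secret key rate *)

Section RateReindexing.
Variables (R : realType) (KA KB : countType) (E E' : choiceType).
Variables (f : E -> E') (g : E' -> E).
Hypotheses (fK : cancel f g) (gK : cancel g f).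
Variables (omega : op R ((KA * KB) * E)%type) (omega' : op R ((KA * KB) * E')%type).
Hypothesis omegaE : forall k e k' e',
  omega (k, e) (k', e') = omega' (k, f e) (k', f e').

Lemma final_state_reindex L l (D : distillation R KA KB L l) k t e k' t' e' :
  @final_state R KA KB E omega L l D (k, (t, e)) (k', (t', e')) =
  @final_state R KA KB E' omega' L l D (k, (t, map_tuple f e)) (k', (t', map_tuple f e')).
Proof.
apply: (congr1 (@csum R _)); apply/funext => -[[a b] [ra rb]].
rewrite /scaleop /tensor /=; congr (_ * (_ * (_ * _))).
rewrite /eve_block /tpow; apply: eq_bigr => i _.
by rewrite !tnth_mktuple omegaE !tnth_map.
Qed.

(** Distillation never acts on Eve's systems, so the same protocols work and only the comparison
    states [sigma] are relabelled. *)
Lemma achievable_rate_reindex r : achievable_rate omega' r -> achievable_rate omega r.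
Proof.
move=> [r0 [l [D [sigma [d [lr sd dist d0]]]]]]; split=> //.
pose F L (p : seq (Msg (D L)) * L.-tuple E) := (p.1, map_tuple f p.2).
pose G L (p : seq (Msg (D L)) * L.-tuple E') := (p.1, map_tuple g p.2).
have FK L : cancel (F L) (G L).
  by move=> [t e]; congr (_, _); apply: val_inj => /=; rewrite mapK.
have GK L : cancel (G L) (F L).
  by move=> [t e]; congr (_, _); apply: val_inj => /=; rewrite mapK.
exists l, D, (fun L => pullop (F L) (sigma L)), d; split=> // L.
  exact: (density_pullop (FK L) (GK L) (sd L)).
pose F' (p : (l L).-tuple bool * (l L).-tuple bool * (seq (Msg (D L)) * L.-tuple E)) :=
  (p.1, F L p.2).
pose G' (p : (l L).-tuple bool * (l L).-tuple bool * (seq (Msg (D L)) * L.-tuple E'))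
  := (p.1, G L p.2).
have F'K : cancel F' G' by move=> [k p]; rewrite /F' /G' /= FK.
have G'K : cancel G' F' by move=> [k p]; rewrite /F' /G' /= GK.
have := trace_norm_pullop F'K G'K (dist L).
rewrite /trace_distance_is; congr trace_norm_is.
apply/funext => -[k [t e]]; apply/funext => -[k' [t' e']].
by rewrite /subop final_state_reindex.
Qed.

Lemma secret_key_rate_reindex : (secret_key_rate omega' <= secret_key_rate omega)%E.
Proof.
apply: ereal_sup_le => _ [r rP <-]; exists r => //; exact: achievable_rate_reindex.
Qed.

End RateReindexing.

(** * The nonlocality order and wirings *)

Section Wirings.
Variables (R : realType) (m n : nat) (A B : finType).
Implicit Types P : dtuple R m n A B.

(** Output maps see the original input [x], not the substituted input [fA x]: output operations act
    at one given input, and this form is stable under composition. *)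
Definition wired (fA : 'I_m -> 'I_m) (gA : 'I_m -> A -> A)
    (fB : 'I_n -> 'I_n) (gB : 'I_n -> B -> B) P : dtuple R m n A B :=
  fun x y a b => \sum_u \sum_v
    (gA x u == a)%:R * (gB y v == b)%:R * P (fA x) (fB y) u v.

Lemma sum_eq_indicator (T : finType) (F : T -> R) a : \sum_u (u == a)%:R * F u = F a.
Proof.
rewrite (bigD1 a)//= eqxx mul1r big1 ?addr0// => u /negbTE ->.
by rewrite mul0r.
Qed.

Lemma sum_eq_indicatorV (T : finType) (F : T -> R) a : \sum_u (a == u)%:R * F u = F a.
Proof. by under eq_bigr do rewrite eq_sym; exact: sum_eq_indicator. Qed.

Lemma wiredA fA gA P x y a b :
  wired fA gA id (fun _ => id) P x y a b = \sum_u (gA x u == a)%:R * P (fA x) y u b.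
Proof.
apply: eq_bigr => u _; under eq_bigr do rewrite mulrAC mulrC.
exact: sum_eq_indicator.
Qed.

Lemma wiredB fB gB P x y a b :
  wired id (fun _ => id) fB gB P x y a b = \sum_v (gB y v == b)%:R * P x (fB y) a v.
Proof.
rewrite /wired exchange_big; apply: eq_bigr => v _.
under eq_bigr do rewrite -mulrA; exact: sum_eq_indicator.
Qed.

Lemma sum_coarse (T : finType) (T' : {set T}) (t' : T) (F : T -> R) a : t' \in T' ->
  \sum_u ((if u \in T' then t' else u) == a)%:R * F u =
  if a \in T' then if a == t' then \sum_(u in T') F u else 0 else F a.
Proof.
move=> t'T'; rewrite (bigID (mem T')) /=.
have -> : \sum_(u in T') ((if u \in T' then t' else u) == a)%:R * F u =
    (t' == a)%:R * \sum_(u in T') F u.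
  by rewrite mulr_sumr; apply: eq_bigr => u ->.
have -> : \sum_(u | u \notin T') ((if u \in T' then t' else u) == a)%:R * F u =
    if a \in T' then 0 else F a.
  case: ifPn => aT'.
    apply: big1 => u uT'; rewrite (negbTE uT'); have [ua|] := eqVneq u a;
      last by rewrite mul0r.
    by rewrite -ua (negbTE uT') in aT'.
  rewrite (bigD1 a)//= (negbTE aT') eqxx mul1r big1 ?addr0// => u /andP[/negbTE ->
    /negbTE ->].
  by rewrite mul0r.
case: ifPn => aT'; first by rewrite addr0 eq_sym; case: eqP; rewrite ?mul1r ?mul0r.
have [ta|] := eqVneq t' a; first by rewrite -ta t'T' in aT'.
by rewrite mul0r add0r.
Qed.

Lemma elementary_wired (e : elementary m n A B) : exists fA gA fB gB,
  forall P x y a b, apply_elementary e P x y a b = wired fA gA fB gB P x y a b.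
Proof.
case: e => [x0 x'|y0 y'|s|s|x0 s|y0 s|x0 A' a' a'A'|y0 B' b' b'B'] /=.
- exists (fun x1 => if x1 == x' then x0 else x1), (fun _ => id), id,
    (fun _ => id) => P x y a b.
  by rewrite wiredA sum_eq_indicator.
- exists id, (fun _ => id), (fun y1 => if y1 == y' then y0 else y1),
    (fun _ => id) => P x y a b.
  by rewrite wiredB sum_eq_indicator.
- exists s, (fun _ => id), id, (fun _ => id) => P x y a b.
  by rewrite wiredA sum_eq_indicator.
- exists id, (fun _ => id), s, (fun _ => id) => P x y a b.
  by rewrite wiredB sum_eq_indicator.
(* The relabelled tuple gives [a] the probability of the outcome [s a], hence outcomes are processed
   by the inverse of [s]. *)
- exists id, (fun x1 u => if x1 == x0 then (s^-1)%g u else u), id,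
    (fun _ => id) => P x y a b.
  rewrite wiredA; case: eqP => _; last by rewrite sum_eq_indicator.
  by rewrite -(sum_eq_indicator (fun u => P x y u b) (s a)); apply: eq_bigr => u _;
    rewrite (canF_eq (permKV s)).
- exists id, (fun _ => id), id,
    (fun y1 u => if y1 == y0 then (s^-1)%g u else u) => P x y a b.
  rewrite wiredB; case: eqP => _; last by rewrite sum_eq_indicator.
  by rewrite -(sum_eq_indicator (fun v => P x y a v) (s b)); apply: eq_bigr => u _;
    rewrite (canF_eq (permKV s)).
- exists id, (fun x1 u => if x1 == x0 then if u \in A' then a' else u else u), id,
    (fun _ => id).
  move=> P x y a b; rewrite wiredA; case: eqP => _; last by rewrite sum_eq_indicator.
  by rewrite sum_coarse.
- exists id, (fun _ => id), id,
    (fun y1 u => if y1 == y0 then if u \in B' then b' else u else u).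
  move=> P x y a b; rewrite wiredB; case: eqP => _; last by rewrite sum_eq_indicator.
  by rewrite sum_coarse.
Qed.

Lemma wired_comp fA gA fB gB fA' gA' fB' gB' P x y a b :
  wired fA gA fB gB (wired fA' gA' fB' gB' P) x y a b =
  wired (fA' \o fA) (fun x => gA x \o gA' (fA x)) (fB' \o fB) (fun y => gB y \o gB' (fB
    y)) P x y a b.
Proof.
rewrite /wired /=.
transitivity (\sum_u' \sum_v' \sum_u \sum_v (gA' (fA x) u' == u)%:R *
  ((gB' (fB y) v' == v)%:R * ((gA x u == a)%:R * (gB y v == b)%:R *
   P (fA' (fA x)) (fB' (fB y)) u' v'))).
  rewrite pair_bigA /= [RHS]pair_bigA /=.
  under [RHS]eq_bigr do rewrite pair_bigA.
  rewrite [RHS]exchange_big /=; apply: eq_bigr => -[u v] _ /=.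
  rewrite pair_bigA mulr_sumr; apply: eq_bigr => -[u' v'] _ /=; ring.
apply: eq_bigr => u' _; apply: eq_bigr => v' _.
under eq_bigr do rewrite -mulr_sumr.
by rewrite sum_eq_indicatorV sum_eq_indicatorV.
Qed.

Lemma composition_wired (c : seq (elementary m n A B)) : exists fA gA fB gB,
  forall P x y a b, apply_composition c P x y a b = wired fA gA fB gB P x y a b.
Proof.
elim: c => [|e c [fA [gA [fB [gB cE]]]]].
  exists id, (fun _ => id), id, (fun _ => id) => P x y a b.
  by rewrite wiredA sum_eq_indicator.
have [fA' [gA' [fB' [gB' eE]]]] := elementary_wired e.
exists (fA \o fA'), (fun x => gA' x \o gA (fA' x)), (fB \o fB'),
  (fun y => gB' y \o gB (fB' y)).
move=> P x y a b; rewrite -wired_comp [LHS]eE.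
by apply: eq_bigr => u _; apply: eq_bigr => v _; congr (_ * _); exact: cE.
Qed.

Lemma deterministic_wired P s t x y a b : is_distribution P ->
  deterministic R s t x y a b = wired id (fun x _ => s x) id (fun y _ => t y) P x y a b.
Proof.
move=> Pdist; have [_ P1] := Pdist x y.
rewrite /wired /deterministic; under eq_bigr do rewrite -mulr_sumr.
by rewrite -mulr_sumr P1 mulr1 [s x == a]eq_sym [t y == b]eq_sym.
Qed.

Record wiring := Wiring {
  inA : 'I_m -> 'I_m; outA : 'I_m -> A -> A;
  inB : 'I_n -> 'I_n; outB : 'I_n -> B -> B }.

Definition apply_wiring (w : wiring) := wired (inA w) (outA w) (inB w) (outB w).

Definition mixture (Lam : finType) (p : Lam -> R) (w : Lam -> wiring) P P' :=
  [/\ forall l, 0 <= p l, \sum_l p l = 1 &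
      forall x y a b, P' x y a b = \sum_l p l * apply_wiring (w l) P x y a b].

Lemma not_less_nonlocal_mixture P P' : is_distribution P -> not_less_nonlocal P P' ->
  exists (Lam : finType) (p : Lam -> R) (w : Lam -> wiring), mixture p w P P'.
Proof.
move=> Pdist [k [p0 [p [Loc [T [p0_ge0 p_ge0 p1 [q [q_ge0 q1 LocE]] P'E]]]]]].
have TW i : exists w, forall x y a b,
    apply_composition (T i) P x y a b = apply_wiring w P x y a b.
  have [fA [gA [fB [gB cE]]]] := composition_wired (T i).
  by exists (Wiring fA gA fB gB) => x y a b; rewrite cE.
have [W WE] := choice TW.
(* The flag selects either one of the compositions or, with weight [p0 * q], a deterministic
   strategy of the local part, viewed as a wiring with constant outputs. *)
exists ('I_k + ({ffun 'I_m -> A} * {ffun 'I_n -> B}))%type.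
exists (fun l : 'I_k + ({ffun 'I_m -> A} * {ffun 'I_n -> B}) =>
  match l with inl i => p i | inr st => p0 * q st.1 st.2 end).
exists (fun l : 'I_k + ({ffun 'I_m -> A} * {ffun 'I_n -> B}) =>
  match l with inl i => W i | inr st =>
  Wiring id (fun x _ => st.1 x) id (fun y _ => st.2 y) end).
split.
- by case=> [i|[s t]] //=; rewrite mulr_ge0.
- rewrite big_sumType /= -mulr_sumr -(pair_bigA _ q) q1 mulr1 addrC; exact: p1.
- move=> x y a b; rewrite P'E big_sumType /= addrC; congr (_ + _); last first.
    by apply: eq_bigr => i _; rewrite WE.
  rewrite LocE pair_bigA mulr_sumr; apply: eq_bigr => -[s t] _ /=.
  by rewrite mulrA (deterministic_wired _ _ _ _ _ _ Pdist).
Qed.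

End Wirings.

(** * Realizing mixtures *)

Section Realizations.
Variable R : realType.
Local Notation C := R[i].

(** The complement of one element is the sum of the other elements, hence positive. *)
Lemma povm_element_qbound (I : choiceType) (O : finType) (M : O -> op R I) o :
  (forall o, psd (M o)) -> (forall i j, \sum_o M o i j = idop R i j) -> qbound 1 (M o).
Proof.
move=> Mpsd M1; apply/qbound_effect.
have psd_rest : psd (fun i j => \sum_(o' | o' != o) M o' i j).
  by apply: psd_sum => o' _; exact: Mpsd.
apply: psd_ext psd_rest => i j.
by rewrite mul1r -[_%:R]/(idop R i j) -M1 [X in X - _](bigD1 o)//= addrAC subrr add0r.
Qed.

Lemma is_povmP (I : choiceType) (O : finType) (M : O -> op R I) :
  is_povm M <-> (forall o, psd (M o)) /\ forall i j, \sum_o M o i j = idop R i j.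
Proof.
split=> [[Mpos M1]|[Mpsd M1]]; first by split=> // o; exact: positive_psd.
by split=> // o; apply: (@psd_positive _ _ _ 1) => //; exact: povm_element_qbound.
Qed.

Lemma povm_qbound (I : choiceType) (O : finType) (M : O -> op R I) o :
  is_povm M -> qbound 1 (M o).
Proof. by move=> /is_povmP[Mpsd M1]; exact: povm_element_qbound. Qed.

Lemma psd_tensorop (I J : choiceType) (S : op R I) (T : op R J) :
  psd S -> psd T -> psd (tensor S T).
Proof. exact: psd_tensor. Qed.

(** The complement of the tensor product of [S] and [T] is [(1 - S)] tensor 1 plus [S] tensor
    [(1 - T)]. *)
Lemma qbound_tensorop (I J : choiceType) (S : op R I) (T : op R J) :
  psd S -> psd T -> qbound 1 S -> qbound 1 T -> qbound 1 (tensor S T).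
Proof.
move=> psdS psdT /qbound_effect S1 /qbound_effect T1; apply/qbound_effect.
apply: psd_ext (psdD (psd_tensor S1 (@psd_id _ J)) (psd_tensor psdS T1)) => -[i j] [i'
  j'].
rewrite /tensor /= xpair_eqE; case: eqP => _; case: eqP => _ /=; ring.
Qed.

Lemma qbound_idop (I : choiceType) : qbound 1 (@idop R I).
Proof.
by apply/qbound_effect; apply: psd_ext (@psd0 _ I) => i j; rewrite mul1r subrr.
Qed.

Lemma psd_idop (I : choiceType) : psd (@idop R I).
Proof. exact: psd_id. Qed.

Lemma sumsto_finprod (L : finType) (S : choiceType) (F : L -> S -> C) (l : L -> C) :
  (forall a, sumsto (F a) (l a)) ->
  sumsto (fun q : L * S => F q.1 q.2) (\sum_a l a).
Proof.
move=> Fl.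
have H a : sumsto (fun q : L * S => (q.1 == a)%:R * F q.1 q.2) (l a).
  rewrite (@sumsto_reindex _ _ _ (fun s => (a, s))).
  - by apply: sumsto_ext (Fl a) => s; rewrite /= eqxx mul1r.
  - by move=> s s' [].
  - move=> [b s] /=; have [-> _|_] := eqVneq b a; first by exists s.
    by rewrite mul0r eqxx.
have K := @sumsto_sum _ _ _ (index_enum L) _ _ H.
apply: sumsto_ext K => -[b s] /=.
rewrite (bigD1 b)//= eqxx mul1r big1 ?addr0// => a ab.
by rewrite eq_sym (negbTE ab) mul0r.
Qed.

(** * Matrix coefficients of the protocol operators *)

Section ClosedForms.
Variables (m n : nat) (A B : finType) (rkp : raw_key_protocol R m n A B).

Lemma rho_tildeE a1 b1 e1 a2 b2 e2 :
  @rho_tilde R m n A B rkp (((a1, b1), e1)) (((a2, b2), e2)) =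
  if [&& a1 == a2, b1 == b2, e1 == e2, a1.2 == e1 & b1.2 == e1]
  then (pX e1 a1.1 * pY e1 b1.1 * pE e1)%:C else 0.
Proof.
rewrite /rho_tilde /sumop (csum_single (i0 := (a1.1, b1.1, e1))) /=; last first.
  move=> [[x y] e] ne; rewrite /scaleop /tensor /Defs.proj /=.
  case: (eqVneq a1 (x, e)) => [a1E|]; last by rewrite !(mul0r, mulr0).
  case: (eqVneq b1 (y, e)) => [b1E|]; last by rewrite !(mul0r, mulr0).
  case: (eqVneq e1 e) => [e1E|]; last by rewrite !(mul0r, mulr0).
  by rewrite a1E b1E e1E eqxx in ne.
rewrite /scaleop /tensor /Defs.proj /= -!natrM !mulnb.
case: a1 b1 a2 b2 => [x e] [y e'] [x' e''] [y' e'''] /=.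
case: ifPn => [/and5P[/eqP[<- <-] /eqP[<- <-] /eqP <- /eqP <- /eqP <-]|].
  by rewrite !eqxx mulr1.
move=> ne; case: (boolP (_ && _)); last by rewrite mulr0.
rewrite -!andbA /= => /and5P[_ /eqP E1 /eqP E2 /eqP E3].
case/and5P=> [_ /eqP E4 /eqP E5 /eqP E6 /andP[_ /eqP E7]].
by case/negP: ne; rewrite E1 E2 E3 E4 E5 E6 E7 !eqxx.
Qed.

Variables (I J : choiceType) (M : 'I_m -> A -> op R I) (N : 'I_n -> B -> op R J).

Lemma opAE (a : KA rkp) x1 x2 i1 i2 : opA M a (x1, i1) (x2, i2) =
  if x1 == x2 then \sum_u (genA u x1.1 x1.2 a)%:C * M (inputA x1.1 x1.2) u i1 i2 else 0.
Proof.
rewrite /opA /sumop (@csum_reindex _ _ _ (fun u => (x1, u))); first last.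
- move=> [[x e] u]; rewrite /scaleop /tensor /Defs.proj /=.
  have [x1E _|_] := eqVneq x1 (x, e); first by exists u; rewrite x1E.
  by rewrite !(mul0r, mulr0) eqxx.
- by move=> u u' [].
rewrite (csum_eq (@csum_fintype _ _ _)); case: x1 => [x e] /=.
rewrite /scaleop /tensor /Defs.proj /= eqxx /= eq_sym.
case: eqP => _; last by apply: big1 => u _; rewrite mul0r mulr0.
by apply: eq_bigr => u _; rewrite mul1r.
Qed.

Lemma opBE (b : KB rkp) y1 y2 j1 j2 : opB N b (y1, j1) (y2, j2) =
  if y1 == y2 then \sum_v (genB v y1.1 y1.2 b)%:C * N (inputB y1.1 y1.2) v j1 j2 else 0.
Proof.
rewrite /opB /sumop (@csum_reindex _ _ _ (fun v => (y1, v))); first last.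
- move=> [[y e] v]; rewrite /scaleop /tensor /Defs.proj /=.
  have [y1E _|_] := eqVneq y1 (y, e); first by exists v; rewrite y1E.
  by rewrite !(mul0r, mulr0) eqxx.
- by move=> v v' [].
rewrite (csum_eq (@csum_fintype _ _ _)); case: y1 => [y e] /=.
rewrite /scaleop /tensor /Defs.proj /= eqxx /= eq_sym.
case: eqP => _; last by apply: big1 => v _; rewrite mul0r mulr0.
by apply: eq_bigr => v _; rewrite mul1r.
Qed.

End ClosedForms.

End Realizations.

(** * A realization of a mixture of wirings *)

Section FlaggedRealization.
Variables (R : realType) (m n : nat) (A B Lam : finType).
Variables (p : Lam -> R) (w : Lam -> wiring m n A B).
Variables (P P' : dtuple R m n A B).
Hypothesis mix : mixture p w P P'.
Variables (I J K : choiceType) (rho : op R ((I * J) * K)%type).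
Variables (M : 'I_m -> A -> op R I) (N : 'I_n -> B -> op R J).
Local Notation C := R[i].
Local Notation I' := (Lam * I)%type.
Local Notation J' := (Lam * J)%type.
Local Notation K' := (Lam * K)%type.

(* Alice, Bob and Eve each hold a copy of the flag [l], drawn according to [p]. *)
Definition flagged_state : op R ((I' * J') * K')%type := fun s t =>
  let: (((l1, i), (l2, j)), (l3, k)) := s in
  let: (((l1', i'), (l2', j')), (l3', k')) := t in
  if [&& l2 == l1, l3 == l1, l1' == l1, l2' == l1 & l3' == l1]
  then (p l1)%:C * rho ((i, j), k) ((i', j'), k') else 0.

(** Block-diagonal in the flag: read it, perform the measurement it selects and process the
    outcome. *)
Definition flagged_povm (O : finType) (T : choiceType) (M0 : Lam -> O -> op R T)
    (g : Lam -> O -> O) (o : O) : op R (Lam * T)%type := fun s t =>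
  if s.1 == t.1 then \sum_u (g s.1 u == o)%:R * M0 s.1 u s.2 t.2 else 0.

Definition flaggedA x := flagged_povm (fun l => M (inA (w l) x)) (fun l => outA (w l) x).
Definition flaggedB y := flagged_povm (fun l => N (inB (w l) y)) (fun l => outB (w l) y).

Lemma flagged_povm_is_povm (O : finType) (T : choiceType) (M0 : Lam -> O -> op R T) g :
  (forall l, is_povm (M0 l)) -> is_povm (flagged_povm M0 g).
Proof.
move=> Mpovm; apply/is_povmP; split=> [o|].
- have Mpsd l u : psd (M0 l u) by have /is_povmP[] := Mpovm l.
  have psdX l : psd (fun s t : Lam * T =>
      ((s.1 == l)%:R * (t.1 == l)%:R^*) * \sum_u (g l u == o)%:R * M0 l u s.2 t.2).
    apply: psd_hadamard; first exact: psd_rank1.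
    apply: psd_sum => u _; apply: psdZ; first by rewrite ler0n.
    exact: (psd_pull snd).
  apply: psd_ext (psd_sum (index_enum Lam) (P :=
    xpredT) (fun l _ => psdX l)) => -[l s] [l' t] /=.
  rewrite (bigD1 l)//= eqxx mul1r rmorph_nat [X in _ + X]big1 ?addr0; last first.
    by move=> l0 ll0; rewrite eq_sym (negbTE ll0) !mul0r.
  rewrite /flagged_povm /= [l' == l]eq_sym.
  by case: (eqVneq l l') => _; rewrite ?mul1r ?mul0r.
- move=> [l s] [l' t]; rewrite /flagged_povm /idop /= xpair_eqE.
  have [_|_] := eqVneq l l'; last by rewrite big1.
  have /is_povmP[_ M1] := Mpovm l; rewrite -[RHS]/(idop R s t) -M1.
  rewrite exchange_big; apply: eq_bigr => u _ /=.
  rewrite -mulr_suml (bigD1 (g l u))//= eqxx big1 ?addr0 ?mul1r// => o.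
  by rewrite eq_sym => /negbTE ->.
Qed.

Let flag (q : Lam * ((I * J) * K)) : (I' * J') * K' :=
  let: (l, ((i, j), k)) := q in (((l, i), (l, j)), (l, k)).

Let flag_inj : injective flag.
Proof. by move=> [l [[i j] k]] [l' [[i' j'] k']] [-> -> _ -> _ ->]. Qed.

Let p_ge0 l : 0 <= p l. Proof. by case: mix. Qed.

Lemma flagged_state_density : density rho -> density flagged_state.
Proof.
move=> /densityP[psd_rho tr_rho]; apply/densityP; split.
(* The state is a sum over [l] of Hadamard products: the rank-one indicator of three flags equal to
   [l], times [rho] pulled back along the map that forgets the flags. *)
- pose chi l (s : (I' * J') * K') : C := [&& s.1.1.1 == l, s.1.2.1 == l & s.2.1 == l]%:R.
  pose strip (s : (I' * J') * K') := ((s.1.1.2, s.1.2.2), s.2.2).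
  have psdX l : psd (fun s t => (p l)%:C *
      ((chi l s * (chi l t)^*) * rho (strip s) (strip t))).
    apply: psdZ; first by rewrite ler0c.
    by apply: psd_hadamard; [exact: psd_rank1|exact: psd_pull].
  apply: psd_ext (psd_sum (index_enum Lam) (P := xpredT) (fun l _ => psdX l)).
  move=> [[[l1 i] [l2 j]] [l3 k]] [[[l1' i'] [l2' j']] [l3' k']] /=.
  rewrite (bigD1 l1)//= [X in _ + X]big1 ?addr0 /chi /strip /=; last first.
    by move=> l ll1; rewrite [l1 == l]eq_sym (negbTE ll1) /= !mul0r mulr0.
  rewrite eqxx /= rmorph_nat -natrM mulnb !andbA.
  by case: ifP => _; rewrite ?mul1r ?mul0r ?mulr0.
- rewrite (@sumsto_reindex _ _ _ flag _ _ flag_inj); last first.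
    move=> [[[l1 i] [l2 j]] [l3 k]] ; rewrite /flagged_state; case: ifP => [|_];
      last by move=> /negP[].
    by move=> /and5P[/eqP -> /eqP -> _ _ _] _; exists (l1, ((i, j), k)).
  have p1 : sumsto (fun l => (p l)%:C : C) 1.
    have := @csum_fintype R Lam (fun l => (p l)%:C); rewrite -rmorph_sum.
    by case: mix => _ -> _.
  have := sumsto_prod _ (fun s => psd_ge0 s psd_rho) p1 tr_rho.
  rewrite mulr1 => H; apply: sumsto_ext (H _) => [|l]; last by rewrite ler0c.
  by move=> [l [[i j] k]] /=; rewrite !eqxx.
Qed.

Lemma flagged_realization : quantum_realization P rho M N ->
  quantum_realization P' flagged_state flaggedA flaggedB.
Proof.
move=> [rho_dens Mpovm Npovm PE]; have /densityP[psd_rho tr_rho] := rho_dens.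
split.
- exact: flagged_state_density.
- by move=> x; apply: flagged_povm_is_povm.
- by move=> y; apply: flagged_povm_is_povm.
move=> x y a b; apply/esym/csum_eq.
pose X (l : Lam) (uv : A * B) := tensor (tensor (M (inA (w l) x) uv.1) (N (inB (w l) y)
  uv.2)) (@idop R K).
pose c (l : Lam) (uv : A * B) : C :=
  (outA (w l) x uv.1 == a)%:R * (outB (w l) y uv.2 == b)%:R.
have psdM l u : psd (M (inA (w l) x) u) by have /is_povmP[] := Mpovm (inA (w l) x).
have psdN l v : psd (N (inB (w l) y) v) by have /is_povmP[] := Npovm (inB (w l) y).
have psdX l uv : psd (X l uv).
  by apply: psd_tensorop; [exact: psd_tensorop|exact: psd_idop].
have X1 l uv : qbound 1 (X l uv).
  apply: qbound_tensorop; [exact: psd_tensorop|exact: psd_idop| |exact: qbound_idop].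
  by apply: qbound_tensorop => //; apply: povm_qbound.
pose Xw l : op R ((I * J) * K)%type := fun s t => \sum_uv c l uv * X l uv s t.
have trX l := @tr_mulop_sum _ _ rho psd_rho tr_rho _ (index_enum (A * B)%type) (c l) (X
  l) (psdX l) (X1 l).
(* All three flags agree on the support of the state, so the intermediate sum stays in the block
   [l]. *)
have flagE l s : mulop flagged_state (tensor (tensor (flaggedA x a) (flaggedB y b))
  (@idop R K'))
    (flag (l, s)) (flag (l, s)) = (p l)%:C * mulop rho (Xw l) s s.
  (* The factor [p l] can be taken out of a [csum] only once convergence is known. *)
  have conv : exists z, sumsto (fun t => rho s t * Xw l t s) z.
    exists (\sum_uv c l uv * mulop rho (X l uv) s s).
    have H := @sumsto_sum _ _ _ (index_enum (A * B)%type) _ _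
      (fun uv => sumstoZ (c l uv) (@mulop_sumsto _ _ _ psd_rho tr_rho _ s s (psdX l uv)
        (X1 l uv))).
    apply: sumsto_ext H => t; rewrite /Xw mulr_sumr; apply: eq_bigr => uv _; ring.
  rewrite {1}/mulop (@csum_reindex _ _ _ (fun t => flag (l, t))).
  - apply: csum_eq; apply: sumsto_ext (sumstoZ (p l)%:C (csumP conv)) => t.
    case: s t {conv} => [[i j] k] [[i' j'] k'] /=.
    rewrite !eqxx /= -mulrA; congr (_ * (_ * _)).
    rewrite /tensor /= /flaggedA /flaggedB /flagged_povm /= !eqxx.
    rewrite /idop xpair_eqE eqxx /=.
    rewrite /Xw -mulrA mulr_suml -(pair_bigA _ (fun u v => c l (u, v) * X l (u, v) (i',
      j', k') (i, j, k))) /=.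
    apply: eq_bigr => u _; rewrite mulr_suml mulr_sumr; apply: eq_bigr => v _.
    by rewrite /c /X /tensor /idop /=; ring.
  - by move=> t t' /flag_inj [].
  - move=> t; apply: contra_neqP => nflag; case: s t nflag {conv} => [[i j] k].
    move=> [[[l1 i'] [l2 j']] [l3 k']] nflag /=.
    case: ifP; last by rewrite mul0r.
    move=> /and5P[_ _ /eqP El1 /eqP El2 /eqP El3]; case: nflag.
    by exists ((i', j'), k'); rewrite El1 El2 El3.
rewrite (@sumsto_reindex _ _ _ flag _ _ flag_inj); last first.
  move=> s; apply: contra_neqP => nflag; apply: csum_eq;
    apply: sumsto_ext (@sumsto0 _ _) => t.
  case: s t nflag => [[[l1 i] [l2 j]] [l3 k]] [[[l1' i'] [l2' j']] [l3' k']] nflag /=.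
  case: ifP; last by rewrite mul0r.
  move=> /and5P[/eqP El2 /eqP El3 _ _ _]; case: nflag.
  by exists (l1, ((i, j), k)); rewrite El2 El3.
have H := sumsto_finprod (fun l => sumstoZ (p l)%:C (trX l)).
have -> : (P' x y a b)%:C = \sum_l (p l)%:C * \sum_uv c l uv * tr (mulop rho (X l uv)).
  case: mix => _ _ ->; rewrite rmorph_sum; apply: eq_bigr => l _.
  rewrite rmorphM; congr (_ * _); rewrite /apply_wiring /wired pair_bigA rmorph_sum.
  by apply: eq_bigr => -[u v] _; rewrite !rmorphM !rmorph_nat /= PE.
by apply: sumsto_ext H => -[l s]; rewrite /= flagE.
Qed.

End FlaggedRealization.

(** * Simulating raw key protocols *)

Section Simulation.
Variables (R : realType) (m n : nat) (A B Lam : finType).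
Variables (p : Lam -> R) (w : Lam -> wiring m n A B).
Hypotheses (p_ge0 : forall l, 0 <= p l) (p1 : \sum_l p l = 1).
Variable rkp : raw_key_protocol R m n A B.
Local Notation C := R[i].

Definition sim_pE (e : TE rkp * Lam) : R := pE e.1 * p e.2.
(* The second component of Alice's private variable is the input she measures.
   It depends on the public flag, but has to be a component of [X]. *)
Definition sim_pX (e : TE rkp * Lam) (x : TX rkp * 'I_m) : R :=
  pX e.1 x.1 * (x.2 == inA (w e.2) (inputA x.1 e.1))%:R.
Definition sim_pY (e : TE rkp * Lam) (y : TY rkp * 'I_n) : R :=
  pY e.1 y.1 * (y.2 == inB (w e.2) (inputB y.1 e.1))%:R.
Definition sim_genA (u : A) (x : TX rkp * 'I_m) (e : TE rkp * Lam) : KA rkp -> R :=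
  genA (outA (w e.2) (inputA x.1 e.1) u) x.1 e.1.
Definition sim_genB (v : B) (y : TY rkp * 'I_n) (e : TE rkp * Lam) : KB rkp -> R :=
  genB (outB (w e.2) (inputB y.1 e.1) v) y.1 e.1.

Lemma is_pmf_graph (S : choiceType) (T : choiceType) (q : S -> R) (g : S -> T) :
  is_pmf q -> is_pmf (fun s : S * T => q s.1 * (s.2 == g s.1)%:R).
Proof.
move=> [q0 q1]; split=> [s|]; first by rewrite mulr_ge0 ?ler0n.
apply/(@sumsto_reindex _ _ _ (fun s => (s, g s))).
- by move=> s s' [].
- move=> [s t] /=; have [-> _|_] := eqVneq t (g s); first by exists s.
  by rewrite mulr0 eqxx.
- by apply: sumsto_ext q1 => s /=; rewrite eqxx mulr1.
Qed.

Lemma sim_pE_pmf : is_pmf sim_pE.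
Proof.
have [q0 q1] := pE_pmf rkp; split=> [e|]; first by rewrite mulr_ge0.
have pp : sumsto p 1.
  rewrite -p1; apply: sumsto_fin; first exact: index_enum_uniq.
  by move=> l _; exact: mem_index_enum.
by have := sumsto_prod q0 p_ge0 q1 pp; rewrite mulr1.
Qed.

Lemma sim_pX_pmf e : is_pmf (sim_pX e).
Proof. exact: (is_pmf_graph (fun x => inA (w e.2) (inputA x e.1)) (pX_pmf e.1)). Qed.

Lemma sim_pY_pmf e : is_pmf (sim_pY e).
Proof. exact: (is_pmf_graph (fun y => inB (w e.2) (inputB y e.1)) (pY_pmf e.1)). Qed.

Definition simulated : raw_key_protocol R m n A B :=
  @RawKeyProtocol R m n A B (KA rkp) (KB rkp) (TX rkp * 'I_m)%type (TY rkp * 'I_n)%type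
    (TE rkp * Lam)%type sim_pE sim_pX sim_pY (inl snd) (inl snd) sim_genA sim_genB
    sim_pE_pmf sim_pX_pmf sim_pY_pmf
    (fun u x e => genA_pmf _ _ _) (fun v y e => genB_pmf _ _ _).

Variables (I J K : choiceType) (rho : op R ((I * J) * K)%type).
Variables (M : 'I_m -> A -> op R I) (N : 'I_n -> B -> op R J).

Local Notation rho' := (flagged_state p rho).
Local Notation M' := (flaggedA w M).
Local Notation N' := (flaggedB w N).

(** Embeds the basis of the flagged run into that of the simulation by filling the additional
    register with the measured input. It is injective but not onto, unlike [simE], which merely
    regroups Eve's factors. *)
Definition simA (s : (TX rkp * TE rkp) * (Lam * I)) : ((TX rkp * 'I_m) * (TE rkp *
  Lam)) * I :=
  let: ((x, e), (l, i)) := s in (((x, inA (w l) (inputA x e)), (e, l)), i).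
Definition simB (s : (TY rkp * TE rkp) * (Lam * J)) : ((TY rkp * 'I_n) * (TE rkp *
  Lam)) * J :=
  let: ((y, e), (l, j)) := s in (((y, inB (w l) (inputB y e)), (e, l)), j).
Definition simE (s : TE rkp * (Lam * K)) : (TE rkp * Lam) * K :=
  let: (e, (l, k)) := s in ((e, l), k).
Definition simE' (s : (TE rkp * Lam) * K) : TE rkp * (Lam * K) :=
  let: ((e, l), k) := s in (e, (l, k)).

Lemma simEK : cancel simE simE'. Proof. by move=> [e [l k]]. Qed.
Lemma simE'K : cancel simE' simE. Proof. by move=> [[e l] k]. Qed.

Definition simAB s := (simA s.1, simB s.2).
Definition simABE s := (simAB s.1, simE s.2).

Lemma simA_inj : injective simA.
Proof. by move=> [[x e] [l i]] [[x' e'] [l' i']] [-> _ -> -> ->]. Qed.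
Lemma simB_inj : injective simB.
Proof. by move=> [[y e] [l j]] [[y' e'] [l' j']] [-> _ -> -> ->]. Qed.
Lemma simAB_inj : injective simAB.
Proof. by move=> [s t] [s' t'] [/simA_inj -> /simB_inj ->]. Qed.
Lemma simABE_inj : injective simABE.
Proof.
move=> [s t] [s' t'] H; congr (_, _).
  by apply: simAB_inj; move/(congr1 fst): H.
by apply: (can_inj simEK); move/(congr1 snd): H.
Qed.

Lemma sim_opA (a : KA rkp) s t : @opA R m n A B rkp _ M' a s t = @opA R m n A B
  simulated _ M a (simA s) (simA t).
Proof.
case: s t => [[x e] [l i]] [[x' e'] [l' i']]; rewrite /simA !opAE /= !xpair_eqE.
have [<-|_] := eqVneq x x'; last by rewrite /= ?andFb.
have [<-|_] := eqVneq e e'; last by rewrite /= !andbF.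
rewrite /flaggedA /flagged_povm /=; have [<-|_] := eqVneq l l'; last first.
  by rewrite /= !andbF big1// => u _; rewrite mulr0.
rewrite eqxx /=; under eq_bigr do rewrite mulr_sumr.
rewrite exchange_big; apply: eq_bigr => u _ /=.
rewrite (bigD1 (outA (w l) (inputA x e) u))//= eqxx mul1r big1 ?addr0// => v.
by rewrite eq_sym => /negbTE ->; rewrite mul0r mulr0.
Qed.

Lemma sim_opB (b : KB rkp) s t : @opB R m n A B rkp _ N' b s t = @opB R m n A B
  simulated _ N b (simB s) (simB t).
Proof.
case: s t => [[y e] [l j]] [[y' e'] [l' j']]; rewrite /simB !opBE /= !xpair_eqE.
have [<-|_] := eqVneq y y'; last by rewrite /= ?andFb.
have [<-|_] := eqVneq e e'; last by rewrite /= !andbF.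
rewrite /flaggedB /flagged_povm /=; have [<-|_] := eqVneq l l'; last first.
  by rewrite /= !andbF big1// => v _; rewrite mulr0.
rewrite eqxx /=; under eq_bigr do rewrite mulr_sumr.
rewrite exchange_big; apply: eq_bigr => v _ /=.
rewrite (bigD1 (outB (w l) (inputB y e) v))//= eqxx mul1r big1 ?addr0// => u.
by rewrite eq_sym => /negbTE ->; rewrite mul0r mulr0.
Qed.

Lemma sim_joint s t : @joint_state R m n A B rkp _ _ _ rho' s t =
  @joint_state R m n A B simulated _ _ _ rho (simABE s) (simABE t).
Proof.
case: s t => [[[[x eA] [lA i]] [[y eB] [lB j]]] [eE [lE k]]].
case=> [[[[x' eA'] [lA' i']] [[y' eB'] [lB' j']]] [eE' [lE' k']]].
rewrite /joint_state /simABE /simAB /simA /simB /simE /= /tensor /= !rho_tildeE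
  /flagged_state /=.
case: (boolP [&& _ == _, (y, _, _) == _, _, _ & _]) => [|c3].
  move=> /and5P[/eqP[<- _ <- <-] /eqP[<- _ <- <-] /eqP[<- <-] /eqP[-> ->] /eqP[-> ->]].
  rewrite !eqxx /= /sim_pX /sim_pY /sim_pE /= !eqxx !mulr1 !rmorphM /=.
  by ring.
case: (boolP (_ && _)) => [c1|_]; last by rewrite !mul0r.
case: (boolP [&& _, _, _, _ & _]) => [c2|_]; last by rewrite mulr0 mul0r.
case/negP: c3; move: c1 c2.
move=> /and5P[/eqP[-> ->] /eqP[-> ->] /eqP -> /eqP -> /eqP ->].
by move=> /and5P[/eqP -> /eqP -> /eqP -> /eqP -> /eqP ->]; rewrite !eqxx.
Qed.

(** The additional registers are functions of the others with probability 1, so nothing is lost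
    outside the embedding. The column index is needed for the sum in [mulop], the row index for the
    partial trace. *)
Lemma sim_joint_range s t : @joint_state R m n A B simulated _ _ _ rho s t != 0 ->
  (exists s', s.1 = simAB s') /\ (exists t', t = simABE t').
Proof.
case: s t => [[[[[x x1] [eA lA]] i] [[[y y1] [eB lB]] j]] [[eE lE] k]].
case=> [[[[[x' x1'] [eA' lA']] i'] [[[y' y1'] [eB' lB']] j']] [[eE' lE'] k']].
rewrite /joint_state /tensor /= rho_tildeE; case: ifP; last by rewrite mul0r eqxx.
move=> /and5P[/eqP[<- <- <- <-] /eqP[<- <- <- <-] /eqP[<- <-] /eqP[<- <-] /eqP[<- <-]] /=.
rewrite mulf_eq0 negb_or => /andP[+ _]; rewrite /sim_pX /sim_pY /=.
have [->|] := eqVneq x1 _; last by rewrite !(mulr0, mul0r) eqxx.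
have [->|] := eqVneq y1 _; last by rewrite !(mulr0, mul0r) eqxx.
move=> _; split; first by exists (((x, eB), (lB, i)), ((y, eB), (lB, j))).
by exists ((((x, eB), (lB, i')), ((y, eB), (lB, j'))), (eB, (lB, k'))).
Qed.

Lemma sim_mulop (a : KA rkp) (b : KB rkp) s t :
  mulop (@joint_state R m n A B rkp _ _ _ rho')
    (tensor (tensor (@opA R m n A B rkp _ M' a) (@opB R m n A B rkp _ N' b)) (@idop R
      _)) s t =
  mulop (@joint_state R m n A B simulated _ _ _ rho)
    (tensor (tensor (@opA R m n A B simulated _ M a) (@opB R m n A B simulated _ N b))
      (@idop R _))
    (simABE s) (simABE t).
Proof.
rewrite /mulop [RHS](@csum_reindex _ _ _ _ _ (@simABE_inj)).
  apply: (congr1 (@csum R _)); apply/funext => k /=; rewrite sim_joint; congr (_ * _).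
  rewrite /tensor sim_opA sim_opB; congr (_ * _).
  by rewrite /idop /= (inj_eq (can_inj simEK)).
move=> k; rewrite mulf_eq0 negb_or => /andP[/sim_joint_range[_ kP] _]; exact: kP.
Qed.

Lemma sim_rho_rk k e k' e' :
  @rho_rk R m n A B rkp _ _ _ rho' M' N' (k, e) (k', e') =
  @rho_rk R m n A B simulated _ _ _ rho M N (k, simE e) (k', simE e').
Proof.
apply: (congr1 (@csum R _)); apply/funext => -[a b] /=; rewrite /tensor /=; congr (_ * _).
rewrite /ptr1 [RHS](@csum_reindex _ _ _ _ _ (@simAB_inj)).
  by apply: (congr1 (@csum R _)); apply/funext => s;
    rewrite /= -[(simAB s, _)]/(simABE (s, e)) sim_mulop.
move=> s; apply: contra_neqP => nsim; apply: csum_eq;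
  apply: sumsto_ext (@sumsto0 _ _) => t.
have [->|/sim_joint_range[[s' sE] _]] :=
  eqVneq (@joint_state R m n A B simulated _ _ _ rho (s, simE e) t) 0.
  by rewrite mul0r.
by case: nsim; exists s'.
Qed.

Lemma sim_secret_key_rate :
  (secret_key_rate (@rho_rk R m n A B rkp _ _ _ rho' M' N') <=
   secret_key_rate (@rho_rk R m n A B simulated _ _ _ rho M N))%E.
Proof.
apply: (secret_key_rate_reindex simE'K simEK) => k e k' e'.
by rewrite sim_rho_rk !simE'K.
Qed.

End Simulation.

Lemma di_key_rate_mono (R : realType) (m n : nat) (A B : finType) (P P' : dtuple R m n
  A B) :
  is_distribution P -> not_less_nonlocal P P' -> (di_key_rate P' <= di_key_rate P)%E.
Proof.
move=> Pdist /(not_less_nonlocal_mixture Pdist)[Lam [p [w mix]]].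
apply/ereal_infP => _ [I [J [K [rho [M [N [real ->]]]]]]].
apply: (@le_trans _ _ (ereal_sup [set s | exists rkp : raw_key_protocol R m n A B,
   s = secret_key_rate (@rho_rk R m n A B rkp _ _ _ (flagged_state p rho) (flaggedA w
     M) (flaggedB w N))])).
  apply: ereal_inf_lbound.
  do 6!eexists; split; first exact: (flagged_realization mix real).
  by [].
apply/ereal_supP => _ [rkp ->].
have [p_ge0 p1 _] := mix.
apply: le_trans (sim_secret_key_rate w p_ge0 p1 rkp rho M N) _.
by apply: ereal_sup_ubound; exists (simulated w p_ge0 p1 rkp).
Qed.

(** * The trivial protocol *)

Section PartialTrace.
Variable R : realType.
Local Notation C := R[i].

Lemma psd_csum (S I : choiceType) (F : S -> op R I) :
  (forall t, psd (F t)) -> (forall i j, exists l, sumsto (fun t => F t i j) l) ->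
  psd (fun i j => csum (fun t => F t i j)).
Proof.
move=> psdF Fc s us v.
have H i j := sumstoZr (v j) (sumstoZ (v i)^* (csumP (Fc i j))).
have K i := @sumsto_sum _ _ _ s _ _ (H i).
have L := @sumsto_sum _ _ _ s _ _ K.
by apply: sumsto_ge0 L => t; exact: psdF.
Qed.

Lemma ler_norm_of_sqr (x a b : C) : 0 <= a -> 0 <= b -> `|x| ^+ 2 <= a * b ->
  `|x| <= a + b.
Proof.
move=> a0 b0 h; rewrite -ler_sqr ?nnegrE ?addr_ge0//; apply: le_trans h _.
rewrite sqrrD -subr_ge0.
have -> : a ^+ 2 + a * b *+ 2 + b ^+ 2 - a * b = a ^+ 2 + a * b + b ^+ 2 by ring.
by rewrite !addr_ge0 ?mulr_ge0 ?exprn_ge0.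
Qed.

(** The diagonal is handled by Tonelli. Off-diagonal coefficients converge absolutely, each entry of
    a positive form being dominated by its two diagonal entries. *)
Lemma psd_ptr1 (S I : choiceType) (rho : op R (S * I)%type) : psd rho ->
  sumsto (fun q => rho q q) 1 -> psd (ptr1 rho) /\ sumsto (fun i => ptr1 rho i i) 1.
Proof.
move=> psd_rho tr_rho; split; last first.
  by have [_] := sumsto_iter (fun q => psd_ge0 q psd_rho) tr_rho.
apply: (@psd_csum S I (fun t i j => rho (t, i) (t, j))) => [t|i j].
  exact: (psd_pull (fun i => (t, i)) psd_rho).
have rowle i' (A : {fset S}) : \sum_(t <- A) rho (t, i') (t, i') <= 1.
  rewrite -(big_map (fun t => (t, i')) xpredT (fun q => rho q q)).
  apply: sumsto_seq_le tr_rho; first by move=> q; exact: psd_ge0.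
  by rewrite map_inj_uniq ?fset_uniq// => t t' [].
apply: (@sumsto_abs _ _ _ (1 + 1)) => A.
apply: (@le_trans _ _ (\sum_(t <- A) (rho (t, i) (t, i) + rho (t, j) (t, j)))).
  apply: ler_sum => t _; apply: ler_norm_of_sqr; rewrite ?psd_ge0//.
  exact: psd_entry.
by rewrite big_split /= lerD.
Qed.

Lemma mulop_id (I : choiceType) (T X : op R I) : (forall i j, X i j = idop R i j) ->
  mulop T X = T.
Proof.
move=> XE; apply/funext => i; apply/funext => j; rewrite /mulop (csum_single (i0 := j)).
  by rewrite XE /idop eqxx mulr1.
by move=> k kj; rewrite XE /idop (negbTE kj) mulr0.
Qed.

Lemma csum_unit (I : choiceType) (f : I -> C) (i0 : I) : (forall i, i = i0) ->
  csum f = f i0.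
Proof. by move=> h; apply: csum_single => i; rewrite (h i) eqxx. Qed.

End PartialTrace.

Section TrivialProtocol.
Variables (R : realType) (m n : nat) (A B : finType) (x0 : 'I_m) (y0 : 'I_n).
Local Notation C := R[i].

Lemma unit_pmf : is_pmf (fun _ : unit => 1 : R).
Proof.
split=> [_|]; first exact: ler01.
by apply: (@sumsto1 _ _ (fun _ : unit => 1 : R) tt) => -[].
Qed.

Definition trivial_protocol : raw_key_protocol R m n A B :=
  @RawKeyProtocol R m n A B unit unit unit unit unit (fun _ => 1) (fun _ _ => 1)
    (fun _ _ => 1) (inl (fun _ => x0)) (inl (fun _ => y0)) (fun _ _ _ _ => 1)
    (fun _ _ _ _ => 1) unit_pmf (fun _ => unit_pmf) (fun _ => unit_pmf)
    (fun _ _ _ => unit_pmf) (fun _ _ _ => unit_pmf).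

Definition trivial_distillation L : distillation R unit unit L 0 :=
  @Distillation R unit unit L 0 unit unit unit (fun _ => 1) (fun _ => 1) 0
    (fun _ _ _ => tt) (fun _ _ _ => tt) (fun _ _ _ => [tuple]) (fun _ _ _ => [tuple])
    unit_pmf unit_pmf.

Variables (I J K : choiceType) (rho : op R ((I * J) * K)%type).
Variables (M : 'I_m -> A -> op R I) (N : 'I_n -> B -> op R J).
Hypotheses (rho_dens : density rho) (Mpovm : forall x, is_povm (M x))
  (Npovm : forall y, is_povm (N y)).

Local Notation omega := (@rho_rk R m n A B trivial_protocol _ _ _ rho M N).

(** With a constant raw key the measurement elements are summed to the identity, so only the
    marginal of Eve remains. *)
Lemma trivial_rho_rk z z' : omega ((tt, tt), (tt, z)) ((tt, tt), (tt,
  z')) = ptr1 rho z z'.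
Proof.
rewrite /rho_rk /sumop (@csum_unit _ _ _ (tt, tt)); last by move=> [[] []].
rewrite /tensor /Defs.proj /= !mulr1 !mul1r mulop_id; last first.
  move=> [[[[[] []] i] [[[] []] j]] [[] k]] [[[[[] []] i'] [[[] []] j']] [[] k']].
  rewrite /tensor /= opAE opBE /= /idop !xpair_eqE !eqxx /=.
  under eq_bigr do rewrite mul1r; under [X in _ * X * _ = _]eq_bigr do rewrite mul1r.
  have /is_povmP[_ ->] := Mpovm (inputA (rkp := trivial_protocol) tt tt).
  have /is_povmP[_ ->] := Npovm (inputB (rkp := trivial_protocol) tt tt).
  by rewrite /idop -!natrM !mulnb.
rewrite /ptr1.
rewrite (@csum_reindex _ (I * J)%type _ (fun ij => (((tt, tt), ij.1), ((tt, tt), ij.2)))).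
- apply: (congr1 (@csum R _)); apply/funext => -[i j] /=.
  by rewrite /joint_state /tensor /= rho_tildeE /= !mulr1 mul1r.
- by move=> [i j] [i' j'] [-> ->].
- by move=> [[[[] []] i] [[[] []] j]] _; exists (i, j).
Qed.

(** Not automatic, because the supremum of an empty set of rates would be minus infinity: the rate 0
    has to be achieved. *)
Lemma trivial_rate_ge0 : (0 <= secret_key_rate omega)%E.
Proof.
have /densityP[psd_rho tr_rho] := rho_dens.
have [psdE trE] := psd_ptr1 psd_rho tr_rho.
(* The empty transcript together with [L] copies of Eve's marginal; with keys of length 0 the final
   state equals the ideal one. *)
pose sg (L : nat) : op R (seq unit * L.-tuple (unit * K))%type := fun s t =>
  Defs.proj R [::] s.1 t.1 * \prod_(i < L) ptr1 rho (tnth s.2 i).2 (tnth t.2 i).2.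
have sg_dens L : density (sg L).
  apply/densityP; split.
    apply: psd_hadamard.
      apply: psd_ext (psd_rank1 (fun s : seq unit * L.-tuple (unit * K) => (s.1 ==
        [::])%:R)) => s t.
      by rewrite rmorph_nat -natrM mulnb.
    apply: psd_prod => i.
    exact: (psd_pull (fun s : seq unit * L.-tuple (unit * K) => (tnth s.2 i).2)).
  have trE' : sumsto (fun q : unit * K => ptr1 rho q.2 q.2) 1.
    apply/(@sumsto_bij K (unit * K)%type (fun z => (tt,
      z)) snd _ _ _ (fun q => ptr1 rho q.2 q.2)) => //.
    by move=> [[] z].
  have H := @sumsto_tuple _ (unit * K)%type L (fun _ q => ptr1 rho q.2 q.2) (fun _ => 1)
    (fun _ q => psd_ge0 q.2 psdE) (fun _ => trE').
  rewrite big1// in H.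
  apply/(@sumsto_reindex _ _ _ (fun e => ([::], e))).
  - by move=> e e' [].
  - move=> [t e]; rewrite /sg /Defs.proj /=; have [-> _|_] := eqVneq t [::];
      first by exists e.
    by rewrite mul0r eqxx.
  - by apply: sumsto_ext H => e; rewrite /sg /Defs.proj /= mul1r.
apply: ereal_sup_ubound; exists 0 => //; split=> //.
exists (fun _ => 0%N), trivial_distillation, sg, (fun _ => 0); split.
- have -> : (fun L : nat => (0%:R / L%:R)%:E) = (fun _ : nat => 0%:E) :> (_ -> \bar R).
    by apply/funext => L; rewrite mul0r.
  have [-> _] := cvg_limn_einf_sup (@cvg_cst (\bar R) 0%E _ \oo _); exact: lexx.
- exact: sg_dens.
- move=> L; rewrite /trace_distance_is mulr0.
  have -> : subop (@final_state R _ _ _ omega L 0 (trivial_distillation L))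
    (@ideal_state R 0 _ (sg L)) =
      fun _ _ => 0.
    apply/funext => -[[k1 k2] [t e]]; apply/funext => -[[k1' k2'] [t' e']].
    rewrite (tuple0 k1) (tuple0 k2) (tuple0 k1') (tuple0 k2').
    apply/eqP; rewrite subr_eq0; apply/eqP.
    have unitT (a : L.-tuple unit) : a = [tuple of nseq L tt].
      by apply: eq_from_tnth => i; case: (tnth a i); case: (tnth _ i).
    rewrite /final_state /sumop (@csum_unit _ _ _ (([tuple of nseq L tt],
      [tuple of nseq L tt]), (tt, tt))); last first.
      by move=> [[a b] [[] []]]; rewrite (unitT a) (unitT b).
    rewrite /ideal_state /scaleop expr0 invr1 mulr1 (bigD1 [tuple])//= big1; last first.
      by move=> k; rewrite (tuple0 k) => /eqP[].
    rewrite addr0 /tensor /sg /Defs.proj /=; congr (_ * (_ * (_ * _))).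
    rewrite /eve_block /tpow; apply: eq_bigr => i _.
    rewrite !tnth_mktuple; case: (tnth e i) => [[] z]; case: (tnth e' i) => [[] z'].
    by case: (tnth _ i); rewrite trivial_rho_rk.
  exists (fun _ _ => 0); split.
  + apply: (@psd_positive _ _ _ 0) => //; first exact: psd0.
    by move=> s v us; rewrite mul0r /qform big1// => i _; rewrite big1// => j _; ring.
  + move=> i j; rewrite /mulop; apply: (congr1 (@csum R _)); apply/funext => k.
    by rewrite !mulr0.
  + exact: sumsto0.
- exact: cvg_cst.
Qed.

End TrivialProtocol.

Lemma di_key_rate_ge0 (R : realType) (m n : nat) (A B : finType) (P : dtuple R m n A B) :
  (1 <= m)%N -> (1 <= n)%N -> (0 <= di_key_rate P)%E.
Proof.
move=> hm hn; apply/ereal_infP => _ [I [J [K [rho [M [N [[rho_dens Mpovm Npovm _]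
  ->]]]]]]].
apply: le_trans (trivial_rate_ge0 (Ordinal hm) (Ordinal hn) rho_dens Mpovm Npovm) _.
by apply: ereal_sup_ubound; eexists.
Qed.

(** * Product raw keys yield no secret key *)

Section Correlations.
Variable R : realType.

(* A product matrix [x w; z y] has determinant zero, the ideal one does not. *)
Lemma product_far_from_diagonal (a0 a1 b0 b1 s D00 D01 D10 D11 : R) :
  0 <= a0 -> 0 <= a1 -> 0 <= b0 -> 0 <= b1 -> 0 <= s ->
  `|a0 * b0 - s / 2| <= D00 -> `|a0 * b1| <= D01 -> `|a1 * b0| <= D10 ->
  `|a1 * b1 - s / 2| <= D11 -> s / 4 <= D00 + D01 + D10 + D11.
Proof.
move=> a00 a10 b00 b10 s0 H00 H01 H10 H11.
have d00 := le_trans (normr_ge0 _) H00; have d01 := le_trans (normr_ge0 _) H01.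
have d10 := le_trans (normr_ge0 _) H10; have d11 := le_trans (normr_ge0 _) H11.
move: H00 H01 H10 H11; rewrite !ler_norml => /andP[h00 _] /andP[_ h01] /andP[_ h10]
  /andP[h11 _].
have [//|lt] := leP (s / 4) (D00 + D01 + D10 + D11).
have x0 : 0 <= a0 * b0 by rewrite mulr_ge0.
have y0 : 0 <= a1 * b1 by rewrite mulr_ge0.
have z0 : 0 <= a0 * b1 by rewrite mulr_ge0.
have w0 : 0 <= a1 * b0 by rewrite mulr_ge0.
have e : (a0 * b0) * (a1 * b1) = (a0 * b1) * (a1 * b0) by ring.
move: x0 y0 z0 w0 e h00 h01 h10 h11.
set x := a0 * b0; set y := a1 * b1; set z := a0 * b1; set w := a1 * b0.
move=> x0 y0 z0 w0 e h00 h01 h10 h11.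
(* A total deviation below [s / 4] keeps both diagonal products above [s / 2 - s / 4] and the sum of
   the off-diagonal ones below [s / 4], which is incompatible with [x * y = z * w]. *)
have hz : z + w < s / 4 by lra.
have hx : s / 4 < x by lra.
have hy : s / 4 < y by lra.
have s4 : 0 <= s / 4 by lra.
have xy : (s / 4) * (s / 4) < x * y by apply: ltr_pM.
have zw : z * w <= (s / 4) * (s / 4).
  have := ler_pM (addr_ge0 z0 w0) (addr_ge0 z0 w0) (ltW hz) (ltW hz).
  have : 0 <= z * w + z * z + w * w by rewrite !addr_ge0 ?mulr_ge0.
  by move: (s / 4 * (s / 4)) => q h1 h2; nra.
by move: (lt_le_trans xy (eq_ind _ (fun q => q <= _) zw _ (esym e))); rewrite ltxx.
Qed.

Lemma sum_thead l (F : l.+1.-tuple bool -> R) (i : bool) :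
  \sum_(k | thead k == i) F k = \sum_(k : l.-tuple bool) F [tuple of i :: k].
Proof.
rewrite (reindex_onto (fun k : l.-tuple bool => [tuple of i :: k]) (fun k =>
  behead_tuple k)) /=.
  apply: eq_bigl => k; rewrite theadE eqxx /=; apply/eqP; exact: val_inj.
move=> k /eqP <-; apply: val_inj; by case/tupleP: k => b k /=; rewrite theadE.
Qed.

(** Keeping only the first bit of each key does not increase the l1-distance; product weights stay
    products and the uniform diagonal becomes [s / 2] on equal bits, which is the 2 by 2 case. Here
    [s] stands for a diagonal entry of Eve's comparison state. *)
Lemma product_key_distance l (gA gB : l.+1.-tuple bool -> R) (s : R) :
  (forall k, 0 <= gA k) -> (forall k, 0 <= gB k) -> 0 <= s ->
  s / 4 <= \sum_k1 \sum_k2 `|gA k1 * gB k2 - 2 ^- l.+1 * (k1 == k2)%:R * s|.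
Proof.
move=> gA0 gB0 s0.
pose D i j := \sum_(k1 | thead k1 == i) \sum_(k2 | thead k2 == j)
  `|gA k1 * gB k2 - 2 ^- l.+1 * (k1 == k2)%:R * s|.
pose a i := \sum_(k | thead k == i) gA k; pose b i := \sum_(k | thead k == i) gB k.
have half i : \sum_(k : l.+1.-tuple bool | thead k == i) (2 ^- l.+1 : R) = 1 / 2.
  rewrite sum_thead sumr_const card_tuple card_bool -[LHS]mulr_natr natrX exprS invfM
    -mulrA.
  by rewrite mulVf ?expf_neq0 ?pnatr_eq0// mulr1 mul1r.
have Dab i j : `|a i * b j - (i == j)%:R * (s / 2)| <= D i j.
  have -> : a i * b j - (i == j)%:R * (s / 2) = \sum_(k1 | thead k1 == i)
      \sum_(k2 | thead k2 == j) (gA k1 * gB k2 - 2 ^- l.+1 * (k1 == k2)%:R * s).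
    under [RHS]eq_bigr do rewrite sumrB.
    rewrite sumrB; congr (_ - _).
      by rewrite /a mulr_suml; apply: eq_bigr => k _; rewrite mulr_sumr.
    have [<-|ij] := eqVneq i j.
      rewrite mul1r; transitivity ((1 / 2) * s); first by rewrite mul1r mulrC.
      rewrite -(half i) mulr_suml; apply: eq_bigr => k1 k1i.
      rewrite (bigD1 k1)//= eqxx mulr1 big1 ?addr0// => k2 /andP[_ /negbTE].
      by rewrite eq_sym => ->; rewrite mulr0 mul0r.
    rewrite mul0r big1// => k1 /eqP k1i; rewrite big1// => k2 /eqP k2j.
    case: eqVneq => [k12|]; last by rewrite mulr0 mul0r.
    by rewrite -k1i -k2j k12 eqxx in ij.
  apply: le_trans (ler_norm_sum _ _ _) _; apply: ler_sum => k1 _.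
  exact: ler_norm_sum.
have a0 i : 0 <= a i by apply: sumr_ge0.
have b0 i : 0 <= b i by apply: sumr_ge0.
have -> : \sum_k1 \sum_k2 `|gA k1 * gB k2 - 2 ^- l.+1 * (k1 == k2)%:R * s| =
    D false false + D false true + D true false + D true true.
  have split2 (F : l.+1.-tuple bool -> R) : \sum_k F k =
      \sum_(k | thead k == false) F k + \sum_(k | thead k == true) F k.
    by rewrite (bigID (fun k : l.+1.-tuple bool => thead k == false)) /=; congr (_ + _);
      apply: eq_bigl => k; case: (thead k).
  have inner i : \sum_(k1 | thead k1 == i)
      \sum_k2 `|gA k1 * gB k2 - 2 ^- l.+1 * (k1 == k2)%:R * s| = D i false + D i true.
    by rewrite /D -big_split; apply: eq_bigr => k1 _; rewrite split2.
  by rewrite split2 !inner addrA.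
have h01 := Dab false true; have h10 := Dab true false.
rewrite /= mul0r subr0 in h01; rewrite /= mul0r subr0 in h10.
have h00 := Dab false false; have h11 := Dab true true.
rewrite /= mul1r in h00; rewrite /= mul1r in h11.
exact: product_far_from_diagonal h00 h01 h10 h11.
Qed.
End Correlations.

(** * Public discussion between the two parties *)

Section Transcripts.
Variables (R : realType) (KA KB : countType) (L l : nat) (D : distillation R KA KB L l).

(* The inputs compatible with a transcript form a combinatorial rectangle. *)
Lemma transcript_rectangle k (t : seq (Msg D)) : exists fA fB,
  forall a b ra rb, (@transcript R KA KB L l D a b ra rb k == t) = fA a ra && fB b rb.
Proof.
elim: k t => [|k IH] t.
  by exists (fun _ _ => [::] == t), (fun _ _ => true) => a b ra rb; rewrite andbT.
case/lastP: t => [|t msg].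
  by exists (fun _ _ => false), (fun _ _ => false) => a b ra rb; rewrite /=;
    case: (transcript _ _ _ _ k).
have [fA [fB fP]] := IH t.
(* Each round constrains only the sender: Alice when [k] is even, Bob when it is odd. *)
exists (fun a ra => fA a ra && (odd k || (sendA a ra t == msg))),
       (fun b rb => fB b rb && (~~ odd k || (sendB b rb t == msg))) => a b ra rb.
rewrite /= eqseq_rcons andbACA -fP.
by have [->|//] := eqVneq (transcript _ _ _ _ _) t; case: (odd k); rewrite /= ?andbT.
Qed.

End Transcripts.

(** * Distillation from keys independent given Eve's classical value *)

Section ProductState.
Variables (R : realType) (KA KB : countType) (E : choiceType).
Local Notation C := R[i].
Variables (c : E -> C) (al : E -> KA -> C) (be : E -> KB -> C).
Hypotheses (c0 : forall e, 0 <= c e) (c1 : forall e, c e <= 1).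
Hypotheses (al0 : forall e k, 0 <= al e k) (be0 : forall e k, 0 <= be e k).
Hypotheses (al1 : forall e (F : {fset KA}), \sum_(k <- F) al e k <= 1)
           (be1 : forall e (F : {fset KB}), \sum_(k <- F) be e k <= 1).
Variable omega : op R ((KA * KB) * E)%type.
Hypothesis omegaE : forall k e k' e', omega (k, e) (k', e') =
  if (k == k') && (e == e') then c e * (al e k.1 * be e k.2) else 0.

Section Distillation.
Variables (L l : nat) (D : distillation R KA KB L l).

Lemma product_eve_block (a : L.-tuple KA) (b : L.-tuple KB) e e' :
  eve_block omega a b e e' = if e == e' then
    (\prod_(i < L) c (tnth e i)) * ((\prod_(i < L) al (tnth e i) (tnth a i)) *
    (\prod_(i < L) be (tnth e i) (tnth b i))) else 0.
Proof.
rewrite /eve_block /tpow; case: eqVneq => [<-|ne].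
  rewrite -!big_split; apply: eq_bigr => i _.
  by rewrite !tnth_mktuple omegaE !eqxx.
have [i ei] : exists i, tnth e i != tnth e' i.
  apply/existsP; rewrite -negb_forall; apply: contra ne => /forallP h.
  by apply/eqP/eq_from_tnth => i; exact/eqP.
by rewrite (bigD1 i)//= !tnth_mktuple omegaE (negbTE ei) andbF mul0r.
Qed.

Lemma sub_distribution_tuple (K : choiceType) (f : E -> K -> C) (e : L.-tuple E) :
  (forall e k, 0 <= f e k) -> (forall e (F : {fset K}), \sum_(k <- F) f e k <= 1) ->
  exists2 s : C, s <= 1 &
    sumsto (fun a : L.-tuple K => \prod_(i < L) f (tnth e i) (tnth a i)) s.
Proof.
move=> f0 f1; have fl e0 := @sumsto_bounded _ _ _ 1 (f0 e0) (f1 e0).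
have fs e0 : sumsto (f e0) (csum (f e0)) by exact/csumP.
exists (\prod_(i < L) csum (f (tnth e i))); last first.
  by apply: (@sumsto_tuple _ K L (fun i => f (tnth e i))) => // i.
apply: prodr_ile1 => i _; rewrite (sumsto_ge0 (f0 _) (fs _)) /=.
by apply: (sumsto_le (A0 := fset0) (fs _)) => A _; exact: f1.
Qed.

Lemma sub_distribution_event (K S : choiceType) (f : K -> C) (q : S -> R) (P : K * S ->
  bool) s :
  (forall k, 0 <= f k) -> is_pmf q -> s <= 1 -> sumsto f s ->
  exists2 g : C, 0 <= g <= 1 &
    sumsto (fun x : K * S => (f x.1 * (q x.2)%:C) * (P x)%:R) g.
Proof.
move=> f0 [q0 q1] s1 fs.
have q1' : sumsto (fun r => (q r)%:C : C) 1 by have := (sumsto_realC q 1).1 q1.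
have q0' r : 0 <= (q r)%:C :> C by rewrite ler0c.
have fq := sumsto_prod f0 q0' fs q1'; rewrite mulr1 in fq.
have g0 x : 0 <= (f x.1 * (q x.2)%:C) * (P x)%:R by rewrite !mulr_ge0.
have gle x : (f x.1 * (q x.2)%:C) * (P x)%:R <= f x.1 * (q x.2)%:C.
  by rewrite ler_piMr ?mulr_ge0// lern1 leq_b1.
have [g gs] : exists g, sumsto (fun x : K * S => (f x.1 * (q x.2)%:C) * (P x)%:R) g.
  apply: (@sumsto_bounded _ _ _ s) => // A.
  apply: le_trans (sumsto_partial_le A _ fq); first by apply: ler_sum.
  by move=> x; rewrite mulr_ge0.
exists g => //; rewrite (sumsto_ge0 g0 gs) /=.
exact: le_trans (sumsto_le_sumsto gle gs fq) s1.
Qed.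

Local Notation Z := (seq (Msg D) * L.-tuple E)%type.
Local Notation F := (@final_state R KA KB E omega L l D).

Lemma final_state_offdiag p q : p != q -> F p q = 0.
Proof.
case: p q => [[ka kb] [t e]] [[ka' kb'] [t' e']] ne.
rewrite /final_state /sumop; apply: csum_eq; apply: sumsto_ext (@sumsto0 _ _).
move=> [[a b] [ra rb]]; rewrite /scaleop /tensor /Defs.proj /= product_eve_block.
set tr := transcript _ _ _ _ _.
case: (boolP ((ka == keyA a ra tr) && (ka' == keyA a ra tr))) => [/andP[/eqP E1 /eqP
  E2]|_]; last by rewrite !(mul0r, mulr0).
case: (boolP ((kb == keyB b rb tr) && (kb' == keyB b rb tr))) => [/andP[/eqP E3 /eqP
  E4]|_]; last by rewrite !(mul0r, mulr0).
case: (boolP ((t == tr) && (t' == tr))) => [/andP[/eqP E5 /eqP E6]|_];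
  last by rewrite !(mul0r, mulr0).
case: (eqVneq e e') => [E7|_]; last by rewrite !(mul0r, mulr0).
by rewrite E1 E2 E3 E4 E5 E6 E7 eqxx in ne.
Qed.

Lemma final_state_diag (z : Z) : exists gA gB : l.-tuple bool -> C,
  [/\ forall k, 0 <= gA k <= 1, forall k, 0 <= gB k <= 1 &
      forall ka kb, F ((ka, kb), z) ((ka, kb), z) = gA ka * gB kb].
Proof.
case: z => [t e].
have [fA [fB tP]] := transcript_rectangle (D := D) (rounds D) t.
have [sA sA1 alS] := sub_distribution_tuple e al0 al1.
have [sB sB1 beS] := sub_distribution_tuple e be0 be1.
(* The key map is evaluated at the fixed [t] instead of the actual transcript; compatibility with
   [t] is imposed separately, so this condition no longer involves Bob's data. *)
pose PA ka (x : L.-tuple KA * RA D) := (ka == keyA x.1 x.2 t) && fA x.1 x.2.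
pose PB kb (x : L.-tuple KB * RB D) := (kb == keyB x.1 x.2 t) && fB x.1 x.2.
pose alL (a : L.-tuple KA) := \prod_(i < L) al (tnth e i) (tnth a i).
pose beL (b : L.-tuple KB) := \prod_(i < L) be (tnth e i) (tnth b i).
have alL0 a : 0 <= alL a by exact: prodr_ge0.
have beL0 a : 0 <= beL a by exact: prodr_ge0.
have gAP ka := sub_distribution_event (PA ka) alL0 (pRA_pmf D) sA1 alS.
have gBP kb := sub_distribution_event (PB kb) beL0 (pRB_pmf D) sB1 beS.
pose cL := \prod_(i < L) c (tnth e i).
have cL0 : 0 <= cL by exact: prodr_ge0.
have cL1 : cL <= 1 by apply: prodr_ile1 => i _; rewrite c0 c1.
(* The weight [cL] of Eve's value is put into Alice's factor. *)
exists (fun ka => cL * s2val (cid2 (gAP ka))), (fun kb => s2val (cid2 (gBP kb))); split.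
- move=> ka; case: cid2 => /= g /andP[g0 g1] _.
  by rewrite mulr_ge0//= mulr_ile1.
- by move=> kb; case: cid2.
move=> ka kb; case: cid2 => /= g /andP[g0 g1] gS; case: cid2 => /= g' /andP[g'0 g'1] gS'.
rewrite /final_state /sumop; apply: csum_eq.
have pos x : 0 <= (alL x.1 * (pRA x.2)%:C) * (PA ka x)%:R :> C.
  by rewrite !mulr_ge0// ler0c; have [] := pRA_pmf D.
have pos' x : 0 <= (beL x.1 * (pRB x.2)%:C) * (PB kb x)%:R :> C.
  by rewrite !mulr_ge0// ler0c; have [] := pRB_pmf D.
have H := sumstoZ cL (sumsto_prod pos pos' gS gS').
pose sh (w : (L.-tuple KA * L.-tuple KB) * (RA D * RB D)) :=
  ((w.1.1, w.2.1), (w.1.2, w.2.2)).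
pose sh' (w : (L.-tuple KA * RA D) * (L.-tuple KB * RB D)) :=
  ((w.1.1, w.2.1), (w.1.2, w.2.2)).
have shK : cancel sh sh' by move=> [[? ?] [? ?]].
have sh'K : cancel sh' sh by move=> [[? ?] [? ?]].
rewrite -mulrA; move/(sumsto_bij shK sh'K): H; apply: sumsto_ext => -[[a b] [ra rb]].
rewrite /scaleop /tensor /Defs.proj /= product_eve_block eqxx !andbb.
have := tP a b ra rb; rewrite [t == _]eq_sym => ->; rewrite /PA /PB /=.
case: (boolP (fA a ra && fB b rb)) => [fAB|]; last first.
  rewrite negb_and => /orP[] /negbTE ->; by rewrite ?andbF !(mul0r, mulr0).
have /eqP -> : transcript (D := D) a b ra rb (rounds D) == t by rewrite tP.
case/andP: fAB => -> ->; rewrite !andbT rmorphM /= -/cL -/(alL a) -/(beL b).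
ring.
Qed.

End Distillation.
End ProductState.

Section DiagonalOperators.
Variables (R : realType) (I : choiceType) (d : I -> R[i]) (T : op R I).
Hypotheses (d01 : forall i, 0 <= d i <= 1) (Td : forall i j,
  T i j = if i == j then d i else 0).

Lemma diagonal_psd : psd T.
Proof.
have psdX : psd (fun i j => (i == j)%:R * (sqrtC (d i) * (sqrtC (d j))^*)).
  by apply: psd_hadamard; [exact: psd_id|exact: psd_rank1].
apply: psd_ext psdX => i j; rewrite Td; case: eqVneq => [<-|_]; last by rewrite mul0r.
have /andP[d0 _] := d01 i.
by rewrite mul1r -normCK ger0_norm ?sqrtC_ge0// sqrtCK.
Qed.

Lemma diagonal_qbound : qbound 1 T.
Proof.
apply/qbound_effect.
have psdX : psd (fun i j => (i == j)%:R * (sqrtC (1 - d i) * (sqrtC (1 - d j))^*)).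
  by apply: psd_hadamard; [exact: psd_id|exact: psd_rank1].
apply: psd_ext psdX => i j; rewrite Td; case: eqVneq => [<-|_]; last first.
  by rewrite mul0r mulr0 subr0.
have /andP[_ d1] := d01 i; have d1' : 0 <= 1 - d i by rewrite subr_ge0.
by rewrite !mul1r -normCK ger0_norm ?sqrtC_ge0// sqrtCK.
Qed.

End DiagonalOperators.

(** * Trace distance from product states to ideal keys *)

Section Converse.
Variables (R : realType) (KA KB : countType) (E : choiceType).
Local Notation C := R[i].

Section Ideal.
Variables (l : nat) (F : choiceType) (sigma : op R F).
Hypotheses (psd_s : psd sigma) (s1 : qbound 1 sigma).

Lemma ideal_stateE p q : @ideal_state R l F sigma p q =
  (if p.1 == q.1 then ((2 ^- l * (p.1.1 == p.1.2)%:R : R)%:C) else 0) * sigma p.2 q.2.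
Proof.
rewrite /ideal_state /scaleop /tensor /Defs.proj.
case: p q => [[k1 k2] z] [[k1' k2'] z'] /=.
rewrite -mulr_suml mulrA; congr (_ * _).
rewrite (bigD1 k1)//= big1 ?addr0; last first.
  by move=> k; rewrite eq_sym => /negbTE ->; rewrite !mul0r.
rewrite eqxx xpair_eqE /= [k1' == _]eq_sym [k2 == k1]eq_sym.
have [_|_] := eqVneq k1 k1'; last by rewrite mul0r mulr0.
have [<-|k12] := eqVneq k1 k2 => /=.
  by rewrite mulr1 mul1r [k2' == _]eq_sym; case: eqP; rewrite ?mulr1 ?mulr0.
by rewrite !mulr0; case: ifP.
Qed.

Lemma ideal_diag01 (k : l.-tuple bool * l.-tuple bool) :
  0 <= ((2 ^- l * (k.1 == k.2)%:R : R)%:C) <= (1 : C).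
Proof.
rewrite ler0c -(rmorph1 (real_complex R)) lecR mulr_ge0 ?invr_ge0 ?exprn_ge0 ?ler0n//=.
apply: mulr_ile1; rewrite ?invr_ge0 ?exprn_ge0 ?ler0n//.
  by rewrite invf_le1 ?exprn_gt0// exprn_ege1// ler1n.
by rewrite lern1 leq_b1.
Qed.

Lemma ideal_state_psd : psd (@ideal_state R l F sigma).
Proof.
pose Dg : op R (l.-tuple bool * l.-tuple bool)%type := fun p q =>
  if p == q then ((2 ^- l * (p.1 == p.2)%:R : R)%:C) else 0.
apply: psd_ext (psd_tensorop (@diagonal_psd R _ _ Dg ideal_diag01 (fun _ _ => erefl))
  psd_s).
by move=> p q; rewrite ideal_stateE.
Qed.

Lemma ideal_state_qbound : qbound 1 (@ideal_state R l F sigma).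
Proof.
pose Dg : op R (l.-tuple bool * l.-tuple bool)%type := fun p q =>
  if p == q then ((2 ^- l * (p.1 == p.2)%:R : R)%:C) else 0.
have -> : @ideal_state R l F sigma = tensor Dg sigma.
  by apply/funext => p; apply/funext => q; rewrite ideal_stateE.
apply: qbound_tensorop => //.
  exact: (@diagonal_psd R _ _ Dg ideal_diag01).
exact: (@diagonal_qbound R _ _ Dg ideal_diag01).
Qed.

End Ideal.

(** As [G] and [H] lie between 0 and 1, their difference lies between -1 and 1 and [diag_le_sqrt]
    applies to it; the trace of the square root bounds the diagonal. *)
Lemma trace_norm_diag_bound (I : choiceType) (G H : op R I) (d : R) (s : seq I) :
  psd G -> psd H -> qbound 1 G -> qbound 1 H -> trace_norm_is (subop G H) d ->
  uniq s -> \sum_(i <- s) `|G i i - H i i| <= d%:C.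
Proof.
move=> psdG psdH G1 H1 [S [Spos SS Sd]] us.
have psdS := positive_psd Spos; have [k k0 Sk] := positive_qbound Spos.
have le i : `|subop G H i i| <= S i i.
  apply: (@diag_le_sqrt R I S (subop G H) k 1 i k0 ler01 psdS Sk).
  - by move=> p q; rewrite /subop rmorphB (psd_herm p q psdG) (psd_herm p q psdH).
  - move=> t v ut; rewrite /subop qformB.
    apply: (@le_trans _ _ (qform G t v v)); last by rewrite rmorph1; exact: G1.
    by rewrite gerBl psdH.
  - move=> t v ut; rewrite (eq_qform (T' := fun p q => H p q - G p q) (u' := v) (v' :=
      v))//.
      rewrite qformB; apply: (@le_trans _ _ (qform H t v v)); last by rewrite rmorph1;
        exact: H1.
      by rewrite gerBl psdG.
    by move=> p q _ _; rewrite /subop opprB.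
  (* The bound of [sqr_normD_le] at [eta = 1], with columns of [G] and [H] of norm at most 1. *)
  - move=> j; exists ((1 + 1) * 1 ^+ 2 + (1 + 1^-1) * 1 ^+ 2) => A.
    apply: (@le_trans _ _ ((1 + 1) * sqnorm A (fun p => G p j) + (1 + 1^-1) * sqnorm A
      (fun p => H p j))).
      rewrite /sqnorm !mulr_sumr -big_split; apply: ler_sum => p _.
      by rewrite -(normrN (H p j)); apply: sqr_normD_le.
    apply: lerD; (apply: ler_wpM2l; first by rewrite ?invr1 addr_ge0).
      exact: psd_column_bound.
    exact: psd_column_bound.
  - exact: SS.
apply: (@le_trans _ _ (\sum_(i <- s) S i i)); first by apply: ler_sum => i _; exact: le.
by apply: sumsto_seq_le Sd => // i; exact: psd_ge0.
Qed.

Section Product.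
Variables (c : E -> C) (al : E -> KA -> C) (be : E -> KB -> C).
Hypotheses (c0 : forall e, 0 <= c e) (c1 : forall e, c e <= 1).
Hypotheses (al0 : forall e k, 0 <= al e k) (be0 : forall e k, 0 <= be e k).
Hypotheses (al1 : forall e (F : {fset KA}), \sum_(k <- F) al e k <= 1)
           (be1 : forall e (F : {fset KB}), \sum_(k <- F) be e k <= 1).
Variable omega : op R ((KA * KB) * E)%type.
Hypothesis omegaE : forall k e k' e', omega (k, e) (k', e') =
  if (k == k') && (e == e') then c e * (al e k.1 * be e k.2) else 0.

(** For each [z], [sigma z z] is at most 4 times the diagonal deviation over the keys. Summing over
    [z] gives 1 on the left and at most 4 times the trace norm [2 * d] on the right. *)
Lemma product_state_distance L l (D : distillation R KA KB L l) sigma d :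
  (0 < l)%N -> density sigma ->
  trace_distance_is (@final_state R KA KB E omega L l D) (@ideal_state R l _ sigma) d ->
  1 <= 8 * d.
Proof.
case: l D sigma => [//|l] D sigma _ /densityP[psd_s tr_s] dist.
set F := @final_state R KA KB E omega L l.+1 D in dist.
have Fdiag p : exists g, F p p = g /\ 0 <= g <= 1.
  case: p => [[ka kb] z].
  have [gA [gB [gA01 gB01 Fz]]] := final_state_diag c0 c1 al0 be0 al1 be1 omegaE z.
  exists (gA ka * gB kb); split; first exact: Fz.
  have /andP[? ?] := gA01 ka; have /andP[? ?] := gB01 kb.
  by rewrite mulr_ge0//= mulr_ile1.
have F01 p : 0 <= F p p <= 1 by have [g [-> ]] := Fdiag p.
have FE p q : F p q = if p == q then F p p else 0.
  by case: eqVneq => [<-//|ne]; apply: (final_state_offdiag omegaE).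
have psdF := @diagonal_psd R _ _ F F01 FE; have F1 := @diagonal_qbound R _ _ F F01 FE.
have s1 := psd_trace_qbound psd_s tr_s.
have key z : sigma z z <= 4 * \sum_(k : l.+1.-tuple bool * l.+1.-tuple bool)
   `|F (k, z) (k, z) - @ideal_state R l.+1 _ sigma (k, z) (k, z)|.
  have [gA [gB [gA01 gB01 Fz]]] := final_state_diag c0 c1 al0 be0 al1 be1 omegaE z.
  have s0 := psd_ge0 z psd_s.
  have reA k : (complex.Re (gA k))%:C = gA k by apply: ge0_Re; have /andP[] := gA01 k.
  have reB k : (complex.Re (gB k))%:C = gB k by apply: ge0_Re; have /andP[] := gB01 k.
  have reS := ge0_Re s0.
  have := @product_key_distance R l (fun k => complex.Re (gA k)) (fun k => complex.Re
    (gB k))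
    (complex.Re (sigma z z)).
  rewrite -!ler0c reS => /(_ _ _ s0) H.
  have {H} : complex.Re (sigma z z) / 4 <= \sum_k1 \sum_k2
    `|complex.Re (gA k1) * complex.Re (gB k2) - 2 ^- l.+1 * (k1 == k2)%:R * complex.Re
      (sigma z z)|.
    by apply: H => k; rewrite -ler0c ?reA ?reB;
      [have /andP[] := gA01 k|have /andP[] := gB01 k].
  rewrite pair_bigA ler_pdivrMr// mulrC -lecR reS rmorphM rmorph_nat rmorph_sum /=.
  move=> H; apply: le_trans H _; apply: ler_wpM2l => //.
  rewrite le_eqVlt; apply/orP; left; apply/eqP/eq_bigr => -[k1 k2] _ /=.
  rewrite [F _ _]Fz ideal_stateE /= eqxx -normc_real rmorphB !rmorphM /= reA reB reS.
  by [].
have dle (A : {fset seq (Msg D) * L.-tuple E}) : \sum_(z <- A) sigma z z <= 4 * (2 *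
  d)%:C.
  apply: (@le_trans _ _ (\sum_(z <- A) 4 * \sum_(k : l.+1.-tuple bool * l.+1.-tuple bool)
      `|F (k, z) (k, z) - @ideal_state R l.+1 _ sigma (k, z) (k, z)|)).
    by apply: ler_sum => z _; exact: key.
  rewrite -mulr_sumr exchange_big; apply: ler_wpM2l => //.
  rewrite -(@big_allpairs _ _ _ _ _ (index_enum _) A
    (fun p => `|F p p - @ideal_state R l.+1 _ sigma p p|)).
  apply: trace_norm_diag_bound dist _ => //.
  - exact: ideal_state_psd.
  - exact: ideal_state_qbound.
  - apply: allpairs_uniq; rewrite ?index_enum_uniq ?fset_uniq//.
    by move=> [? ?] [? ?].
have := sumsto_le (A0 := fset0) tr_s (fun A _ => dle A).
rewrite -(rmorph1 (real_complex R)) -(rmorph_nat (real_complex R)) -rmorphM lecR mulrA.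
by rewrite -natrM.
Qed.

Lemma product_state_rate_le0 : (secret_key_rate omega <= 0)%E.
Proof.
apply/ereal_supP => _ [r [r0 [l [D [sigma [d [lr sd dist d0]]]]]] <-].
rewrite lee_fin leNgt; apply/negP => r_gt0.
have [N _ dN] : \forall L \near \oo, `|0 - d L| < 8^-1.
  by move/cvgrPdist_lt: d0; apply; rewrite invr_gt0.
(* A key of positive length would require distance at least 1/8. *)
have lN L : (N <= L)%N -> l L = 0%N.
  move=> NL; case: (posnP (l L)) => // lpos.
  have h1 := product_state_distance lpos (sd L) (dist L).
  have := dN L NL; rewrite /= sub0r normrN => /(le_lt_trans (ler_norm _)).
  by rewrite -(ltr_pM2l (x := 8))// divff// ltNge h1.
have : limn_einf (fun L => ((l L)%:R / L%:R)%:E) = 0%:E :> \bar R.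
  apply: (cvg_limn_einf_sup _).1; apply: cvg_near_cst; exists N => // L /lN lL.
  by rewrite lL mul0r.
by move=> lim0; move: lr; rewrite lim0 lee_fin leNgt r_gt0.
Qed.

End Product.
End Converse.

(** * Deterministic tuples *)

Section SubStochastic.
Variable R : realType.
Local Notation C := R[i].

Lemma is_pmf_le1 (I : choiceType) (f : I -> R) i : is_pmf f -> f i <= 1.
Proof. by move=> [f0 f1]; have := @sumsto_seq_le _ _ f 1 [:: i] f0 isT f1;
  rewrite big_seq1. Qed.

Variables (X K : choiceType) (q : X -> R) (g : X -> K -> R).
Hypotheses (q_pmf : is_pmf q) (g_pmf : forall x, is_pmf (g x)).

(** The law of a raw key character given the public value, the private variable being averaged
    out. *)
Definition average k : C := csum (fun x => (q x * g x k)%:C).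

Lemma average_term_ge0 x k : 0 <= (q x * g x k)%:C :> C.
Proof. by rewrite ler0c mulr_ge0//; [have [] := q_pmf|have [] := g_pmf x]. Qed.

Let q1 : sumsto (fun x => (q x)%:C : C) 1.
Proof. by have [_ h] := q_pmf; exact: (sumsto_realC q 1).1 h. Qed.

Lemma average_sumsto k : sumsto (fun x => (q x * g x k)%:C : C) (average k).
Proof.
apply: csumP; apply: (@sumsto_bounded _ _ _ 1) => [x|A]; first exact: average_term_ge0.
apply: (@le_trans _ _ (\sum_(x <- A) (q x)%:C)).
  apply: ler_sum => x _; rewrite lecR ler_piMr//; first by have [] := q_pmf.
  exact: is_pmf_le1.
by apply: sumsto_partial_le q1 => x; rewrite ler0c; have [] := q_pmf.
Qed.

Lemma average_ge0 k : 0 <= average k.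
Proof. by apply: sumsto_ge0 (@average_sumsto k) => x; exact: average_term_ge0. Qed.

Lemma average_sum_le1 (F : {fset K}) : \sum_(k <- F) average k <= 1.
Proof.
have H := @sumsto_sum _ _ _ F _ _ (@average_sumsto).
apply: (sumsto_le_sumsto _ H q1) => x; rewrite -rmorph_sum lecR -mulr_sumr ler_piMr//.
  by have [] := q_pmf.
by have [g0 g1] := g_pmf x; exact: sumsto_partial_le g1.
Qed.

End SubStochastic.

Lemma tensorE (R : realType) (I J : choiceType) (S : op R I) (T : op R J) p q :
  tensor S T p q = S p.1 q.1 * T p.2 q.2.
Proof. by []. Qed.

Section Deterministic.
Variables (R : realType) (m n : nat) (A B : finType).
Variables (s : {ffun 'I_m -> A}) (t : {ffun 'I_n -> B}).
Local Notation C := R[i].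
Local Notation D0 := (deterministic R s t).

Definition pure_state : op R ((unit * unit) * unit)%type := fun _ _ => 1.
Definition pure_povm (J : Type) (O : finType) (f : J -> O) (x : J) (o : O) : op R unit :=
  fun _ _ => (o == f x)%:R.

Lemma deterministic_distribution : is_distribution D0.
Proof.
move=> x y; split=> [a b|]; first by rewrite mulr_ge0.
under eq_bigr do rewrite -mulr_sumr.
have sum1 (T : finType) (u0 : T) : \sum_u (u == u0)%:R = 1 :> R.
  by rewrite -[RHS](@sum_eq_indicator R T (fun=> 1) u0); apply: eq_bigr => u _;
    rewrite mulr1.
by rewrite -mulr_suml !sum1 mulr1.
Qed.

Lemma pure_povm_is_povm (J : Type) (O : finType) (f : J ->
  O) (x : J) : is_povm (pure_povm f x).
Proof.
apply/is_povmP; split=> [o|[] []].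
  apply: psd_ext (psd_rank1 (fun _ : unit => (o == f x)%:R : C)) => i j.
  by rewrite rmorph_nat -natrM mulnb andbb.
rewrite /pure_povm /idop (bigD1 (f x))//= eqxx big1 ?addr0// => o /negbTE ->.
by [].
Qed.

Lemma deterministic_realization :
  quantum_realization D0 pure_state (pure_povm s) (pure_povm t).
Proof.
split.
- apply/densityP; split.
    by apply: psd_ext (psd_rank1 (fun _ => 1 : C)) => i j; rewrite rmorph1 mulr1.
  by apply: (@sumsto1 _ _ (fun _ : (unit * unit) * unit => 1 : C) ((tt, tt),
    tt)) => -[[[] []] []].
- exact: pure_povm_is_povm.
- exact: pure_povm_is_povm.
- move=> x y a b; rewrite /tr (@csum_unit _ _ _ ((tt, tt), tt));
    last by move=> [[[] []] []].
  rewrite /mulop (@csum_unit _ _ _ ((tt, tt), tt)); last by move=> [[[] []] []].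
  by rewrite /tensor /pure_povm /idop /pure_state /= mul1r mulr1 rmorphM !rmorph_nat.
Qed.

Variable rkp : raw_key_protocol R m n A B.
Local Notation omega := (@rho_rk R m n A B rkp unit unit unit pure_state (pure_povm s)
  (pure_povm t)).

Let gA (e : TE rkp) (x : TX rkp) : KA rkp -> R := genA (s (inputA x e)) x e.
Let gB (e : TE rkp) (y : TY rkp) : KB rkp -> R := genB (t (inputB y e)) y e.
Let al (e : TE rkp * unit) := average (pX e.1) (gA e.1).
Let be (e : TE rkp * unit) := average (pY e.1) (gB e.1).

Lemma pure_opA (k : KA rkp) x1 x2 i1 i2 :
  opA (pure_povm s) k (x1, i1) (x2, i2) =
  if x1 == x2 then (gA x1.2 x1.1 k)%:C else 0.
Proof.
rewrite opAE; case: ifP => // _;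
  rewrite (bigD1 (s (inputA x1.1 x1.2)))//= /pure_povm eqxx mulr1.
by rewrite big1 ?addr0// => u /negbTE ->; rewrite mulr0.
Qed.

Lemma pure_opB (k : KB rkp) y1 y2 j1 j2 :
  opB (pure_povm t) k (y1, j1) (y2, j2) =
  if y1 == y2 then (gB y1.2 y1.1 k)%:C else 0.
Proof.
rewrite opBE; case: ifP => // _;
  rewrite (bigD1 (t (inputB y1.1 y1.2)))//= /pure_povm eqxx mulr1.
by rewrite big1 ?addr0// => u /negbTE ->; rewrite mulr0.
Qed.

Lemma pure_joint a1 b1 e1 a2 b2 e2 z1 z2 :
  @joint_state R m n A B rkp _ _ _ pure_state (((a1, tt), (b1, tt)), (e1, z1)) (((a2,
    tt), (b2, tt)), (e2, z2)) =
  if [&& a1 == a2, b1 == b2, e1 == e2, a1.2 == e1 & b1.2 == e1]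
  then (pX e1 a1.1 * pY e1 b1.1 * pE e1)%:C else 0.
Proof. by rewrite /joint_state /tensor /pure_state rho_tildeE mulr1. Qed.

(** The outcomes are functions of the inputs, and the private variables are independent given the
    public value; hence the product form required for the converse. *)
Lemma pure_rho_rk k e k' e' : omega (k, e) (k', e') =
  if (k == k') && (e == e') then (pE e.1)%:C * (al e k.1 * be e k.2) else 0.
Proof.
rewrite /rho_rk /sumop (csum_single (i0 := k)); last first.
  move=> w wk; rewrite /tensor /Defs.proj /=.
  have [E1|_] := eqVneq k.1 w.1; last by rewrite !mul0r.
  have [E2|_] := eqVneq k.2 w.2; last by rewrite mulr0 !mul0r.
  by case/eqP: wk; case: k w E1 E2 => [? ?] [? ?] /= -> ->.
rewrite !tensorE /Defs.proj /= !eqxx /= -natrM mulnb.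
have -> : (k'.1 == k.1) && (k'.2 == k.2) = (k == k').
  by rewrite [k == k']eq_sym; case: k k' => [? ?] [? ?]; rewrite xpair_eqE.
case: (k == k'); rewrite /= ?mul0r// mul1r.
case: e e' => [e []] [e' []].
have mulopE a b a' b' : mulop (@joint_state R m n A B rkp _ _ _ pure_state)
   (tensor (tensor (opA (pure_povm s) k.1) (opB (pure_povm t) k.2)) (@idop R _))
   (((a, tt), (b, tt)), (e, tt)) (((a', tt), (b', tt)), (e', tt)) =
   if [&& a == a', b == b', e == e', a.2 == e & b.2 == e]
   then (pE e)%:C * ((pX e a.1 * gA e a.1 k.1)%:C * (pY e b.1 * gB e b.1 k.2)%:C) else 0.
  rewrite /mulop (csum_single (i0 := (((a, tt), (b, tt)), (e, tt)))); last first.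
    move=> [[[a2 []] [b2 []]] [e2 []]] ne; rewrite pure_joint.
    case: ifP => [/and5P[/eqP E1 /eqP E2 /eqP E3 _ _]|_]; last by rewrite mul0r.
    by rewrite E1 E2 E3 eqxx in ne.
  rewrite pure_joint !eqxx /= /tensor /= pure_opA pure_opB /idop xpair_eqE eqxx andbT.
  case: (boolP ((a.2 == e) && (b.2 == e))) => [/andP[/eqP E1 /eqP E2]|_]; last first.
    by rewrite mul0r !andbF.
  rewrite E1 E2 !andbT.
  case: (a == a'); case: (b == b'); case: (e == e') => /=; rewrite ?(mul0r, mulr0)//.
  by rewrite mulr1 !rmorphM /=; ring.
rewrite /ptr1; have [ee|ee] := eqVneq e e'; last first.
  rewrite xpair_eqE (negbTE ee) /=; apply: csum_eq; apply: sumsto_ext (@sumsto0 _ _).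
  by move=> [[a []] [b []]]; rewrite mulopE (negbTE ee) !andbF.
subst e'; rewrite eqxx (@csum_reindex _ (TX rkp * TY rkp)%type _ (fun w => (((w.1, e),
  tt), ((w.2, e), tt)))); first last.
- move=> [[a []] [b []]]; rewrite mulopE;
    case: ifP => [/and5P[_ _ _ /eqP E1 /eqP E2] _|_].
    by exists (a.1, b.1); case: a b E1 E2 => [? ?] [? ?] /= -> ->.
  by rewrite eqxx.
- by move=> [x y] [x' y'] [-> ->].
apply: csum_eq.
have pAx x := average_term_ge0 (pX_pmf e) (fun x => genA_pmf (s (inputA x e)) x e) x k.1.
have pBx y := average_term_ge0 (pY_pmf e) (fun y => genB_pmf (t (inputB y e)) y e) y k.2.
have sA := @average_sumsto _ _ _ _ _ (pX_pmf e) (fun x => genA_pmf (s (inputA x e)) x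
  e) k.1.
have sB := @average_sumsto _ _ _ _ _ (pY_pmf e) (fun y => genB_pmf (t (inputB y e)) y
  e) k.2.
have H := sumstoZ (pE e)%:C (sumsto_prod pAx pBx sA sB).
apply: sumsto_ext H => -[x y] /=.
by rewrite mulopE !eqxx.
Qed.

Lemma deterministic_rate_le0 : (secret_key_rate omega <= 0)%E.
Proof.
apply: (@product_state_rate_le0 _ _ _ _ (fun e => (pE e.1)%:C) al be).
- by move=> e; rewrite ler0c; have [] := pE_pmf rkp.
- by move=> e; rewrite -(rmorph1 (real_complex R)) lecR; apply: is_pmf_le1; exact: pE_pmf.
- by move=> e k; apply: average_ge0; [exact: pX_pmf|move=> x; exact: genA_pmf].
- by move=> e k; apply: average_ge0; [exact: pY_pmf|move=> y; exact: genB_pmf].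
- by move=> e F; apply: average_sum_le1; [exact: pX_pmf|move=> x; exact: genA_pmf].
- by move=> e F; apply: average_sum_le1; [exact: pY_pmf|move=> y; exact: genB_pmf].
- exact: pure_rho_rk.
Qed.

End Deterministic.

Lemma di_key_rate_deterministic (R : realType) (m n : nat) (A B : finType)
    (s : {ffun 'I_m -> A}) (t : {ffun 'I_n -> B}) :
  (di_key_rate (deterministic R s t) <= 0)%E.
Proof.
apply: (@le_trans _ _ (ereal_sup [set v | exists rkp : raw_key_protocol R m n A B,
   v = secret_key_rate (@rho_rk R m n A B rkp _ _ _ (@pure_state R) (pure_povm R s)
     (pure_povm R t))])).
  apply: ereal_inf_lbound.
  by do 6!eexists; split; first exact: deterministic_realization.
apply/ereal_supP => _ [rkp ->]; exact: deterministic_rate_le0.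
Qed.

(** With [p0 = 1] the mixture ignores [P], so Bell local tuples lie below every tuple. *)
Lemma bell_local_not_more_nonlocal (R : realType) (m n : nat) (A B : finType)
    (P P' : dtuple R m n A B) : bell_local P' -> not_less_nonlocal P P'.
Proof.
move=> P'loc; exists 0%N, 1, (fun _ => 0), P', (fun _ => [::]); split=> //.
  by rewrite big_ord0 addr0.
by move=> x y a b; rewrite big_ord0 addr0 mul1r.
Qed.

Theorem proposition1 (R : realType) (m n : nat) (hm : (1 <= m)%N)
    (hn : (1 <= n)%N) (A B : finType) :
  (forall P P' : dtuple R m n A B,
     quantum P -> quantum P' -> not_less_nonlocal P P' ->
     (di_key_rate P' <= di_key_rate P)%E) /\
  (forall P : dtuple R m n A B,
     bell_local P -> di_key_rate P = 0%E).
Proof.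
split=> [P P' [Pdist _] _|P Ploc]; first exact: di_key_rate_mono.
(* Alphabets may be empty: a deterministic strategy exists because the weights of a Bell local tuple
   sum to 1, which an empty sum cannot. *)
have [s [t _]] : exists (s : {ffun 'I_m -> A}) (t : {ffun 'I_n -> B}), True.
  have [q [_ q1 _]] := Ploc.
  have [/existsP[s _]|] := boolP [exists s : {ffun 'I_m -> A}, true].
    have [/existsP[t _]|] := boolP [exists t : {ffun 'I_n -> B}, true];
      first by exists s, t.
    rewrite negb_exists => /forallP not; exfalso.
    move: q1; rewrite big1 => [/esym/eqP|s' _]; first by rewrite oner_eq0.
    by rewrite big1// => t; have := not t.
  rewrite negb_exists => /forallP nos; exfalso.
  move: q1; rewrite big1 => [/esym/eqP|s _]; first by rewrite oner_eq0.
  by have := nos s.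
apply/eqP; rewrite eq_le di_key_rate_ge0// andbT.
apply: le_trans (di_key_rate_deterministic R s t).
apply: di_key_rate_mono; first exact: deterministic_distribution.
exact: bell_local_not_more_nonlocal.
Qed.
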